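(* Fix $n$ and $h$ with $n\ge h\ge 3$. Any two combinatorial 4-PPTs with $n$ vertices, $h$ of which lie on the outer face, can be transformed into each other by a finite sequence of flips (the unlabeled flip graph is connected), and there is an absolute constant $C$ such that $Cn^2$ flips always suffice (diameter $O(n^2)$). The same holds for labeled combinatorial 4-PPTs: for any two labeled combinatorial 4-PPTs on the same $n$ labeled vertices with the same outer face (the same $h$ labeled vertices in the same cyclic order along the outer face), there is a sequence of $O(n^2)$ flips transforming one into the other.
   Context: An angle of a plane embedded graph is an incidence between a vertex and a face (the wedge between two consecutive edges around the vertex). A combinatorial pseudo-triangulation is a combinatorial embedding in the plane (rotation system together with a designated outer face) of a connected planar simple graph, together with an assignment of a tag ''reflex'' or ''convex'' to each angle, such that (1) every interior face has exactly three angles tagged convex, (2) all angles of the outer face are tagged reflex, (3) no vertex is incident to more than one angle tagged reflex. It is pointed if every vertex is incident to exactly one reflex angle. A combinatorial 4-PPT is a combinatorial pointed pseudo-triangulation in which every interior face has size (number of edges on its boundary) 3 or 4; the outer face may have any size $h\ge 3$. Flip: let $\triangle$ be an interior triangular face of a combinatorial 4-PPT $T$, let $e$ be an edge of $\triangle$ that is not an edge of the outer face, and let $F$ be the other face incident to $e$ ($F$ has size 3 or 4). Deleting $e$ merges $\triangle$ and $F$ into a region $R$. A flip of $e$ replaces $e$ by another edge $e'\neq e$ drawn inside $R$ such that $e'$ splits $R$ into a triangular face and a face of the same size as $F$, and such that the result (tags outside $R$ unchanged, suitable tags inside $R$) is again a combinatorial 4-PPT; in particular the new graph must be simple, so $e'$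 may not join two vertices already adjacent in $T$. In the unlabeled setting combinatorial 4-PPTs are considered up to isomorphism preserving the embedding, the outer face and the tags; in the labeled setting vertices carry distinct labels, flips preserve labels, and the outer face (its labeled vertices and their cyclic order) is fixed. *)

(* Defs.v *)
From mathcomp Require Import all_boot all_fingroup.

Set Implicit Arguments.
Unset Strict Implicit.
Unset Printing Implicit Defensive.

(* Combinatorial plane embeddings with tagged angles, on vertex set 'I_n.   *)
(* A dart is an ordered pair (u,v) of adjacent vertices.  The rotation      *)
(* system is rot : for a dart (v,u), rot (v,u) is the neighbour of v that   *)
(* follows u in the cyclic order around v.  Junk convention (so that        *)
(* structures can be compared with Leibniz equality): rot (v,u) = u if      *)
(* (v,u) is not a dart.                                                     *)
(* Face successor of the dart (u,v): (v, rot (v,u)).  Faces are the orbits  *)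
(* of this permutation of darts.  The ANGLE indexed by the dart d = (u,v)   *)
(* is the wedge at the vertex v = d.2 between the consecutive edges vu and  *)
(* v(rot (v,u)); it is incident to the face containing d.  Hence angles     *)
(* are in bijection with darts, the angles of a face are its darts, and the *)
(* angles at a vertex v are the darts with head v.                          *)
(* outer  = the set of darts (= angles) of the designated outer face.       *)
(* reflex = the set of darts whose angle is tagged "reflex" (others convex).*)

Record cemb (n : nat) := CEmb {
  darts  : {set 'I_n * 'I_n};
  rot    : {ffun 'I_n * 'I_n -> 'I_n};
  outer  : {set 'I_n * 'I_n};
  reflex : {set 'I_n * 'I_n} }.

Section Defs.
Variable n : nat.
Implicit Types T : cemb n.

Definition adjv T : rel 'I_n := fun u v => (u, v) \in darts T.

Definition phi T (d : 'I_n * 'I_n) : 'I_n * 'I_n := (d.2, rot T (d.2, d.1)).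

Definition face T (d : 'I_n * 'I_n) : {set 'I_n * 'I_n} :=
  [set d' | fconnect (phi T) d d'].

Definition faces T : {set {set 'I_n * 'I_n}} := [set face T d | d in darts T].

Definition simple_graph T : Prop :=
  (forall u v, (u, v) \in darts T -> (v, u) \in darts T) /\
  (forall v, (v, v) \notin darts T).

Definition rotation_system T : Prop :=
  (forall v u, (v, u) \notin darts T -> rot T (v, u) = u) /\
  (forall v u, (v, u) \in darts T -> (v, rot T (v, u)) \in darts T) /\
  (forall v u w, (v, u) \in darts T -> (v, w) \in darts T ->
      rot T (v, u) = rot T (v, w) -> u = w) /\
  (forall v u w, (v, u) \in darts T -> (v, w) \in darts T ->
      exists k, iter k (fun x => rot T (v, x)) u = w).

Definition connected_graph T : Prop := forall u v, connect (adjv T) u v.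

(* genus 0 (embedding in the plane/sphere): Euler's formula V - E + F = 2 *)
Definition planar_embedding T : Prop :=
  (n + #|faces T| = #|darts T| %/ 2 + 2)%N.

Definition comb_embedding T : Prop :=
  [/\ simple_graph T, rotation_system T, connected_graph T,
      planar_embedding T & outer T \in faces T /\ reflex T \subset darts T].

Definition interior_face T (F : {set 'I_n * 'I_n}) : Prop :=
  F \in faces T /\ F != outer T.

Definition nreflex_at T (v : 'I_n) : nat := #|[set d in reflex T | d.2 == v]|.

Definition pseudo_triangulation T : Prop :=
  [/\ comb_embedding T,
      (forall F, interior_face T F -> #|[set d in F | d \notin reflex T]| = 3),
      outer T \subset reflex T &
      (forall v, nreflex_at T v <= 1)].

Definition pointed_pt T : Prop :=
  pseudo_triangulation T /\ forall v, nreflex_at T v = 1.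

(* size of a face = length of its boundary walk = number of its darts *)
Definition is4PPT T : Prop :=
  pointed_pt T /\
  forall F, interior_face T F -> #|F| = 3 \/ #|F| = 4.

Definition nouter T : nat := #|[set d.2 | d in outer T]|.

Definition del_darts T (a b : 'I_n) : {set 'I_n * 'I_n} :=
  darts T :\ (a, b) :\ (b, a).

Definition del_rot T (a b : 'I_n) : {ffun 'I_n * 'I_n -> 'I_n} :=
  [ffun d => if d \in del_darts T a b then
               let r := rot T d in
               if ((d.1 == a) && (r == b)) || ((d.1 == b) && (r == a))
               then rot T (d.1, r) else r
             else d.2].

(* ---- flips ----
   T' is obtained from T by flipping the edge e = {a,b} into e' = {a',b'}:
   - (a,b) lies on an interior triangular face (the triangle), and the other
     face F (containing (b,a)) is not the outer face (e is not an outer edge);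
   - e' is not an edge of T (simplicity), and T' has edge set E - e + e';
   - T - e and T' - e' are the same embedded graph (same rotation system);
   - e' is drawn inside the region R obtained by merging the triangle and F:
     the faces of T' incident to e' consist exactly of the darts of R and of
     e', and they are a triangle and a face of the same size as F;
   - the outer face and the tags of all angles outside R are unchanged;
   - T' is again a combinatorial 4-PPT (tags inside R are "suitable"). *)
Definition flip T T' : Prop :=
  exists a b a' b' : 'I_n,
    let R := (face T (a, b) :|: face T (b, a)) :\ (a, b) :\ (b, a) in
    let E' := [set (a', b'); (b', a')] in
    [/\ (a, b) \in darts T,
        interior_face T (face T (a, b)) /\ #|face T (a, b)| = 3,
        face T (b, a) != outer T,
        (a', b') \notin darts T /\ a' != b' &
    [/\ darts T' = del_darts T a b :|: E',
        del_rot T a b = del_rot T' a' b',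
        face T' (a', b') :|: face T' (b', a') = R :|: E',
        ((#|face T' (a', b')| == 3) && (#|face T' (b', a')| == #|face T (b, a)|))
        || ((#|face T' (b', a')| == 3) && (#|face T' (a', b')| == #|face T (b, a)|)) &
     [/\ outer T' = outer T,
        (forall d, d \notin R -> d \notin [set (a, b); (b, a)] -> d \notin E' ->
           (d \in reflex T) = (d \in reflex T')) &
        is4PPT T']]].

Inductive flips : nat -> cemb n -> cemb n -> Prop :=
| flips0 T : flips 0 T T
| flipsS k T T' T'' : flip T T' -> flips k T' T'' -> flips k.+1 T T''.

Definition relabel (s : {perm 'I_n}) T : cemb n :=
  CEmb [set (s d.1, s d.2) | d in darts T]
       [ffun d => s (rot T ((s^-1)%g d.1, (s^-1)%g d.2))]
       [set (s d.1, s d.2) | d in outer T]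
       [set (s d.1, s d.2) | d in reflex T].

Definition iso T T' : Prop := exists s : {perm 'I_n}, relabel s T = T'.

End Defs.

(* Main.v *)
Require Import Defs.
From mathcomp Require Import all_boot all_fingroup all_algebra zify.

(** Every interior face is a triangle or a quadrilateral with exactly one reflex
    angle; a flip re-cuts the pentagon formed by an adjacent triangle and
    quadrilateral (or the square formed by two triangles).  Counting vertices,
    edges and faces on the inner side of a 3-cycle shows that this side has no
    reflex angle at the three vertices and contains at most one triangle.
    So the new edge of a flip is never already present when it ends at the
    reflex vertex of the pentagon, and one of the two other edges is always
    available: a triangle can be moved along a path of quadrilaterals, and a
    quadrilateral along a path of triangles, with one flip per face.

    Let b, c, a be consecutive on the outer face.  Bring a triangle to the edge
    ac and sweep the faces around c: after O(n) flips c has degree two and lies on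
    a quadrilateral w a c b with reflex vertex w.  Now w plays the role of c, so
    O(n^2) flips stack all the inner vertices, and O(n) flips turn the triangles
    that are left into a fan at a.  This normal form is determined by the order of
    the stack.  To permute the stack, its top vertex x is made to carry part of
    the others; at the place where it is held, two consecutive vertices of the
    stack are exchanged by seven flips, so that O(n^2) flips reach any order.
    Flips are reversible, and the unlabeled statement follows by relabeling. *)

Set Implicit Arguments.
Unset Strict Implicit.
Unset Printing Implicit Defensive.

Local Notation rot := Defs.rot.

Arguments phi : simpl never.

(** * Darts and faces *)

Section Basics.
Variable n : nat.
Notation dart := ('I_n * 'I_n)%type.
Implicit Types (T : cemb n) (D : {set dart}) (r : {ffun dart -> 'I_n}) (d : dart).

(** What blocks a flip is simplicity: the new edge may already exist elsewhere. It would then close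
    a 3-cycle with two consecutive sides of the region, so everything rests on knowing the inner
    side of a 3-cycle. That a 3-cycle separates is itself derived from Euler's formula. A rank
    inequality over the rationals gives [F + V <= E + 1] for the faces, vertices and edges strictly
    on one side; a cycle that did not separate would violate it, and the inequalities of the two
    sides add up to Euler's formula, so both are equalities. Counting the darts of the inner side by
    edges and by angles gives [2E + 3 = 3F + R], where the [R] reflex angles are at least one per
    inner vertex and at most one per face. Hence [R = V] and [F = V + 1]. The other burden is that
    each stage must leave the earlier ones intact. Finished faces form a set [X] of darts that later
    flips avoid, and the invariant that the rest stays connected in the dual guarantees a path along
    which the next face can travel. *)

Definition rv (d : dart) : dart := (d.2, d.1).

Lemma rvK : involutive rv. Proof. by case. Qed.

Lemma rv_inj : injective rv. Proof. exact: inv_inj rvK. Qed.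

Definition sym D := forall u v, ((u, v) \in D) = ((v, u) \in D).

Definition rotsys D r :=
  (forall v u, (v, u) \notin D -> r (v, u) = u) /\
  (forall v u, (v, u) \in D -> (v, r (v, u)) \in D) /\
  (forall v u w, (v, u) \in D -> (v, w) \in D -> r (v, u) = r (v, w) -> u = w) /\
  (forall v u w, (v, u) \in D -> (v, w) \in D ->
      exists k, iter k (fun x => r (v, x)) u = w).

(** Insertion and deletion shift iteration counts around a vertex, so transitivity of the rotation
    is supplied as an induction principle for arbitrary [P]; taking for [P] the reachable vertices
    recovers the count. *)
Lemma rotsysP D r :
  (forall v u, (v, u) \notin D -> r (v, u) = u) ->
  (forall v u, (v, u) \in D -> (v, r (v, u)) \in D) ->
  (forall v u w, (v, u) \in D -> (v, w) \in D -> r (v, u) = r (v, w) -> u = w) ->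
  (forall v (P : 'I_n -> Prop),
     (forall u, (v, u) \in D -> P u -> P (r (v, u))) ->
     forall u w, (v, u) \in D -> (v, w) \in D -> P u -> P w) ->
  rotsys D r.
Proof.
move=> H1 H2 H3 H4; do ![split=> //] => v u w Hu Hw.
apply: (H4 v (fun w => exists k, iter k (fun x => r (v, x)) u = w) _ u w) => //.
- by move=> u' Hu' [k Hk]; exists k.+1; rewrite /= Hk.
- by exists 0.
Qed.

Lemma rotsys_ind D r v (P : 'I_n -> Prop) : rotsys D r ->
  (forall u, (v, u) \in D -> P u -> P (r (v, u))) ->
  forall u w, (v, u) \in D -> (v, w) \in D -> P u -> P w.
Proof.
move=> [_ [H2 [_ H4]]] HP u w Hu Hw Pu; have [k <-] := H4 _ _ _ Hu Hw.
suff: (v, iter k (fun x => r (v, x)) u) \in D /\ P (iter k (fun x => r (v, x)) u) by case.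
by elim: k => //= k [Dk Pk]; split; [exact: H2 | exact: HP].
Qed.

Lemma simple_sym T : simple_graph T -> sym (darts T).
Proof. by case=> H _ u v; apply/idP/idP => /H. Qed.

Section Phi.
Variable T : cemb n.
Hypotheses (sT : simple_graph T) (rT : rotation_system T).

Let dC : sym (darts T) := simple_sym sT.

Lemma rv_dart d : (rv d \in darts T) = (d \in darts T).
Proof. by case: d => u v; rewrite dC. Qed.

Lemma dart_neq u v : (u, v) \in darts T -> u != v.
Proof. by move=> H; apply/eqP => E; move: H; rewrite E; apply/negP; apply: sT.2. Qed.

Lemma phi_dart d : (phi T d \in darts T) = (d \in darts T).
Proof.
case: d => u v; rewrite /phi /= [RHS]dC; case: rT => H1 [H2 _].
by have [/H2->|/[dup] H /H1 ->] := boolP ((v, u) \in darts T); last exact: negbTE.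
Qed.

Lemma phi_nondart d : d \notin darts T -> phi T d = rv d.
Proof. by case: d => u v; rewrite dC => /(rT.1 v u) E; rewrite /phi /= E. Qed.

(** Off the darts the junk convention makes [phi] the reversal, so injectivity holds on all pairs
    and face orbits are symmetric without side conditions. *)
Lemma phi_inj : injective (phi T).
Proof.
move=> d d' E; have := phi_dart d; rewrite E phi_dart.
have [d'D dD|d'D dD] := boolP (d' \in darts T); last first.
  by move: E; rewrite !phi_nondart ?dD // -?dD //; apply: rv_inj.
case: d d' E dD d'D => [u v] [u' v'] [/= <-]; case: rT => _ [_ [H3 _]].
by move=> E D1 D2; rewrite (H3 _ _ _ _ _ E) // dC.
Qed.

Lemma face_dart d d' : d' \in face T d -> (d' \in darts T) = (d \in darts T).
Proof.
rewrite inE => /iter_findex <-; elim: (findex _ _ _) => //= k <-.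
by rewrite phi_dart.
Qed.

Lemma mem_face d : d \in face T d. Proof. by rewrite inE. Qed.

Lemma face_eq d d' : d' \in face T d -> face T d' = face T d.
Proof.
rewrite inE => H; apply/setP => e; rewrite !inE; apply/esym.
exact: (same_connect (fconnect_sym phi_inj) H).
Qed.

Lemma phi_face d d' : (phi T d' \in face T d) = (d' \in face T d).
Proof. by rewrite !inE -(same_fconnect1_r phi_inj). Qed.

Lemma face_phi d : face T (phi T d) = face T d.
Proof. by apply: face_eq; rewrite phi_face mem_face. Qed.

Lemma face_cycle c d : fcycle (phi T) c -> d \in c -> face T d = [set e in c].
Proof. by move=> Hc Hd; apply/setP=> e; rewrite !inE (fconnect_cycle Hc Hd). Qed.

Lemma facesP F : reflect (exists2 d, d \in darts T & F = face T d) (F \in faces T).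
Proof. exact: imsetP. Qed.

Lemma face_in F d : F \in faces T -> d \in F -> F = face T d /\ d \in darts T.
Proof. by case/facesP => e He -> Hd; rewrite (face_eq Hd) (face_dart Hd). Qed.

Lemma face_faces d : d \in darts T -> face T d \in faces T.
Proof. exact: imset_f. Qed.

(** Reversing [phi T (u, v)] gives the next dart with head [v], so this is induction once around
    [v], in terms of the darts that index the angles at [v]. The degree arguments rest on it. *)
Lemma rot_in_ind v (P : 'I_n -> Prop) :
  (forall u, (u, v) \in darts T -> P u -> P (phi T (u, v)).2) ->
  forall u w, (u, v) \in darts T -> (w, v) \in darts T -> P u -> P w.
Proof.
move=> HP u w; rewrite dC (dC w) => Hu Hw; apply: (rotsys_ind rT) Hu Hw => x.
by rewrite -dC; apply: HP.
Qed.

End Phi.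
End Basics.

(** * Surgery on rotation systems *)

Section Surgery.
Variable n : nat.
Notation dart := ('I_n * 'I_n)%type.
Implicit Types (T : cemb n) (D : {set dart}) (r : {ffun dart -> 'I_n}) (d : dart).

Definition edge (a b : 'I_n) : {set dart} := [set (a, b); (b, a)].

Lemma del_dartsE T a b : del_darts T a b = darts T :\: edge a b.
Proof. by apply/setP=> d; rewrite !inE negb_or andbA [(d != _) && _]andbC. Qed.

(** [del_rot] skips the removed edge by a single further step. The hypothesis says that neither end
    is a leaf, so that this step does not fall back on the removed edge. *)
Lemma rotsys_del T a b : rotation_system T ->
  (forall d, d \in edge a b -> (d.1, rot T d) \notin edge a b) ->
  rotsys (del_darts T a b) (del_rot T a b).
Proof.
move=> [H1 [H2 [H3 H4]]] dg; rewrite del_dartsE.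
have r0E v u : (v, u) \in darts T :\: edge a b -> del_rot T a b (v, u) =
    if (v, rot T (v, u)) \in edge a b then rot T (v, rot T (v, u)) else rot T (v, u).
  by move=> H; rewrite ffunE del_dartsE H !inE !xpair_eqE.
apply: rotsysP.
- by move=> v u H; rewrite ffunE del_dartsE (negbTE H).
- move=> v u H; rewrite r0E //; case: ifP => [/dg /= E|/negbT E].
    by rewrite !inE in E *; rewrite E !H2 //; move: H; rewrite inE => /andP[].
  by rewrite inE E H2 //; move: H; rewrite inE => /andP[].
- move=> v u w Hu Hw; rewrite !r0E //.
  have [Hu1 Hu2] : (v, u) \notin edge a b /\ (v, u) \in darts T.
    by move: Hu; rewrite inE => /andP.
  have [Hw1 Hw2] : (v, w) \notin edge a b /\ (v, w) \in darts T.
    by move: Hw; rewrite inE => /andP.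
  case: ifP => [E1|E1]; case: ifP => [E2|E2] E.
  + by apply: (H3 v) => //; apply: (H3 v) => //; apply: H2.
  + by case/negP: Hw1; rewrite -(H3 _ _ _ _ _ E) //; apply: H2.
  + by case/negP: Hu1; rewrite (H3 _ _ _ _ _ E) //; apply: H2.
  + exact: (H3 v).
- move=> v P HP u w Hu Hw Pu.
  (* At the removed dart [P'] looks one step ahead, so the induction around [v] in [T] can run
     through it. *)
  pose P' x := if (v, x) \in edge a b then P (rot T (v, x)) else P x.
  have [Hu1 Hu2] : (v, u) \notin edge a b /\ (v, u) \in darts T.
    by move: Hu; rewrite inE => /andP.
  have [Hw1 Hw2] : (v, w) \notin edge a b /\ (v, w) \in darts T.
    by move: Hw; rewrite inE => /andP.
  suff: P' w by rewrite /P' (negbTE Hw1).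
  apply: (@rotsys_ind _ (darts T) (rot T) v P' _ _ u w) => //; last by rewrite /P' (negbTE Hu1).
  move=> x Hx; rewrite /P'; case: ifP => [/dg/= /negbTE-> //|E Px].
  have := HP x; rewrite r0E; last by rewrite inE E.
  by rewrite inE E Hx; case: ifP => _; apply.
Qed.

(* x becomes the successor of l around v. *)
Definition rins r (v l x : 'I_n) : {ffun dart -> 'I_n} :=
  [ffun d => if d == (v, l) then x else if d == (v, x) then r (v, l) else r d].

Lemma rotsys_ins D r v l x : rotsys D r -> (v, l) \in D -> (v, x) \notin D ->
  rotsys ((v, x) |: D) (rins r v l x).
Proof.
move=> rD Hl Hx; have [H1 [H2 [H3 _]]] := rD.
have lx : l != x by apply: contraNneq Hx => <-.
apply: rotsysP.
- move=> w u; rewrite !inE negb_or => /andP[N1 N2]; rewrite ffunE (negbTE N1).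
  by case: eqP => [E|_]; [rewrite E Hl in N2 | rewrite H1].
- move=> w u; rewrite !inE !xpair_eqE ffunE !xpair_eqE.
  case: (eqVneq w v) => /= [->|Nw]; last by apply: H2.
  case: (eqVneq u l) => [-> _|_]; first by rewrite eqxx.
  case: (eqVneq u x) => [_ _|_ /= Hu]; first by rewrite H2 ?orbT.
  by rewrite H2 ?orbT.
- move=> w u y; rewrite !inE !xpair_eqE !ffunE !xpair_eqE.
  case: (eqVneq w v) => /= [->|Nw]; last by apply: H3.
  have Nr z : (v, z) \in D -> r (v, z) <> x.
    by move=> /H2 H E; rewrite E (negbTE Hx) in H.
  case: (eqVneq u l) => [->|ul]; case: (eqVneq y l) => [->//|yl].
  + rewrite (negbTE lx) /= => _; case: (eqVneq y x) => [_ _ E|_ /= /Nr H E].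
      by case: (Nr l).
    by case: H.
  + rewrite (negbTE lx) /= => H _; case: (eqVneq u x) => [_ E|N /=].
      by case: (Nr l).
    by move: H; rewrite (negbTE N) => /Nr H' /H'.
  + case: (eqVneq u x) => [->|ux]; case: (eqVneq y x) => [->//|yx] //=.
    * by move=> _ Hy /esym E; case/eqP: yl; apply: (H3 v).
    * by move=> Hu _ E; case/eqP: ul; apply: (H3 v).
    * exact: H3.
- move=> w P HP u y Hu Hy Pu.
  have [Ew|Nw] := eqVneq w v; last first.
    have inD z : ((w, z) \in (v, x) |: D) = ((w, z) \in D).
      by rewrite !inE xpair_eqE (negbTE Nw).
    apply: (@rotsys_ind _ D r w P rD _ u) => //; rewrite -?inD // => z.
    by rewrite -inD => /HP; rewrite ffunE !xpair_eqE (negbTE Nw).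
  subst w; have PD z t : (v, z) \in D -> (v, t) \in D -> P z -> P t.
    apply: (@rotsys_ind _ D r v P rD) => {}z Hz Pz.
    have zx : z != x by apply: contraNneq Hx => <-.
    have := HP z; rewrite !inE Hz orbT ffunE !xpair_eqE eqxx /= (negbTE zx).
    case: eqP => [[ez]|_]; last by apply.
    subst z => /(_ isT Pz) Px.
    by have := HP x; rewrite !inE eqxx ffunE !xpair_eqE !eqxx eq_sym (negbTE lx) /=; apply.
  have Px : P l -> P x.
    by have := HP l; rewrite !inE Hl orbT ffunE eqxx; apply.
  have Prl : P x -> P (r (v, l)).
    by have := HP x; rewrite !inE eqxx ffunE !xpair_eqE !eqxx eq_sym (negbTE lx) /=; apply.
  move: Hu Hy; rewrite !inE !xpair_eqE eqxx /=.
  case/orP=> [/eqP eu|Hu] /orP[/eqP ey|Hy]; subst => //.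
  + by apply: (PD (r (v, l))); [apply: H2 | | apply: Prl].
  + by apply: Px; apply: (PD u).
  + exact: (PD u).
Qed.

Lemma rins_eq1 r v l x : rins r v l x (v, l) = x.
Proof. by rewrite ffunE eqxx. Qed.

Lemma rins_eq2 r v l x : l != x -> rins r v l x (v, x) = r (v, l).
Proof. by move=> N; rewrite ffunE xpair_eqE !eqxx eq_sym (negbTE N) /=. Qed.

Lemma rins_neq r v l x d : d != (v, l) -> d != (v, x) -> rins r v l x d = r d.
Proof. by move=> N1 N2; rewrite ffunE (negbTE N1) (negbTE N2). Qed.

(* The edge ab is replaced by a'b', placed after la around a' and after lb around b'. *)
Definition flipT T (a b a' la b' lb : 'I_n) (R : {set dart}) : cemb n :=
  CEmb (del_darts T a b :|: edge a' b')
       (rins (rins (del_rot T a b) a' la b') b' lb a') (outer T) R.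

(** The face successor of the intermediate embedding, with the old edge removed and the new one not
    yet drawn. In it the region of the flip is a single face. *)
Definition phi0 T a b d : dart := (d.2, del_rot T a b (d.2, d.1)).
Arguments phi0 : simpl never.

Section FlipPhi.
Variables (T : cemb n) (a b a' la b' lb : 'I_n) (R : {set dart}).
Let T' := flipT T a b a' la b' lb R.
Hypotheses (sT : simple_graph T) (Na' : (a', b') \notin del_darts T a b) (ab' : a' != b').
Hypotheses (Ha' : (la, a') \in del_darts T a b) (Hb' : (lb, b') \in del_darts T a b).

Lemma sym_del : sym (del_darts T a b).
Proof.
move=> u v; rewrite del_dartsE !in_setD (simple_sym sT); congr (_ && _).
by rewrite !inE !xpair_eqE [in RHS]orbC ![(v == _) && _]andbC.
Qed.

Let lab : la != b'.
Proof. by apply: contraNneq Na' => <-; rewrite sym_del. Qed.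
Let lba : lb != a'.
Proof. by apply: contraNneq Na' => <-. Qed.

Lemma phi_new_la : phi T' (la, a') = (a', b').
Proof.
by rewrite /phi /= rins_neq ?rins_eq1 // xpair_eqE (negbTE ab').
Qed.

Lemma phi_new_lb : phi T' (lb, b') = (b', a').
Proof. by rewrite /phi /= rins_eq1. Qed.

Lemma phi_new_ab : phi T' (a', b') = phi0 T a b (lb, b').
Proof.
by rewrite /phi /= rins_eq2 // rins_neq // xpair_eqE eq_sym (negbTE ab').
Qed.

Lemma phi_new_ba : phi T' (b', a') = phi0 T a b (la, a').
Proof.
by rewrite /phi /= rins_neq ?xpair_eqE ?(negbTE ab') ?andbF ?rins_eq2.
Qed.

Lemma phi_new d : d \in del_darts T a b -> d != (la, a') -> d != (lb, b') ->
  phi T' d = phi0 T a b d.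
Proof.
case: d => u v; rewrite sym_del => H; rewrite !xpair_eqE => N1 N2.
have Nv x y : (x, y) \notin del_darts T a b -> (v, u) != (x, y).
  by move=> Nx; apply: contraNneq Nx => <-.
rewrite /phi /= !rins_neq //.
- by rewrite xpair_eqE andbC.
- by rewrite Nv.
- by rewrite xpair_eqE andbC.
- by rewrite Nv // sym_del.
Qed.

Lemma del_rot_new : rotation_system T ->
  (forall d, d \in edge a b -> (d.1, rot T d) \notin edge a b) ->
  del_rot T a b = del_rot T' a' b'.
Proof.
move=> rT dg; have [H1 [H2 _]] := rotsys_del rT dg.
have Dn : del_darts T' a' b' = del_darts T a b.
  rewrite del_dartsE /= setDUl setDv setU0; apply/setP=> d.
  rewrite inE andbC; have [dD /=|//] := boolP (d \in _).
  by rewrite !inE; apply/norP; split; apply: contraTneq dD => ->;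
     rewrite // sym_del.
apply/ffunP=> -[v u]; have [vu|vu] := boolP ((v, u) \in del_darts T a b); last first.
  by rewrite [RHS]ffunE Dn (negbTE vu) H1.
rewrite [RHS]ffunE Dn vu /=.
have Nvx : (v, u) != (a', b') by apply: contraNneq Na' => <-.
have Nvy : (v, u) != (b', a') by apply: contraNneq Na' => E; rewrite sym_del -E.
have [[ev eu]|Nl] := eqVneq (v, u) (a', la).
  subst; rewrite rins_neq ?xpair_eqE ?(negbTE ab') ?rins_eq1 //= !eqxx /=.
  by rewrite rins_neq ?rins_eq2 ?xpair_eqE ?(negbTE ab').
have [[ev eu]|Nl'] := eqVneq (v, u) (b', lb).
  subst; rewrite rins_eq1 !eqxx orbT rins_eq2 // rins_neq ?xpair_eqE //.
rewrite !(rins_neq _ Nl') // !(rins_neq _ Nl) //.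
have := H2 _ _ vu; case: ifP => // /orP[]/andP[/eqP-> /eqP->] /=.
  by rewrite (negbTE Na').
by rewrite sym_del (negbTE Na').
Qed.

Lemma flipT_simple : (a, b) \in darts T -> simple_graph T'.
Proof.
move=> _; split => [u v|v] /=; rewrite !in_setU.
  rewrite sym_del => /orP[->//|]; rewrite !inE !xpair_eqE.
  by case/orP=> /andP[/eqP-> /eqP->]; rewrite !eqxx ?orbT.
rewrite negb_or del_dartsE in_setD negb_and (sT.2 v) orbT /= !inE !xpair_eqE.
by apply/norP; split; apply: contra ab' => /andP[/eqP<- /eqP<-].
Qed.

Lemma flipT_rotsys : rotation_system T ->
  (forall d, d \in edge a b -> (d.1, rot T d) \notin edge a b) -> rotation_system T'.
Proof.
move=> rT dg; have R0 := rotsys_del rT dg.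
have R1 := @rotsys_ins _ _ a' la b' R0.
rewrite -sym_del Ha' in R1; have {}R1 := R1 isT Na'.
have R2 := @rotsys_ins _ _ b' lb a' R1.
have -> : rotation_system T' =
   rotsys ((b', a') |: ((a', b') |: del_darts T a b)) (rot T').
  rewrite /rotsys /rotation_system; suff -> : darts T' = (b', a') |: ((a', b') |: del_darts T a b) by [].
  by apply/setP => d; rewrite !inE; do ![case: (d == _); rewrite ?orbT ?andbT ?orbF //=].
apply: R2; first by rewrite in_setU -sym_del Hb' orbT.
by rewrite in_setU sym_del negb_or Na' inE xpair_eqE eq_sym (negbTE ab').
Qed.

End FlipPhi.
End Surgery.

Arguments phi0 : simpl never.

(** * A flip yields a combinatorial 4-PPT *)

Section Core.
Variable n : nat.
Notation dart := ('I_n * 'I_n)%type.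
Implicit Types (T : cemb n) (D : {set dart}) (d : dart).

Lemma is4PPT_simple T : is4PPT T -> simple_graph T.
Proof. by case=> [[[[]]]]. Qed.

Lemma is4PPT_rot T : is4PPT T -> rotation_system T.
Proof. by case=> [[[[]]]]. Qed.

(** Where [phi] would enter the removed edge, the intermediate face continues on the other side of
    that edge. *)
Lemma phi0E T a b d : simple_graph T -> d \in del_darts T a b ->
  phi0 T a b d = if phi T d \in edge a b then phi T (rv (phi T d)) else phi T d.
Proof.
case: d => u v sT; rewrite (sym_del _ _ sT) /phi0 /phi /= ffunE => -> /=.
by rewrite !inE !xpair_eqE; case: ifP.
Qed.

Lemma eq_face_in T T' (A : {set dart}) d :
  {in A, phi T' =1 phi T} -> (forall e, e \in A -> phi T e \in A) ->
  d \in A -> face T' d = face T d.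
Proof.
move=> E cl dA.
have it k : iter k (phi T') d = iter k (phi T) d /\ iter k (phi T) d \in A.
  by elim: k => //= k [-> H]; split; [exact: E | exact: cl].
apply/setP=> e; rewrite !inE; apply/idP/idP => /iter_findex <-.
  by rewrite (it _).1 fconnect_iter.
by rewrite -(it _).1 fconnect_iter.
Qed.

Section FlipCore.
Variables (T : cemb n) (w0 w1 w2 : 'I_n) (r : seq dart).
Hypothesis ppT : is4PPT T.
Let sT := is4PPT_simple ppT.
Let rT := is4PPT_rot ppT.
Let pI := phi_inj sT rT.
Hypotheses (D01 : (w0, w1) \in darts T)
  (triT : fcycle (phi T) [:: (w0, w1); (w1, w2); (w2, w0)])
  (restT : fcycle (phi T) ((w0, w2) :: r)) (ur : uniq ((w0, w2) :: r))
  (sr : (size r == 2) || (size r == 3)).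
(** The boundary walk of the merged region. Rotating it so that another pair of consecutive darts
    comes first selects the new triangle, so one construction covers every flip. *)
Let c0 := (w0, w1) :: (w1, w2) :: r.
Let a := w2.
Let b := w0.
Let P : {set dart} := [set d in (w2, w0) :: (w0, w2) :: c0].

Let D12 : (w1, w2) \in darts T.
Proof. by case/and4P: triT => /eqP<- _ _ _; rewrite (phi_dart sT rT). Qed.
Let D20 : (w2, w0) \in darts T.
Proof. by case/and4P: triT => _ /eqP<- _ _; rewrite (phi_dart sT rT). Qed.
Let D02 : (w0, w2) \in darts T.
Proof. by rewrite -(rv_dart sT). Qed.
Let n01 := dart_neq sT D01.
Let n12 := dart_neq sT D12.
Let n20 := dart_neq sT D20.

Let face1 : face T (w2, w0) = [set d in [:: (w0, w1); (w1, w2); (w2, w0)]].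
Proof. by apply: (face_cycle triT); rewrite !inE eqxx !orbT. Qed.

Let face2 : face T (w0, w2) = [set d in (w0, w2) :: r].
Proof. by apply: (face_cycle restT); rewrite mem_head. Qed.

Let n02f : (w0, w2) \notin face T (w2, w0).
Proof.
rewrite face1 !inE !xpair_eqE [w2 == w1]eq_sym (negbTE n12) andbF (negbTE n01).
by rewrite [w0 == w2]eq_sym (negbTE n20).
Qed.

Let faceN : face T (w0, w2) != face T (w2, w0).
Proof. by apply: contraNneq n02f => <-; rewrite mem_face. Qed.

Let fdisj d : d \in face T (w2, w0) -> d \in face T (w0, w2) -> False.
Proof.
by move=> /(face_eq sT rT) E1 /(face_eq sT rT) E2; case/eqP: faceN; rewrite -E1 -E2.
Qed.

Let PE : P = face T (w2, w0) :|: face T (w0, w2).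
Proof.
apply/setP=> d; rewrite face1 face2 !inE.
by do ![case: (d == _) => //=]; rewrite ?orbT.
Qed.

Let Pphi d : (phi T d \in P) = (d \in P).
Proof. by rewrite PE !in_setU !(phi_face sT rT). Qed.

Let PD d : d \in P -> d \in darts T.
Proof. by rewrite PE in_setU => /orP[] /(face_dart sT rT) ->. Qed.

(** The two faces are distinct orbits, hence share no dart. Only darts are claimed to be distinct:
    the walk may visit a vertex twice. *)
Lemma walk_uniq : uniq c0.
Proof.
have H1 : (w0, w1) \notin r.
  apply/negP=> H; apply: (@fdisj (w0, w1)); rewrite ?face1 ?face2 !inE ?eqxx //.
  by rewrite H orbT.
have H2 : (w1, w2) \notin r.
  apply/negP=> H; apply: (@fdisj (w1, w2)); rewrite ?face1 ?face2 !inE ?eqxx ?orbT //.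
  by rewrite H orbT.
move: ur; rewrite /= inE negb_or H1 H2 xpair_eqE (negbTE n01) /=.
by case/andP.
Qed.

Let r02 : (w0, w2) \notin r. Proof. by case/andP: ur. Qed.
Let r20 : (w2, w0) \notin r.
Proof.
apply/negP=> H; apply: (@fdisj (w2, w0)); first by rewrite mem_face.
by rewrite face2 !inE H orbT.
Qed.

Let c0N d : d \in c0 -> d \notin edge w2 w0.
Proof.
rewrite !inE => /or3P[/eqP->|/eqP->|H]; rewrite ?xpair_eqE.
- by rewrite [w1 == w2](negbTE n12) ![w0 == w2]eq_sym (negbTE n20) !andbF.
- by rewrite (negbTE n12) [w1 == w0]eq_sym (negbTE n01).
- by apply/norP; split; apply: contraTneq H => ->.
Qed.

Lemma walk_del d : d \in c0 -> d \in del_darts T a b.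
Proof.
move=> H; rewrite del_dartsE in_setD c0N //=; apply: PD.
by rewrite inE; move: H; rewrite !inE => ->; rewrite !orbT.
Qed.

(** A leaf at an end of the removed edge would put both orientations of this edge on the same
    face. *)
Let dg : forall d, d \in edge a b -> (d.1, rot T d) \notin edge a b.
Proof.
move=> d; rewrite !inE => /orP[]/eqP-> /=.
  rewrite -[(a, rot T (a, b))]/(phi T (w0, w2)); have : phi T (w0, w2) \in face T (w0, w2) by rewrite (phi_face sT rT) mem_face.
  rewrite face2 inE; case: r restT sr r20 r02 => // x r' /= /andP[/eqP-> _] _ H1 H2 _.
  by rewrite negb_or; apply/andP; split; [move: H1 | move: H2]; rewrite inE negb_or;
    case/andP; rewrite eq_sym.
rewrite -[(b, rot T (b, a))]/(phi T (w2, w0)).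
by case/and4P: triT => _ _ /eqP-> _; rewrite !xpair_eqE /a /b ![w0 == w2]eq_sym (negbTE n20) /= [w1 == w2](negbTE n12) ?andbF.
Qed.

Let cyc0 : fcycle (phi0 T a b) c0.
Proof.
have Ed d : d \in c0 -> phi0 T a b d =
    if phi T d \in edge a b then phi T (rv (phi T d)) else phi T d.
  by move=> /walk_del; apply: phi0E.
have h1 : phi0 T a b (w0, w1) = (w1, w2).
  rewrite Ed ?mem_head //; case/and4P: triT => /eqP-> _ _ _.
  by rewrite (negbTE (c0N _)) // !inE eqxx orbT.
have h2 : phi0 T a b (w1, w2) = phi T (w0, w2).
  rewrite Ed ?inE ?eqxx ?orbT //; case/and4P: triT => _ /eqP-> _ _.
  by rewrite eqxx.
have hr d : d \in r -> phi0 T a b d = if phi T d == (w0, w2) then (w0, w1) else phi T d.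
  move=> dr; have dc : d \in c0 by rewrite !inE dr !orbT.
  rewrite (Ed _ dc).
  have -> : (phi T d \in edge a b) = (phi T d == (w0, w2)).
    rewrite !inE orbC; case: eqP => //= _; apply/eqP => E.
    apply: (@fdisj (phi T d)); first by rewrite E mem_face.
    by rewrite (phi_face sT rT) face2 !inE dr orbT.
  case: ifP => // /eqP ->; have -> : rv (w0, w2) = (w2, w0) by [].
  by case/and4P: triT => _ _ /eqP-> _.
rewrite /c0 /= h1 eqxx /=.
case: r sr ur restT hr => // x r' _ /= /andP[Nx _] /andP[/eqP Ex Hp] hr.
rewrite h2 Ex eqxx /=; elim: r' x Nx Hp hr {Ex} => [|y r' IH] x /= Nx.
  by rewrite !andbT => /eqP E ->; rewrite ?mem_head // E !eqxx.
case/andP=> /eqP E Hp hr; rewrite hr ?mem_head // E.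
have Ny : (y == (w0, w2)) = false.
  by apply/eqP=> Ey; move: Nx; rewrite !inE Ey eqxx orbT.
rewrite Ny eqxx /=; apply: IH => //.
  by move: Nx; rewrite !inE negb_or => /andP[].
by move=> d Hd; apply: hr; rewrite inE Hd orbT.
Qed.

Variables (u0 u1 u2 : 'I_n) (r' : seq dart) (k : nat) (R RP : {set dart}).
Hypotheses (rotE : seq.rot k c0 = (u0, u1) :: (u1, u2) :: r')
  (N02 : (u0, u2) \notin darts T) (n02 : u0 != u2).
Let P' : {set dart} := [set d in (u2, u0) :: (u0, u2) :: c0].
Hypotheses (RE : R = (reflex T :\: P) :|: RP) (RP' : RP \subset P')
  (Rtri : all [pred d | d \notin RP] [:: (u0, u1); (u1, u2); (u2, u0)])
  (Rquad : count [pred d | d \notin RP] ((u0, u2) :: r') = 3)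
  (Rhead : forall v, #|[set d in RP | d.2 == v]| = #|[set d in reflex T :&: P | d.2 == v]|)
  (Fint : face T (w0, w2) != outer T) (Tint : face T (w2, w0) != outer T).

(** The new edge is placed at [u0] after the vertex that precedes [u0] on the walk, and at [u2]
    after [u1]. *)
Let lb := (last (u1, u2) r').1.
Let T' := flipT T a b u2 u1 u0 lb R.

Let c0' : seq.rot k c0 =i c0. Proof. exact: mem_rot. Qed.
Let cyc1 : fcycle (phi0 T a b) ((u0, u1) :: (u1, u2) :: r').
Proof. by rewrite -rotE rot_cycle. Qed.
Let uc1 : uniq ((u0, u1) :: (u1, u2) :: r').
Proof. by rewrite -rotE rot_uniq walk_uniq. Qed.
Let m1 d : d \in (u0, u1) :: (u1, u2) :: r' -> d \in del_darts T a b.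
Proof. by rewrite -rotE c0' => /walk_del. Qed.
Let sr' : size r' = size r.
Proof. by have /(congr1 size) := rotE; rewrite size_rot /= => -[]. Qed.

Let lastE : last (u1, u2) r' = (lb, u0).
Proof.
move: cyc1; rewrite /= => /andP[_]; rewrite rcons_path => /andP[_ /eqP].
by rewrite /lb; case: (last _ _) => x y [-> _].
Qed.

Let lr' : (lb, u0) \in r'.
Proof.
by rewrite -lastE; case: r' sr' sr => [<-//|x s _ _] /=; exact: mem_last.
Qed.

Let Na' : (u2, u0) \notin del_darts T a b.
Proof. by rewrite (sym_del _ _ sT) del_dartsE in_setD (negbTE N02) andbF. Qed.
Let ab' : u2 != u0. Proof. by rewrite eq_sym. Qed.
Let Ha' : (u1, u2) \in del_darts T a b.
Proof. by apply: m1; rewrite !inE eqxx orbT. Qed.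
Let Hb' : (lb, u0) \in del_darts T a b.
Proof. by apply: m1; rewrite !inE lr' !orbT. Qed.

Let sT' : simple_graph T'. Proof. exact: flipT_simple. Qed.
Let rT' : rotation_system T'. Proof. exact: flipT_rotsys. Qed.

Let pla : phi T' (u1, u2) = (u2, u0).
Proof. exact: phi_new_la. Qed.
Let plb : phi T' (lb, u0) = (u0, u2).
Proof. exact: phi_new_lb. Qed.
Let pab : phi T' (u2, u0) = phi0 T a b (lb, u0).
Proof. exact: phi_new_ab. Qed.
Let pba : phi T' (u0, u2) = phi0 T a b (u1, u2).
Proof. exact: phi_new_ba. Qed.
Let pn d : d \in del_darts T a b -> d != (u1, u2) -> d != (lb, u0) ->
  phi T' d = phi0 T a b d.
Proof. exact: phi_new. Qed.

Lemma flipT_tri : fcycle (phi T') [:: (u0, u1); (u1, u2); (u2, u0)].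
Proof.
move: cyc1 uc1; rewrite /= => /andP[/eqP h1 _] /andP[]; rewrite !inE !negb_or.
move=> /andP[N1 N2] _.
rewrite pla pab eqxx.
rewrite pn ?h1 ?eqxx //=; last 2 first.
- by apply: m1; rewrite mem_head.
- by apply: contraNneq N2 => ->.
have : phi0 T a b (lb, u0) = (u0, u1); last by move=> ->; rewrite eqxx.
move: cyc1; rewrite /= => /andP[_]; rewrite rcons_path lastE.
by case/andP=> _ /eqP.
Qed.

Lemma flipT_rest : fcycle (phi T') ((u0, u2) :: r').
Proof.
have h : phi T' (u0, u2) = phi0 T a b (u1, u2) by exact: pba.
have hr d : d \in r' -> phi T' d = if d == (lb, u0) then (u0, u2) else phi0 T a b d.
  move=> Hd; case: eqP => [->|/eqP N]; first by exact: plb.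
  apply: pn => //; first by apply: m1; rewrite !inE Hd !orbT.
  by move: uc1; rewrite /= => /and3P[_ H _]; apply: contraNneq H => <-.
have := cyc1; rewrite /= => /andP[_]; rewrite !rcons_path lastE => /andP[Hp _].
have ul : uniq r' by case/and3P: uc1.
have [x [s E]] : exists x s, r' = x :: s.
  by case: r' lr' => // x s _; exists x, s.
move: Hp; rewrite E /= h => /andP[-> Hp] /=.
have ls : last x s = (lb, u0) by rewrite -lastE E.
rewrite ls hr // eqxx eqxx andbT.
have {}hr : {in x :: s, phi T' =1 fun d => if d == (lb, u0) then (u0, u2) else phi0 T a b d}.
  by rewrite -E.
have us : uniq (x :: s) by rewrite -E.
elim: s x us ls Hp hr {E} => //= y s IH x /andP[Nx us] ls /andP[/eqP Ey Hp] hr.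
rewrite hr ?mem_head // ifN; last first.
  apply: contraNneq Nx => ->; rewrite -ls; exact: mem_last.
rewrite Ey eqxx /=; apply: IH => // d Hd; apply: hr; by rewrite inE Hd orbT.
Qed.

Let D'E : darts T' = del_darts T a b :|: edge u2 u0. Proof. by []. Qed.

Lemma flipT_out d : d \in darts T -> d \notin P ->
  [/\ d \in darts T', phi T' d = phi T d & face T' d = face T d].
Proof.
have notP x : x \in darts T -> x \notin P -> x \in del_darts T a b.
  move=> xD xP; rewrite del_dartsE in_setD xD andbT.
  by apply: contra xP; rewrite /P !inE => /orP[]->; rewrite ?orbT.
have PhiE x : x \in darts T :\: P -> phi T' x = phi T x.
  rewrite in_setD => /andP[xP xD]; have x0 := notP _ xD xP.
  rewrite pn //.
  - rewrite phi0E // ifN //; apply: contra xP => H; rewrite -Pphi /P !inE.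
    by move: H; rewrite !inE => /orP[]->; rewrite ?orbT.
  - apply: contraNneq xP => ->; rewrite /P inE !in_cons; apply/orP; right; apply/orP; right.
    by rewrite -[_ || _]/((u1, u2) \in c0) -c0' rotE !inE eqxx orbT.
  - apply: contraNneq xP => ->; rewrite /P inE !in_cons; apply/orP; right; apply/orP; right.
    by rewrite -[_ || _]/((lb, u0) \in c0) -c0' rotE !inE lr' !orbT.
move=> dD dP; have dA : d \in darts T :\: P by rewrite in_setD dP.
split; last 2 [exact: PhiE].
- by rewrite D'E in_setU notP.
- apply: (eq_face_in PhiE) => // e; rewrite !in_setD Pphi => /andP[-> /=].
  by rewrite (phi_dart sT rT).
Qed.

Let face'1 : face T' (u2, u0) = [set d in [:: (u0, u1); (u1, u2); (u2, u0)]].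
Proof. by apply: (face_cycle flipT_tri); rewrite !inE eqxx !orbT. Qed.

Let face'2 : face T' (u0, u2) = [set d in (u0, u2) :: r'].
Proof. by apply: (face_cycle flipT_rest); rewrite mem_head. Qed.

Let c0E d : (d \in c0) = [|| d == (u0, u1), d == (u1, u2) | d \in r'].
Proof. by rewrite -c0' rotE !inE. Qed.

Let P'E : P' = face T' (u2, u0) :|: face T' (u0, u2).
Proof.
apply/setP=> d; rewrite /P' inE 2!in_cons c0E face'1 face'2 !inE.
by do ![case: (d == _) => //=]; rewrite ?orbT.
Qed.

Let PU : P = edge w2 w0 :|: [set d in c0].
Proof. by apply/setP=> d; rewrite /P !inE -!orbA. Qed.

Let P'U : P' = edge u2 u0 :|: [set d in c0].
Proof. by apply/setP=> d; rewrite /P' !inE -!orbA. Qed.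

Let N20 : (u2, u0) \notin darts T.
Proof. by rewrite -(rv_dart sT). Qed.

Let E'N d : d \in edge u2 u0 -> d \notin darts T.
Proof. by rewrite !inE => /orP[]/eqP->. Qed.

Let D'P : darts T' = (darts T :\: P) :|: P'.
Proof.
rewrite D'E del_dartsE P'U PU -(setDDl _ (edge w2 w0)).
set X := darts T :\: _; set C := [set d in c0].
have XC : X :&: C = C.
  by apply/setIidPr/subsetP=> d; rewrite in_set /X -del_dartsE => /walk_del.
by rewrite -{1}(setID X C) XC [C :|: (X :\: C)]setUC -setUA [C :|: edge u2 u0]setUC.
Qed.

Let DP' d : d \in darts T -> d \in P' -> d \in P.
Proof.
move=> dD; rewrite P'U PU [in X in X -> _]in_setU [in X in _ -> X]in_setU.
by case/orP=> [/E'N|->]; rewrite ?dD ?orbT.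
Qed.

(** The faces away from the region. They are common to [T] and [T'], so the face conditions have to
    be checked only for the two new faces, and the number of faces is unchanged. *)
Let O : {set {set dart}} := [set face T d | d in darts T :\: P].

Let facesE : faces T = face T (w2, w0) |: (face T (w0, w2) |: O).
Proof.
apply/setP=> F; rewrite !in_setU1; apply/idP/idP; last first.
  case/or3P=> [/eqP->|/eqP->|/imsetP[d]]; try exact: face_faces.
  by rewrite in_setD => /andP[_ H] ->; apply: face_faces.
case/facesP=> d dD ->; have [|dP] := boolP (d \in P).
  by rewrite PE in_setU => /orP[]/(face_eq sT rT) ->; rewrite eqxx ?orbT.
by apply/orP; right; apply/orP; right; apply: imset_f; rewrite in_setD dP.
Qed.

Let faces'E : faces T' = face T' (u2, u0) |: (face T' (u0, u2) |: O).
Proof.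
apply/setP=> F; rewrite !in_setU1; apply/idP/idP; last first.
  have inD' d : d \in P' -> d \in darts T' by move=> H; rewrite D'P in_setU H orbT.
  case/or3P=> [/eqP->|/eqP->|/imsetP[d]].
  - by apply: face_faces; rewrite inD' // P'E in_setU mem_face.
  - by apply: face_faces; rewrite inD' // P'E in_setU mem_face orbT.
  rewrite in_setD => /andP[Hp H] ->; have [dD' _ <-] := flipT_out H Hp.
  exact: face_faces.
case/facesP=> d; rewrite D'P in_setU => /orP[|].
  rewrite in_setD => /andP[Hp H] ->; have [dD' _ ->] := flipT_out H Hp.
  by apply/orP; right; apply/orP; right; apply: imset_f; rewrite in_setD Hp.
by rewrite P'E in_setU => /orP[]/(face_eq sT' rT') -> ->; rewrite eqxx ?orbT.
Qed.

Let ON F : F \in O -> [/\ F \in faces T, [disjoint F & P] & [disjoint F & P']].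
Proof.
case/imsetP=> d; rewrite in_setD => /andP[dP dD] ->.
have FP : [disjoint face T d & P].
  apply/pred0P=> e /=; apply/negP=> /andP[e1].
  rewrite PE in_setU => /orP[]/(face_eq sT rT); rewrite (face_eq sT rT e1) => E;
  by move: dP; rewrite PE in_setU -E mem_face ?orbT.
split=> //; first exact: face_faces.
apply/pred0P=> e /=; apply/negP=> /andP[e1 /DP'].
by rewrite (face_dart sT rT e1) => /(_ dD) e2; move/pred0P: FP => /(_ e) /=; rewrite e1 e2.
Qed.

Let O1 F : F \in faces T -> F != face T (w2, w0) -> F != face T (w0, w2) -> F \in O.
Proof. by rewrite facesE !in_setU1 => /or3P[/eqP->|/eqP->|//]; rewrite eqxx. Qed.

Let face'N : face T' (u2, u0) != face T' (u0, u2).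
Proof.
apply/eqP=> /setP/(_ (u0, u1)); rewrite face'1 face'2 !inE eqxx /=.
move: uc1; rewrite /= => /andP[]; rewrite inE negb_or => /andP[_ /negbTE ->] _.
rewrite orbF xpair_eqE eqxx /= => /esym/eqP E; move: Ha'.
by rewrite E del_dartsE in_setD (negbTE (sT.2 _)) andbF.
Qed.

Let cfaces : #|faces T'| = #|faces T|.
Proof.
have inP d : d \in P -> face T d \notin O.
  move=> dP; apply/negP=> /ON [_ /pred0P/(_ d) /=]; by rewrite mem_face dP.
have inP' d : d \in P' -> face T' d \notin O.
  move=> dP; apply/negP=> /ON [_ _ /pred0P/(_ d) /=]; by rewrite mem_face dP.
rewrite facesE faces'E !cardsU1 !in_setU1 !negb_or face'N eq_sym faceN.
by rewrite !inP ?inP' // ?PE ?P'E in_setU mem_face ?orbT.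
Qed.

Let cdarts : #|darts T'| = #|darts T|.
Proof.
rewrite D'E del_dartsE cardsU cardsD.
have -> : darts T :&: edge a b = edge a b.
  by apply/setIidPr/subsetP=> d; rewrite !inE => /orP[]/eqP->.
have -> : (darts T :\: edge a b) :&: edge u2 u0 = set0.
  apply/setP=> d; rewrite !in_setI in_setD in_set0; apply/negP=> /andP[/andP[_ H] /E'N].
  by rewrite H.
rewrite cards0 subn0 !cards2 !xpair_eqE [w2 == w0](negbTE n20) [u2 == u0]eq_sym (negbTE n02) /=.
rewrite subnK //; apply: leq_trans (subset_leq_card (A := mem (edge a b)) _).
  by rewrite cards2 xpair_eqE [w2 == w0](negbTE n20).
by apply/subsetP=> d; rewrite !inE => /orP[]/eqP->.
Qed.

Lemma reflex_new d : d \in R -> d \in P' -> d \in RP.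
Proof.
rewrite RE in_setU in_setD => /orP[/andP[N H] /DP'|//]; rewrite (negbTE N) => H'.
suff: d \in darts T by move/H'.
by case: ppT => [[[[_ _ _ _ [_ /subsetP/(_ d H)]]]]].
Qed.

Let R_out d : d \notin P' -> d \notin P -> (d \in R) = (d \in reflex T).
Proof.
move=> N1 N2; rewrite RE in_setU in_setD N2 /=.
by rewrite (negbTE (contra (subsetP RP' d) N1)) orbF.
Qed.

Let card_list (s : seq dart) (p : pred dart) : uniq s ->
  #|[set d in [set x in s] | p d]| = count p s.
Proof.
move=> us; rewrite -size_filter -(card_uniqP (filter_uniq p us)).
by apply: eq_card => d; rewrite !inE mem_filter andbC.
Qed.

Let connT' : connected_graph T'.
Proof.
have cT : connected_graph T by case: ppT => [[[[]]]].
have sy : connect_sym (adjv T').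
  by apply: sym_connect_sym => x y; rewrite /adjv (simple_sym sT').
have cc x y : (x, y) \in c0 -> connect (adjv T') x y.
  by move=> H; apply: connect1; rewrite /adjv D'P in_setU P'U in_setU inE H !orbT.
have c02 : connect (adjv T') w0 w2.
  by apply: (connect_trans (y := w1)); apply: cc; rewrite !inE eqxx ?orbT.
move=> u v; move: (cT u v); apply: connect_sub => x y Hxy.
have [|H] := boolP ((x, y) \in P); last first.
  by apply: connect1; rewrite /adjv D'P in_setU in_setD H [_ \in darts T]Hxy.
rewrite PU in_setU inE [_ \in c0]inE => /orP[|/cc//]; rewrite !inE !xpair_eqE.
by case/orP=> /andP[/eqP-> /eqP->] //; rewrite sy.
Qed.

Let utri : uniq [:: (u0, u1); (u1, u2); (u2, u0)].
Proof.
rewrite /= !inE !xpair_eqE negb_or !andbT.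
have n01' : u0 != u1.
  apply: contraTneq (m1 (mem_head _ _)) => ->; rewrite del_dartsE in_setD.
  by apply/nandP; right; apply: sT.2.
have n12' : u1 != u2.
  apply: contraTneq Ha' => ->; rewrite del_dartsE in_setD.
  by apply/nandP; right; apply: sT.2.
by rewrite (negbTE n01') (negbTE n12') (negbTE n02) ?andbF.
Qed.

Let urest : uniq ((u0, u2) :: r').
Proof.
case/and3P: uc1 => _ _ ur'; rewrite cons_uniq (ur' : uniq r') andbT.
apply/negP=> H; move: (m1 (d := (u0, u2))); rewrite !inE H !orbT => /(_ isT).
by rewrite (negbTE N02) !andbF.
Qed.

Lemma flipT_is4PPT : is4PPT T'.
Proof.
have [[[[_ _ _ pl [oF rD]] if3 orf r1] pt] f34] := ppT.
have oO : outer T \in O by apply: O1; rewrite // eq_sym.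
(* [Rhead] gives every vertex as many reflex angles inside the region as before, and outside nothing
   changes. *)
have r1E v : nreflex_at T' v = nreflex_at T v.
  have split_v (X : {set dart}) (Y : {set dart}) : 
    #|[set d in X :|: Y | d.2 == v]| = #|[set d in X | d.2 == v]| + #|[set d in Y | d.2 == v]|
      - #|[set d in X :&: Y | d.2 == v]|.
    rewrite -cardsUI; have -> : [set d in X | d.2 == v] :|: [set d in Y | d.2 == v] =
      [set d in X :|: Y | d.2 == v] by apply/setP=> d; rewrite !inE andb_orl.
    have -> : [set d in X | d.2 == v] :&: [set d in Y | d.2 == v] =
      [set d in X :&: Y | d.2 == v] by apply/setP=> d; rewrite !inE andbACA andbb.
    by rewrite addnK.
  rewrite /nreflex_at /= -[in RHS](setID (reflex T) P) RE !split_v Rhead.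
  have -> : [set d in (reflex T :\: P) :&: RP | d.2 == v] = set0.
    apply/setP=> d; rewrite in_set in_setI in_setD in_set0; apply/negP=> /andP[/andP[/andP[N H] H2] _].
    by move: N; rewrite (DP' (subsetP rD _ H) (subsetP RP' _ H2)).
  have -> : [set d in (reflex T :&: P) :&: (reflex T :\: P) | d.2 == v] = set0.
    apply/setP=> d; rewrite in_set !in_setI in_setD in_set0; apply/negP=> /andP[/andP[/andP[_ H] /andP[N _]] _].
    by rewrite H in N.
  by rewrite addnC.
split; last first.
  move=> F [HF NF]; move: HF; rewrite faces'E !in_setU1 => /or3P[/eqP->|/eqP->|/ON[H _ _]].
  - by left; rewrite face'1 cardsE (card_uniqP utri).
  - rewrite face'2 cardsE (card_uniqP urest) /= sr'.
    by case/orP: sr => /eqP->; [left|right].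
  - exact: f34.
split; last by move=> v; rewrite r1E.
split.
- split=> //.
  + by rewrite /planar_embedding cfaces cdarts.
  + split; first by rewrite faces'E !in_setU1 oO !orbT.
    apply/subsetP=> d; rewrite [reflex _]RE D'P !in_setU => /orP[|/(subsetP RP')->].
      by rewrite !in_setD => /andP[-> /(subsetP rD)->].
    by rewrite orbT.
- move=> F [HF NF]; move: HF; rewrite faces'E !in_setU1 => /or3P[/eqP->|/eqP->|].
  + rewrite face'1 card_list //= ?utri //.
    have inP' : {subset [:: (u0, u1); (u1, u2); (u2, u0)] <= P'}.
      by move=> d Hd; rewrite P'E in_setU face'1 inE Hd.
    have NR d : d \in [:: (u0, u1); (u1, u2); (u2, u0)] -> d \notin R.
      move=> Hd; apply/negP=> /reflex_new/(_ (inP' _ Hd)) H; by have /allP/(_ d Hd) := Rtri; rewrite /= H.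
    by rewrite !NR ?inE ?eqxx ?orbT.
  + rewrite face'2 card_list // -Rquad; apply: eq_in_count => d Hd; congr (~~ _).
    have dP' : d \in P' by rewrite P'E in_setU face'2 orbC in_set Hd.
    rewrite -[reflex T']/R; apply/idP/idP => [/reflex_new->//|H]; by rewrite RE in_setU H orbT.
  + case/ON=> H1 H2 H3; rewrite -(if3 F) //; apply: eq_card => d; rewrite !inE.
    have [dF /=|//] := boolP (d \in F); rewrite R_out //.
     by apply/negP=> H; move/pred0P: H3 => /(_ d) /=; rewrite dF H.
    by apply/negP=> H; move/pred0P: H2 => /(_ d) /=; rewrite dF H.
- apply/subsetP=> d dO; rewrite -[reflex T']/R R_out; first exact: (subsetP orf).
    by apply/negP=> H; have [_ _ /pred0P/(_ d) /=] := ON oO; rewrite dO H.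
  by apply/negP=> H; have [_ /pred0P/(_ d) /=] := ON oO; rewrite dO H.
- by move=> v; rewrite r1E.
Qed.

Lemma flipT_flip : flip T T'.
Proof.
have R0 : (face T (w2, w0) :|: face T (w0, w2)) :\ (w2, w0) :\ (w0, w2) = [set d in c0].
  rewrite -PE PU; apply/setP=> d.
  have nc x : x \in edge w2 w0 -> (x \in c0) = false.
    by move=> H; apply/negP=> /c0N; rewrite H.
  rewrite 2!in_setD1 in_setU !in_set.
  case: (eqVneq d (w0, w2)) => [->|N1]; first by rewrite nc // !inE eqxx orbT.
  case: (eqVneq d (w2, w0)) => [->|N2]; first by rewrite nc // !inE eqxx.
  by rewrite !in_set1 (negbTE N1) (negbTE N2).
exists w2, w0, u2, u0; rewrite R0; split=> //.
- split; last by rewrite face1 cardsE /= (card_uniqP _) //= !inE !xpair_eqE negb_or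
    (negbTE n01) (negbTE n12) [w0 == w2]eq_sym (negbTE n20) ?andbF.
  by split=> //; apply: face_faces.
- split=> //; first exact: del_rot_new.
  + by rewrite -P'E P'U setUC.
  + by rewrite face'1 face'2 face2 !cardsE (card_uniqP utri) (card_uniqP urest) (card_uniqP ur) /= sr' !eqxx.
  split=> //; last exact: flipT_is4PPT.
  move=> d; rewrite inE => Nc Ne Ne'; rewrite [in RHS]/reflex /= R_out //.
    by rewrite P'U in_setU inE (negbTE Nc) (negbTE Ne').
  by rewrite PU in_setU inE (negbTE Nc) (negbTE Ne).
Qed.

End FlipCore.
End Core.

(** * Flips in pentagons and squares *)

Section Faces.
Variable n : nat.
Notation dart := ('I_n * 'I_n)%type.
Implicit Types (T : cemb n) (D : {set dart}) (d : dart).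

Definition tri T x y z : bool :=
  [&& (x, y) \in darts T, fcycle (phi T) [:: (x, y); (y, z); (z, x)]
   & all [pred d | d \notin reflex T] [:: (x, y); (y, z); (z, x)]].

(* The reflex angle is the dart (s,p), at p. *)
Definition qd T p q r s : bool :=
  [&& (p, q) \in darts T, fcycle (phi T) [:: (p, q); (q, r); (r, s); (s, p)],
      (s, p) \in reflex T & all [pred d | d \notin reflex T] [:: (p, q); (q, r); (r, s)]].

Section Basic.
Variable T : cemb n.
Hypothesis ppT : is4PPT T.
Let sT := is4PPT_simple ppT.
Let rT := is4PPT_rot ppT.

Lemma reflex_dart d : d \in reflex T -> d \in darts T.
Proof. by move: d; apply/subsetP; case: ppT => [[[[_ _ _ _ []]]]]. Qed.

Lemma outer_reflex d : d \in outer T -> d \in reflex T.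
Proof. by move: d; apply/subsetP; case: ppT => [[[]]]. Qed.

Lemma outer_face : outer T \in faces T.
Proof. by case: ppT => [[[[_ _ _ _ []]]]]. Qed.

Lemma reflex_ex v : exists u, (u, v) \in reflex T.
Proof.
have := ppT.1.2 v; rewrite /nreflex_at => /eqP/cards1P[[u w] E].
have : (u, w) \in [set d in reflex T | d.2 == v] by rewrite E inE.
by rewrite !inE /= => /andP[H /eqP<-]; exists u.
Qed.

Lemma reflex_uniq u u' v : (u, v) \in reflex T -> (u', v) \in reflex T -> u = u'.
Proof.
have := ppT.1.2 v; rewrite /nreflex_at => /eqP/cards1P[x E] H1 H2.
have : (u, v) \in [set d in reflex T | d.2 == v] by rewrite !inE H1 eqxx.
have : (u', v) \in [set d in reflex T | d.2 == v] by rewrite !inE H2 eqxx.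
by rewrite E !inE => /eqP<- /eqP[].
Qed.

Lemma deg1_reflex u v : (u, v) \in darts T -> phi T (u, v) = (v, u) ->
  (u, v) \in reflex T.
Proof.
move=> uv E; have [w wv] := reflex_ex v.
suff <- : w = u by [].
apply: (rot_in_ind sT rT (P := fun x => x = u)) uv (reflex_dart wv) _ => //.
by move=> x _ ->; rewrite E.
Qed.

Lemma interior_reflex d : d \in darts T -> d \notin reflex T ->
  interior_face T (face T d).
Proof.
move=> dD dR; split; first exact: face_faces.
by apply: contraNneq dR => E; apply: outer_reflex; rewrite -E mem_face.
Qed.

Lemma triE x y z : tri T x y z ->
  [/\ [/\ (x, y) \in darts T, (y, z) \in darts T & (z, x) \in darts T],
      [/\ phi T (x, y) = (y, z), phi T (y, z) = (z, x) & phi T (z, x) = (x, y)] &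
      [/\ (x, y) \notin reflex T, (y, z) \notin reflex T & (z, x) \notin reflex T]].
Proof.
case/and3P=> D1 /= /and4P[/eqP h1 /eqP h2 /eqP h3 _] /and4P[r1 r2 r3 _]; split=> //.
have D2 : (y, z) \in darts T by rewrite -h1 phi_dart.
by split=> //; rewrite -h2 phi_dart.
Qed.

Lemma tri_rot x y z : tri T x y z -> tri T y z x.
Proof.
case/triE=> -[D1 D2 D3] [h1 h2 h3] [r1 r2 r3].
by rewrite /tri D2 /= h2 h3 h1 !eqxx r1 r2 r3.
Qed.

Lemma qdE p q r s : qd T p q r s ->
  [/\ [/\ (p, q) \in darts T, (q, r) \in darts T, (r, s) \in darts T & (s, p) \in darts T],
      [/\ phi T (p, q) = (q, r), phi T (q, r) = (r, s), phi T (r, s) = (s, p)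
        & phi T (s, p) = (p, q)] &
      [/\ (p, q) \notin reflex T, (q, r) \notin reflex T, (r, s) \notin reflex T
        & (s, p) \in reflex T]].
Proof.
case/and4P=> D1 /= /and5P[/eqP h1 /eqP h2 /eqP h3 /eqP h4 _] r4 /and4P[r1 r2 r3 _].
have D2 : (q, r) \in darts T by rewrite -h1 phi_dart.
have D3 : (r, s) \in darts T by rewrite -h2 phi_dart.
by split=> //; split=> //; rewrite -h3 phi_dart.
Qed.

Lemma tri_uniq x y z : tri T x y z -> uniq [:: x; y; z].
Proof.
case/triE=> -[D1 D2 D3] _ _; rewrite /= !inE negb_or (dart_neq sT D1) (dart_neq sT D2).
by rewrite eq_sym (dart_neq sT D3).
Qed.

(** [p = r] would make [q] a leaf and [q = s] would make [r] one; the only angle of a leaf is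
    reflex, while the angles at [q] and [r] are convex. *)
Lemma qd_uniq p q r s : qd T p q r s -> uniq [:: p; q; r; s].
Proof.
case/qdE=> -[D1 D2 D3 D4] [h1 h2 h3 h4] [r1 r2 r3 r4].
rewrite /= !inE !negb_or (dart_neq sT D1) (dart_neq sT D2) (dart_neq sT D3).
rewrite [p == s]eq_sym (dart_neq sT D4) !andbT /=; apply/andP; split.
  by apply: contraNneq r1 => E; apply: deg1_reflex; rewrite // h1 E.
by apply: contraNneq r2 => E; apply: deg1_reflex; rewrite // h2 -E.
Qed.

Lemma face_order d : #|face T d| = fingraph.order (phi T) d.
Proof. by apply: eq_card => e; rewrite inE. Qed.

(** Three convex angles among three or four leave no reflex angle or exactly one. In the second case
    the walk is restarted so that the reflex dart comes last, the form that [qd] expects. *)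
Lemma tri_or_qd d : d \in darts T -> face T d != outer T ->
  (exists x, tri T d.1 d.2 x) \/
  (exists p q r s, qd T p q r s /\ d \in [:: (p, q); (q, r); (r, s); (s, p)]).
Proof.
move=> dD dO; have iF : interior_face T (face T d) by split=> //; apply: face_faces.
have [[[_ if3 _ _] _] f34] := ppT.
have pI := phi_inj sT rT.
have split_c : #|face T d| = #|[set e in face T d | e \notin reflex T]|
                              + #|[set e in face T d | e \in reflex T]|.
  rewrite addnC -cardsUI.
  have -> : [set e in face T d | e \in reflex T] :&: [set e in face T d | e \notin reflex T] = set0.
    by apply/setP=> e; rewrite !inE; case: (e \in reflex T); rewrite ?andbF.
  rewrite cards0 addn0; apply: eq_card => e; rewrite !inE.
  by case: (e \in reflex T); rewrite ?andbF ?andbT ?orbF.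
rewrite (if3 _ iF) in split_c.
have walk e : exists x, phi T e = (e.2, x) by exists (rot T (e.2, e.1)).
case: d dD dO iF split_c => x y dD dO iF split_c.
have [z h1] := walk (x, y); have [w h2] := walk (y, z); have [t h3] := walk (z, w).
rewrite /= in h1 h2 h3.
have it3 : iter 3 (phi T) (x, y) = (w, t) by rewrite /= h1 h2 h3.
case: (f34 _ iF) => [c3|c4].
- left; exists z; have := iter_order pI (x, y).
  rewrite -face_order c3 it3 => -[ew et]; subst w t.
  rewrite c3 in split_c; have /eqP := split_c; rewrite -[X in X == _]addn0 eqn_add2l eq_sym.
  rewrite cards_eq0 => /eqP E0.
  have nr e : e \in face T (x, y) -> e \notin reflex T.
    by move=> H; apply/negP=> H'; have := in_set0 e; rewrite -E0 inE H H'.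
  rewrite /tri dD /= h1 h2 h3 !eqxx !nr ?mem_face //.
    by rewrite -h2 phi_face // -h1 phi_face ?mem_face.
  by rewrite -h1 phi_face ?mem_face.
- right; have [u h4] := walk (w, t); rewrite /= in h4.
  have := iter_order pI (x, y); rewrite -face_order c4 iterS it3 h4 => -[et eu]; subst t u.
  rewrite c4 in split_c; have /eqP := split_c; rewrite -[X in X == _]addn1 eqn_add2l eq_sym.
  case/cards1P=> e0 E0.
  have refE e : e \in face T (x, y) -> (e \in reflex T) = (e == e0).
    by move=> H; have := in_set1 e e0; rewrite -E0 inE H.
  have fE : face T (x, y) = [set e in [:: (x, y); (y, z); (z, w); (w, x)]].
    by apply: face_cycle => //=; rewrite ?h1 ?h2 ?h3 ?h4 ?eqxx ?mem_head.
  have D2 : (y, z) \in darts T by rewrite -h1 phi_dart.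
  have D3 : (z, w) \in darts T by rewrite -h2 phi_dart.
  have D4 : (w, x) \in darts T by rewrite -h3 phi_dart.
  have u4 : uniq [:: (x, y); (y, z); (z, w); (w, x)].
    by apply/card_uniqP; rewrite -[RHS]c4 fE cardsE.
  have e0F : e0 \in face T (x, y) by have := set11 e0; rewrite -E0 inE => /andP[].
  have := e0F; rewrite fE in_set => e0c.
  have refE' e : e \in [:: (x, y); (y, z); (z, w); (w, x)] -> (e \in reflex T) = (e == e0).
    by move=> H; apply: refE; rewrite fE in_set.
  have R1 := refE' (x, y); have R2 := refE' (y, z); have R3 := refE' (z, w); have R4 := refE' (w, x).
  rewrite !in_cons !eqxx ?orbT in R1 R2 R3 R4.
  have {}R1 := R1 isT; have {}R2 := R2 isT; have {}R3 := R3 isT; have {}R4 := R4 isT.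
  move: u4; rewrite /= !inE !negb_or => /and4P[/and3P[u12 u13 u14] /andP[u23 u24] u34 _].
  move: e0c; rewrite !inE => /or4P[]/eqP E; subst e0.
  + exists y, z, w, x; rewrite /qd D2 /= h1 h2 h3 h4 !eqxx R1 R2 R3 R4 eqxx.
    by rewrite ![_ == (x, y)]eq_sym u12 u13 u14 !inE eqxx !orbT.
  + exists z, w, x, y; rewrite /qd D3 /= h1 h2 h3 h4 !eqxx R1 R2 R3 R4 eqxx.
    by rewrite u12 [_ == (y, z)]eq_sym u23 [_ == (y, z)]eq_sym u24 !inE eqxx !orbT.
  + exists w, x, y, z; rewrite /qd D4 /= h1 h2 h3 h4 !eqxx R1 R2 R3 R4 eqxx.
    by rewrite u13 u23 [_ == (z, w)]eq_sym u34 !inE eqxx !orbT.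
  + exists x, y, z, w; rewrite /qd dD /= h1 h2 h3 h4 !eqxx R1 R2 R3 R4 eqxx.
    by rewrite u14 u24 u34 !inE eqxx.
Qed.

End Basic.
End Faces.

Section Flips.
Variable n : nat.
Notation dart := ('I_n * 'I_n)%type.
Implicit Types (T : cemb n) (D : {set dart}) (d : dart).

(* Inside the closed walk c, the edge e has been replaced by e'. *)
Definition frame T T' (e e' : dart) (c : seq dart) : Prop :=
  [/\ outer T' = outer T,
      forall d, (d \in darts T') =
        ((d \in darts T) && (d != e) && (d != rv e)) || (d == e') || (d == rv e') &
      forall d, d \in darts T -> d \notin [:: e, rv e & c] ->
        [/\ d \in darts T', phi T' d = phi T d, (d \in reflex T') = (d \in reflex T)
          & face T' d = face T d]].

(* RO and RP list the reflex angles of the quadrilateral before and after the flip. *)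
Lemma flip_gen T w0 w1 w2 r k u0 u1 u2 r' (RO RP : seq dart) :
  is4PPT T -> tri T w0 w1 w2 ->
  fcycle (phi T) ((w0, w2) :: r) -> uniq ((w0, w2) :: r) ->
  (size r == 2) || (size r == 3) ->
  {in (w0, w2) :: r, forall d, (d \in reflex T) = (d \in RO)} ->
  {subset RO <= (w0, w2) :: r} -> ~~ all (mem RO) ((w0, w2) :: r) ->
  seq.rot k [:: (w0, w1), (w1, w2) & r] = [:: (u0, u1), (u1, u2) & r'] ->
  (u0, u2) \notin darts T -> u0 != u2 ->
  {subset RP <= (u0, u2) :: r'} ->
  all [pred d | d \notin RP] [:: (u0, u1); (u1, u2); (u2, u0)] ->
  count [pred d | d \notin RP] ((u0, u2) :: r') = 3 ->
  map snd RP = map snd RO -> uniq RP -> uniq RO ->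
  exists T', [/\ flip T T', is4PPT T', tri T' u0 u1 u2, fcycle (phi T') ((u0, u2) :: r') &
     {in (u0, u2) :: r', forall d, (d \in reflex T') = (d \in RP)} /\
     frame T T' (w0, w2) (u0, u2) [:: (w0, w1), (w1, w2) & r]].
Proof.
move=> ppT tT rT ur sr refO RO_sub nRO rotE N02 n02 RPs RPt RPq hd uRP uRO.
have [[D01 D12 D20] [h1 h2 h3] [r1 r2 r3]] := triE ppT tT.
have tc : fcycle (phi T) [:: (w0, w1); (w1, w2); (w2, w0)] by case/and3P: tT.
set P := [set d in [:: (w2, w0), (w0, w2), (w0, w1), (w1, w2) & r]].
pose RPset : {set dart} := [set d in RP].
pose R := (reflex T :\: P) :|: RPset.
have c0m x : x \in (u0, u1) :: (u1, u2) :: r' -> x \in (w0, w1) :: (w1, w2) :: r.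
  by rewrite -rotE mem_rot.
have reP : reflex T :&: P = [set d in RO].
  apply/setP=> d; rewrite in_setI !in_set; apply/andP/idP.
    case=> dR; rewrite !in_cons => /or4P[]; try by move/eqP=> E; rewrite E (negbTE r3) in dR.
    - by move/eqP=> E; rewrite -refO ?E ?mem_head // -E.
    - by move/eqP=> E; rewrite E (negbTE r1) in dR.
    case/orP=> [/eqP E|dr]; first by rewrite E (negbTE r2) in dR.
    by rewrite -refO // in_cons dr orbT.
  move=> dO; rewrite refO ?dO; last exact: RO_sub.
  by split=> //; move: (RO_sub _ dO); rewrite !in_cons => /orP[->|->]; rewrite !orbT.
(* Some angle of the other face is convex, hence it is not the outer face. *)
have F1 : face T (w0, w2) != outer T.
  apply: contra nRO => /eqP E; apply/allP=> d dr /=.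
  rewrite -refO //; apply: (outer_reflex ppT); rewrite -E.
  by rewrite (face_cycle rT (mem_head _ _)) inE.
have Tint : face T (w2, w0) != outer T by case: (interior_reflex ppT D20 r3).
have sRP : RPset \subset [set d in [:: (u2, u0), (u0, u2), (w0, w1), (w1, w2) & r]].
  apply/subsetP=> d; rewrite !in_set => /RPs; rewrite in_cons => /orP[/eqP->|H].
    by rewrite !in_cons eqxx orbT.
  rewrite 2!in_cons; apply/orP; right; apply/orP; right; apply: c0m.
  by rewrite !in_cons H !orbT.
have cnt (s : seq dart) v : uniq s -> #|[set d in [set x in s] | d.2 == v]| = count (pred1 v) (map snd s).
  move=> us; rewrite count_map -size_filter -(card_uniqP (filter_uniq _ us)).
  by apply: eq_card => d; rewrite !inE mem_filter andbC.
have Hh v : #|[set d in RPset | d.2 == v]| = #|[set d in reflex T :&: P | d.2 == v]|.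
  by rewrite reP !cnt ?hd.
have Rt : all [pred d | d \notin RPset] [:: (u0, u1); (u1, u2); (u2, u0)].
  by move: RPt; rewrite /= !inE.
have Rq : count [pred d | d \notin RPset] ((u0, u2) :: r') = 3.
  by rewrite -RPq; apply: eq_count => d; rewrite /= inE.
have wd := walk_del ppT D01 tc rT ur.
have fl := flipT_flip ppT D01 tc rT ur sr rotE N02 n02 (erefl R) sRP Rt Rq Hh F1 Tint.
set T' := flipT T w2 w0 u2 u1 u0 (last (u1, u2) r').1 R.
have ppT' : is4PPT T' by exact: (flipT_is4PPT ppT D01 tc rT ur sr rotE N02 n02 (erefl R) sRP Rt Rq Hh F1 Tint).
have refN x : x \in [:: (u2, u0), (u0, u2), (u0, u1), (u1, u2) & r'] -> (x \in reflex T') = (x \in RP).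
  move=> Hx; have Hx' : x \in [set d in [:: (u2, u0), (u0, u2), (w0, w1), (w1, w2) & r]].
    rewrite inE; move: Hx; rewrite 2!in_cons [in X in _ -> X]in_cons [in X in _ -> X]in_cons.
    by case/or3P=> [->|->|/c0m ->]; rewrite ?orbT.
  apply/idP/idP => H.
    have := reflex_new ppT N02 (erefl R) H Hx'.
    by rewrite inE.
  by rewrite /= in_setU [_ \in RPset]inE H orbT.
exists T'; split=> //.
- apply/and3P; split.
  + by rewrite /= in_setU wd // c0m // mem_head.
  + exact: (flipT_tri ppT D01 tc rT ur _ _ rotE N02 n02).
  + apply/allP=> d Hd; rewrite inE refN; last first.
      by move: Hd; rewrite !inE => /or3P[]->; rewrite ?orbT.
    by have /allP/(_ d Hd) := RPt.
- exact: (flipT_rest ppT D01 tc rT ur _ _ rotE N02 n02).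
split.
  by move=> d Hd; apply: refN; move: Hd; rewrite !in_cons => /orP[]->; rewrite ?orbT.
split=> //.
  move=> d; rewrite /= in_setU del_dartsE in_setD !inE negb_or [in LHS]andbC.
  rewrite -[rv (w0, w2)]/(w2, w0) -[rv (u0, u2)]/(u2, u0).
  by case: (d \in darts T); case: (d == (w2, w0)); case: (d == (w0, w2)); case: (d == (u2, u0)); case: (d == (u0, u2)).
move=> d dD Nd.
have dP : d \notin P.
  by rewrite inE; move: Nd; rewrite !in_cons !negb_or => /and3P[-> -> ->].
have [dD' E1 E2] := flipT_out ppT D01 tc rT ur sr R rotE N02 dD dP.
split=> //; rewrite /= in_setU in_setD dP [_ \in RPset]inE /=.
have [dRP|_] := boolP (d \in RP); last by rewrite orbF.
have := subsetP sRP d; rewrite !inE dRP => /(_ isT) /orP[/eqP E|/orP[/eqP E|H]].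
- by move: N02; rewrite -(rv_dart (is4PPT_simple ppT)) /rv /= -E dD.
- by move: N02; rewrite -E dD.
by move: dP; rewrite !inE H !orbT.
Qed.

Lemma flip_gen1 T w0 w1 w2 r k u0 u1 u2 r' o o' :
  is4PPT T -> tri T w0 w1 w2 ->
  fcycle (phi T) ((w0, w2) :: r) -> uniq ((w0, w2) :: r) -> size r = 3 ->
  o \in (w0, w2) :: r ->
  {in (w0, w2) :: r, forall d, (d \in reflex T) = (d == o)} ->
  seq.rot k [:: (w0, w1), (w1, w2) & r] = [:: (u0, u1), (u1, u2) & r'] ->
  (u0, u2) \notin darts T -> u0 != u2 ->
  o' \in (u0, u2) :: r' -> o'.2 = o.2 ->
  exists T', [/\ flip T T', is4PPT T', tri T' u0 u1 u2, fcycle (phi T') ((u0, u2) :: r') &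
     [/\ uniq ((u0, u2) :: r'), {in (u0, u2) :: r', forall d, (d \in reflex T') = (d == o')}
       & frame T T' (w0, w2) (u0, u2) [:: (w0, w1), (w1, w2) & r]]].
Proof.
move=> ppT tT rT ur sr or refo rotE N02 n02 o'r o2.
have [[D01 D12 D20] _ _] := triE ppT tT.
have tc : fcycle (phi T) [:: (w0, w1); (w1, w2); (w2, w0)] by case/and3P: tT.
have uc : uniq [:: (u0, u1), (u1, u2) & r'].
  by rewrite -rotE rot_uniq (walk_uniq ppT D01 tc rT ur).
have cD x : x \in [:: (u0, u1), (u1, u2) & r'] -> x \in darts T.
  rewrite -rotE mem_rot => /(walk_del ppT D01 tc rT ur).
  by rewrite del_dartsE in_setD => /andP[].
have ur' : uniq ((u0, u2) :: r').
  case/and3P: uc => _ _ ur'; rewrite cons_uniq (ur' : uniq r') andbT.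
  by apply: contra N02 => H; apply: cD; rewrite !in_cons H !orbT.
have sr' : size r' = 3.
  by have /(congr1 size) := rotE; rewrite size_rot /= sr => -[].
have N20 : (u2, u0) \notin darts T by rewrite -(rv_dart (is4PPT_simple ppT)).
have o't : o' \notin [:: (u0, u1); (u1, u2); (u2, u0)].
  have no x : x \in r' -> x \notin [:: (u0, u1); (u1, u2); (u2, u0)].
    move=> xr; have xD : x \in darts T by apply: cD; rewrite !in_cons xr !orbT.
    move: uc; rewrite /= !inE !negb_or => /and3P[/andP[_ N1] N2 _].
    apply/and3P; split; [by apply: contraNneq N1 => <- | by apply: contraNneq N2 => <- |].
    by apply: contraNneq N20 => <-.
  move: o'r; rewrite in_cons => /orP[/eqP->|/no//]; rewrite !inE !negb_or.
  apply/and3P; split.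
  - by apply: contraNneq N02 => ->; apply: cD; rewrite mem_head.
  - by apply: contraNneq N02 => ->; apply: cD; rewrite !inE eqxx orbT.
  - by rewrite xpair_eqE (negbTE n02).
have [] := flip_gen (RO := [:: o]) (RP := [:: o']) ppT tT rT ur _ _ _ _ rotE N02 n02.
- by rewrite sr.
- by move=> d /refo ->; rewrite inE.
- by move=> d; rewrite inE => /eqP->.
- case: r sr ur {rT or refo rotE} => [|x r0] // _ /= /andP[]; rewrite !inE negb_or => /andP[xw _] _.
  by apply/negP=> /and3P[/eqP e1 /eqP e2 _]; rewrite e1 e2 eqxx in xw.
- by move=> d; rewrite inE => /eqP->.
- by apply/allP=> d Hd /=; rewrite inE; apply: contraNneq o't => <-.
- have -> : count [pred d | d \notin [:: o']] ((u0, u2) :: r') = 4 - count_mem o' ((u0, u2) :: r').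
    have <- : size ((u0, u2) :: r') = 4 by rewrite /= sr'.
    rewrite -(count_predC (pred1 o')) addKn; apply: eq_count => d.
    by rewrite /= inE.
  by rewrite count_uniq_mem // o'r.
- by rewrite /= o2.
- by [].
- by [].
move=> T' [H1 H2 H3 H4 [H5 H6]]; exists T'; split=> //; split=> //.
by move=> d /H5 ->; rewrite inE.
Qed.

Lemma qd_of T k (c : seq dart) p q r s : is4PPT T ->
  seq.rot k c = [:: (p, q); (q, r); (r, s); (s, p)] ->
  fcycle (phi T) c -> uniq c -> {in c, forall d, (d \in reflex T) = (d == (s, p))} ->
  qd T p q r s.
Proof.
move=> ppT E cy uc re.
have {}cy : fcycle (phi T) [:: (p, q); (q, r); (r, s); (s, p)] by rewrite -E rot_cycle.
have {}uc : uniq [:: (p, q); (q, r); (r, s); (s, p)] by rewrite -E rot_uniq.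
have {}re : {in [:: (p, q); (q, r); (r, s); (s, p)], forall d, (d \in reflex T) = (d == (s, p))}.
  by move=> d; rewrite -E mem_rot => /re.
have rs : (s, p) \in reflex T by rewrite re ?eqxx // !inE eqxx !orbT.
apply/and4P; split=> //.
  case/and5P: (cy) => _ _ _ /eqP<- _.
  by rewrite (phi_dart (is4PPT_simple ppT) (is4PPT_rot ppT)) (reflex_dart ppT).
move: uc; rewrite /= !inE !negb_or => /and4P[/and3P[u12 u13 u14] /andP[u23 u24] u34 _].
by rewrite !re ?inE ?eqxx ?orbT // u14 u24 u34.
Qed.

Lemma qd_neq T p q r s : is4PPT T -> qd T p q r s ->
  [/\ p != q, p != r, p != s & [/\ q != r, q != s & r != s]].
Proof.
move=> ppT /(qd_uniq ppT); rewrite /= !inE !negb_or.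
by case/and4P=> /and3P[-> -> ->] /andP[-> ->] ->.
Qed.

Lemma qd_data T p q r s : is4PPT T -> qd T p q r s ->
  let c := [:: (p, q); (q, r); (r, s); (s, p)] in
  [/\ fcycle (phi T) c, uniq c & {in c, forall d, (d \in reflex T) = (d == (s, p))}].
Proof.
move=> ppT H c; have [pq pr ps [qr qs rs]] := qd_neq ppT H.
case/and4P: H => D1 cy r4 /and4P[r1 r2 r3 _].
have uc : uniq c.
  rewrite /= !inE !xpair_eqE !negb_or /= (negbTE pq) (negbTE pr) (negbTE ps) (negbTE qr) (negbTE qs).
  by rewrite (negbTE rs).
split; [exact: cy | exact: uc |].
move=> d; rewrite !inE => /or4P[]/eqP->.
- by rewrite (negbTE r1) xpair_eqE (negbTE ps).
- by rewrite (negbTE r2) xpair_eqE (negbTE qs).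
- by rewrite (negbTE r3) xpair_eqE (negbTE rs).
- by rewrite r4 eqxx.
Qed.

(* The pentagon p q1 q2 q3 q4 with reflex vertex p, cut so that qi is the middle vertex
   of the triangle. *)
Definition pent T (i : nat) p q1 q2 q3 q4 : bool :=
  match i with
  | 1 => tri T p q1 q2 && qd T p q2 q3 q4
  | 2 => tri T q1 q2 q3 && qd T p q1 q3 q4
  | 3 => tri T q2 q3 q4 && qd T p q1 q2 q4
  | 4 => tri T q3 q4 p && qd T p q1 q2 q3
  | _ => false
  end.

Definition diag (i : nat) (p q1 q2 q3 q4 : 'I_n) : dart :=
  match i with 1 => (p, q2) | 2 => (q1, q3) | 3 => (q2, q4) | _ => (q3, p) end.

Definition walk5 (p q1 q2 q3 q4 : 'I_n) : seq dart :=
  [:: (p, q1); (q1, q2); (q2, q3); (q3, q4); (q4, p)].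

Lemma frame_mem T T' e e' c c' : c =i c' -> frame T T' e e' c -> frame T T' e e' c'.
Proof.
move=> E [H1 H2 H3]; split=> // d dD N; apply: H3 => //.
by move: N; rewrite !in_cons E.
Qed.

(** [m], [k], [l] and [s] are rotation offsets that align the walks with the form used in
    [flip_gen1]. For each of the twelve ordered pairs of cuts of the pentagon they are given
    explicitly, and the equations hold by computation. *)
Lemma pent_case T m w0 w1 w2 r k u0 u1 u2 r' p a b c l a' b' c' s :
  is4PPT T -> tri T w0 w1 w2 -> qd T p a b c ->
  seq.rot m [:: (p, a); (a, b); (b, c); (c, p)] = (w0, w2) :: r ->
  seq.rot k [:: (w0, w1), (w1, w2) & r] = [:: (u0, u1), (u1, u2) & r'] ->
  seq.rot l ((u0, u2) :: r') = [:: (p, a'); (a', b'); (b', c'); (c', p)] ->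
  (u0, u2) \notin darts T -> u0 != u2 ->
  exists T', [/\ flip T T', is4PPT T', tri T' u0 u1 u2 && qd T' p a' b' c' &
    frame T T' (w0, w2) (u0, u2) (seq.rot s [:: (w0, w1), (w1, w2) & r])].
Proof.
move=> ppT tT /(qd_data ppT) [cy uc re] E0 E1 E2 N n0.
have sr : size r = 3 by have /(congr1 size) := E0; rewrite size_rot => -[].
have [||||||||||T' [f1 f2 f3 f4 [f5 f6 f7]]] := @flip_gen1 T w0 w1 w2 r k u0 u1 u2 r' (c, p) (c', p) ppT tT.
- by rewrite -E0 rot_cycle.
- by rewrite -E0 rot_uniq.
- exact: sr.
- by rewrite -E0 mem_rot !inE eqxx !orbT.
- by move=> d; rewrite -E0 mem_rot => /re.
- exact: E1.
- by [].
- by [].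
- by rewrite -(mem_rot l) E2 !inE eqxx !orbT.
- by [].
exists T'; split=> //; first by rewrite f3; apply: (qd_of f2 E2 f4 f5 f6).
by apply: frame_mem f7 => d; rewrite mem_rot.
Qed.

Lemma pent_flip T i j p q1 q2 q3 q4 : is4PPT T -> pent T i p q1 q2 q3 q4 ->
  0 < j <= 4 -> i != j ->
  diag j p q1 q2 q3 q4 \notin darts T ->
  (diag j p q1 q2 q3 q4).1 != (diag j p q1 q2 q3 q4).2 ->
  exists T', [/\ flip T T', is4PPT T', pent T' j p q1 q2 q3 q4 &
    frame T T' (diag i p q1 q2 q3 q4) (diag j p q1 q2 q3 q4) (walk5 p q1 q2 q3 q4)].
Proof.
move=> ppT H ji ij N n0.
have [I1|I1|I1|I1] : [\/ i = 1, i = 2, i = 3 | i = 4].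
- by case: i H {ij} => [|[|[|[|[|i]]]]] //; [constructor 1 | constructor 2 | constructor 3 | constructor 4].
all: subst i; move: H => /= /andP[tT qT].
all: have [J1|J1|J1|J1] : [\/ j = 1, j = 2, j = 3 | j = 4]
  by case: j ji {ij N n0} => [|[|[|[|[|j]]]]] //; [constructor 1 | constructor 2 | constructor 3 | constructor 4].
all: subst j => //; rewrite /= in N n0; rewrite /walk5.
- exact: (@pent_case T 0 _ _ _ _ 1 _ _ _ _ _ _ _ _ 3 _ _ _ 0 ppT tT qT (erefl _) (erefl _) (erefl _) N n0).
- exact: (@pent_case T 0 _ _ _ _ 2 _ _ _ _ _ _ _ _ 2 _ _ _ 0 ppT tT qT (erefl _) (erefl _) (erefl _) N n0).
- exact: (@pent_case T 0 _ _ _ _ 3 _ _ _ _ _ _ _ _ 1 _ _ _ 0 ppT tT qT (erefl _) (erefl _) (erefl _) N n0).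
- exact: (@pent_case T 1 _ _ _ _ 4 _ _ _ _ _ _ _ _ 0 _ _ _ 4 ppT tT qT (erefl _) (erefl _) (erefl _) N n0).
- exact: (@pent_case T 1 _ _ _ _ 1 _ _ _ _ _ _ _ _ 2 _ _ _ 4 ppT tT qT (erefl _) (erefl _) (erefl _) N n0).
- exact: (@pent_case T 1 _ _ _ _ 2 _ _ _ _ _ _ _ _ 1 _ _ _ 4 ppT tT qT (erefl _) (erefl _) (erefl _) N n0).
- exact: (@pent_case T 2 _ _ _ _ 3 _ _ _ _ _ _ _ _ 0 _ _ _ 3 ppT tT qT (erefl _) (erefl _) (erefl _) N n0).
- exact: (@pent_case T 2 _ _ _ _ 4 _ _ _ _ _ _ _ _ 3 _ _ _ 3 ppT tT qT (erefl _) (erefl _) (erefl _) N n0).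
- exact: (@pent_case T 2 _ _ _ _ 1 _ _ _ _ _ _ _ _ 1 _ _ _ 3 ppT tT qT (erefl _) (erefl _) (erefl _) N n0).
- exact: (@pent_case T 3 _ _ _ _ 2 _ _ _ _ _ _ _ _ 0 _ _ _ 2 ppT tT qT (erefl _) (erefl _) (erefl _) N n0).
- exact: (@pent_case T 3 _ _ _ _ 3 _ _ _ _ _ _ _ _ 3 _ _ _ 2 ppT tT qT (erefl _) (erefl _) (erefl _) N n0).
- exact: (@pent_case T 3 _ _ _ _ 4 _ _ _ _ _ _ _ _ 2 _ _ _ 2 ppT tT qT (erefl _) (erefl _) (erefl _) N n0).
Qed.

Lemma square_flip T w0 w1 w2 w3 : is4PPT T -> tri T w0 w1 w2 -> tri T w0 w2 w3 ->
  (w1, w3) \notin darts T -> w1 != w3 ->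
  exists T', [/\ flip T T', is4PPT T', tri T' w1 w2 w3 && tri T' w1 w3 w0 &
    frame T T' (w0, w2) (w1, w3) [:: (w0, w1); (w1, w2); (w2, w3); (w3, w0)]].
Proof.
move=> ppT tT tT2 N n0; have [[D1 D2 D3] [h1 h2 h3] [r1 r2 r3]] := triE ppT tT2.
have cy : fcycle (phi T) [:: (w0, w2); (w2, w3); (w3, w0)] by case/and3P: tT2.
have uc : uniq [:: (w0, w2); (w2, w3); (w3, w0)].
  have /= := tri_uniq ppT tT2; rewrite !inE !xpair_eqE !negb_or.
  by case/andP=> /andP[/negbTE -> /negbTE ->] /andP[/negbTE-> _].
have re : {in [:: (w0, w2); (w2, w3); (w3, w0)], forall d, (d \in reflex T) = (d \in [::])}.
  by move=> d; rewrite !inE => /or3P[]/eqP->; exact/negbTE.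
have [|||||||||T' [f1 f2 f3 f4 [f6 f7]]] := @flip_gen T w0 w1 w2 [:: (w2, w3); (w3, w0)] 1
  w1 w2 w3 [:: (w3, w0); (w0, w1)] [::] [::] ppT tT cy uc _ re _ _ (erefl _) N n0 => //.
exists T'; split=> //.
  rewrite f3 /=; apply/and3P; split=> //.
    by have [[_ H _] _ _] := triE f2 f3; case: f7 => _ -> _; rewrite eqxx orbT.
  by apply/allP=> d /f6; rewrite /= => ->.
Qed.
End Flips.

(** * The inner side of a 3-cycle *)

Section Incidence.
Import GRing.Theory.
Local Open Scope ring_scope.

(* The two incidence maps compose to zero, so their ranks add up to at most #|EE|. *)
Lemma incidence_bound (F : fieldType) (I J L : finType)
    (FF : {set I}) (EE : {set J}) (VV : {set L}) (b : I -> J -> F) (a : J -> L -> F) :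
  (forall f v, f \in FF -> v \in VV -> \sum_(e in EE) b f e * a e v = 0) ->
  (forall x : I -> F, (forall e, e \in EE -> \sum_(f in FF) x f * b f e = 0) ->
     forall f, f \in FF -> x f = 0) ->
  (forall y : L -> F, (forall e, e \in EE -> \sum_(v in VV) a e v * y v = 0) ->
     forall v, v \in VV -> y v = 0) ->
  (#|FF| + #|VV| <= #|EE|)%N.
Proof.
move=> Hba Hb Ha.
pose B := \matrix_(i < #|FF|, j < #|EE|) b (enum_val i) (enum_val j).
pose A := \matrix_(i < #|EE|, j < #|VV|) a (enum_val i) (enum_val j).
have BA : B *m A = 0.
  apply/matrixP=> i j; rewrite !mxE -[RHS](Hba (enum_val i) (enum_val j)) ?enum_valP //.
  by rewrite [RHS]big_enum_val; apply: eq_bigr => e _; rewrite !mxE.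
have rB : row_free B.
  apply: inj_row_free => v vB; apply/rowP=> i; rewrite !mxE.
  pose x f := \sum_(i | enum_val i == f) v 0 i.
  have xE k : x (enum_val k) = v 0 k.
    rewrite /x (eq_bigl (pred1 k)) ?big_pred1_eq // => m.
    by rewrite (inj_eq enum_val_inj).
  rewrite -xE; apply: Hb; last exact: enum_valP.
  move=> e He; have := congr1 (fun M : 'rV_#|EE| => M 0 (enum_rank_in He e)) vB.
  rewrite !mxE => vB'; rewrite big_enum_val -[RHS]vB'; apply: eq_bigr => k _.
  by rewrite xE !mxE enum_rankK_in.
have rA : row_free A^T.
  apply: inj_row_free => v vA; apply/rowP=> i; rewrite !mxE.
  pose x f := \sum_(i | enum_val i == f) v 0 i.
  have xE k : x (enum_val k) = v 0 k.
    rewrite /x (eq_bigl (pred1 k)) ?big_pred1_eq // => m.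
    by rewrite (inj_eq enum_val_inj).
  rewrite -xE; apply: Ha; last exact: enum_valP.
  move=> e He; have := congr1 (fun M : 'rV_#|EE| => M 0 (enum_rank_in He e)) vA.
  rewrite !mxE => vA'; rewrite big_enum_val -[RHS]vA'; apply: eq_bigr => k _.
  by rewrite xE !mxE enum_rankK_in // mulrC.
have := mulmx0_rank_max BA; rewrite -(mxrank_tr A).
by rewrite (eqP rB) (eqP rA).
Qed.

End Incidence.

(** * Unions of faces cut off by a set of edges *)

Section Sides.
Variable n : nat.
Notation dart := ('I_n * 'I_n)%type.
Variable T : cemb n.
Hypotheses (sT : simple_graph T) (rT : rotation_system T) (cT : connected_graph T).
Implicit Types (d : dart) (K : {set dart}).

(** To be read with [rv_closed]: on darts, [K] is a union of faces, and crossing an edge outside [C]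
    does not leave it. *)
Definition phi_closed K := forall d, d \in darts T -> (phi T d \in K) = (d \in K).
Definition rv_closed (C K : {set dart}) :=
  forall d, d \in darts T -> d \notin C -> (rv d \in K) = (d \in K).

Lemma rotate_closed K v : phi_closed K ->
  (forall u, (u, v) \in darts T -> (v, u) \in K -> (u, v) \in K) ->
  forall u w, (u, v) \in darts T -> (w, v) \in darts T -> (u, v) \in K -> (w, v) \in K.
Proof.
move=> cK H1; apply: (rot_in_ind sT rT (P := fun u => (u, v) \in K)) => u uD uK.
set u' := (phi T (u, v)).2.
have pE : phi T (u, v) = (v, u') by [].
have D' : (u', v) \in darts T by rewrite -(rv_dart sT) -[rv _]/(v, u') -pE phi_dart.
have K' : (v, u') \in K by rewrite -pE cK.
exact: H1.
Qed.

(** The dual of a connected graph is connected: if one angle at a vertex is in [K], rotation puts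
    all of them there, and reversing an edge passes this on to the neighbours. *)
Lemma dual_connected K d0 : phi_closed K -> rv_closed set0 K -> d0 \in darts T ->
  d0 \in K -> forall d, d \in darts T -> d \in K.
Proof.
move=> cK rK D0 K0.
have rK' d : d \in darts T -> (rv d \in K) = (d \in K) by move=> H; rewrite rK ?inE.
pose W := [pred v | [forall u, ((u, v) \in darts T) ==> ((u, v) \in K)]].
have WI u v : (u, v) \in darts T -> (u, v) \in K -> W v.
  move=> uD uK; apply/forallP=> w; apply/implyP=> wD.
  by apply: (rotate_closed cK) uK => // t tD tK; rewrite -rK'.
have W0 : W d0.2 by apply: (WI d0.1); rewrite -surjective_pairing.
have clW : closed (adjv T) W.
  apply: intro_closed => [|u v uv Wu].
    by apply: sym_connect_sym => u v; rewrite /adjv (simple_sym sT).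
  apply: (WI u) => //; rewrite -(rK' (u, v)) //.
  by have /forallP/(_ v)/implyP := Wu; apply; rewrite -(rv_dart sT).
move=> [u v] uD; have : v \in W by rewrite -(closed_connect clW (cT d0.2 v)).
by move/forallP/(_ u)/implyP; apply.
Qed.

(** [phi] is followed in both directions so that, once [C] is closed under reversal, the relation is
    symmetric and sides are equivalence classes. *)
Definition side_rel (C : {set dart}) : rel dart := fun d d' =>
  (d \in darts T) && [|| d' == phi T d, d == phi T d' | (d \notin C) && (d' == rv d)].
Definition side (C : {set dart}) d0 : {set dart} := [set d | connect (side_rel C) d0 d].

Section Comp.
Variable C : {set dart}.
Hypothesis symC : forall d, (rv d \in C) = (d \in C).

Lemma side_sym : connect_sym (side_rel C).
Proof.
apply: sym_connect_sym => d d'; rewrite /side_rel.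
suff H e e' : (e \in darts T) && [|| e' == phi T e, e == phi T e' | (e \notin C) && (e' == rv e)] ->
   (e' \in darts T) && [|| e == phi T e', e' == phi T e | (e' \notin C) && (e == rv e')].
  by apply/idP/idP; apply: H.
case/andP=> eD /or3P[/eqP E|/eqP E|/andP[N /eqP E]].
- by rewrite E phi_dart // eD eqxx orbT.
- by rewrite {1}E phi_dart // in eD; rewrite eD E eqxx.
- by rewrite E rv_dart // eD symC N rvK eqxx !orbT.
Qed.

Lemma side_phi d0 : phi_closed (side C d0).
Proof.
move=> d dD; rewrite !inE; apply/idP/idP => H; apply: connect_trans H (connect1 _).
  by rewrite /side_rel phi_dart // dD eqxx orbT.
by rewrite /side_rel dD eqxx.
Qed.

Lemma side_rv d0 : rv_closed C (side C d0).
Proof.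
move=> d dD dC; rewrite !inE; apply/idP/idP => H; apply: connect_trans H (connect1 _).
  by rewrite /side_rel rv_dart // dD symC dC rvK eqxx !orbT.
by rewrite /side_rel dD dC eqxx !orbT.
Qed.

Lemma side_min K d0 : phi_closed K -> rv_closed C K -> {in side C d0, forall d, (d \in K) = (d0 \in K)}.
Proof.
move=> cK rK d; rewrite inE => H; apply/esym; apply: closed_connect H => e e'.
case/andP=> eD /or3P[/eqP->|/eqP E|/andP[N /eqP->]]; first by rewrite cK.
  by rewrite E cK // -(phi_dart sT rT) -E.
by rewrite rK.
Qed.

Lemma side_self d0 : d0 \in side C d0. Proof. by rewrite inE connect0. Qed.

Lemma side_dart d0 d : d \in side C d0 -> (d \in darts T) = (d0 \in darts T).
Proof.
by apply: side_min => [e eD | e eD _]; rewrite ?phi_dart ?rv_dart.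
Qed.

End Comp.
End Sides.

Section Count.
Variable n : nat.
Notation dart := ('I_n * 'I_n)%type.
Variable T : cemb n.
Hypotheses (sT : simple_graph T) (rT : rotation_system T) (cT : connected_graph T).
Implicit Types (d : dart) (K : {set dart}).
Variables (C : {set dart}) (X : {set 'I_n}) (x0 : 'I_n).
Hypothesis symC : forall d, (rv d \in C) = (d \in C).
Hypothesis CX : forall d, d \in C -> (d.1 \in X) && (d.2 \in X).
Hypothesis x0X : x0 \in X.

Definition face_sub K := [set f in faces T | f \subset K].
Definition vert_in K := [set v | (v \notin X) && [exists u, (u, v) \in K]].
Definition edge_in K := [set d in K | (d \notin C) && (d.1 < d.2)].

Lemma vert_all K v u : K \subset darts T -> phi_closed T K -> rv_closed T C K ->
  v \in vert_in K -> (u, v) \in darts T -> (u, v) \in K.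
Proof.
move=> /subsetP KD cK rK; rewrite inE => /andP[vX /existsP[w wK]] uD.
apply: (rotate_closed sT rT cK) (KD _ wK) uD wK => t tD tK.
by rewrite -(rK _ tD) //; apply/negP=> /CX /= /andP[_]; apply/negP.
Qed.

Lemma face_sub_closed K d : phi_closed T K -> d \in darts T -> d \in K ->
  face T d \in face_sub K.
Proof.
move=> cK dD dK; rewrite inE face_faces //; apply/subsetP=> e.
rewrite inE => /iter_findex <-; elim: (findex _ _ _) => //= k IH; rewrite cK //.
suff -> : forall m, (iter m (phi T) d \in darts T) by [].
by elim=> //= m Hm; rewrite phi_dart.
Qed.

Import GRing.Theory Num.Theory.

Lemma edge_sum K (g : dart -> rat) : K \subset darts T -> rv_closed T C K ->
  (\sum_(e in edge_in K) (g e + g (rv e)) = \sum_(d in K | d \notin C) g d)%R.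
Proof.
move=> /subsetP KD rK; rewrite big_split /= [RHS](bigID (fun d : dart => d.1 < d.2)) /=.
congr (_ + _)%R; first by apply: eq_bigl => d; rewrite inE -andbA.
rewrite [RHS](reindex_inj (@rv_inj n)) /=; apply: eq_bigl => d.
rewrite inE symC -leqNgt -andbA; case: (boolP (d \in C)) => [_|dC]; first by rewrite !andbF.
have [dD|dD] := boolP (d \in darts T); last first.
  by rewrite !(contraNF (KD _)) // rv_dart.
rewrite (rK _ dD dC) /= ltn_neqAle.
have : d.1 != d.2 by apply: (dart_neq sT); rewrite -surjective_pairing.
by rewrite -val_eqE /= => ->.
Qed.

Lemma edge_in_card K : K \subset darts T -> rv_closed T C K ->
  #|K :\: C| = 2 * #|edge_in K|.
Proof.
move=> KD rK; have := edge_sum (fun=> 1%R) KD rK.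
have -> : (\sum_(d in K | d \notin C) 1 = \sum_(d in K :\: C) 1 :> rat)%R.
  by apply: eq_bigl => d; rewrite in_setD andbC.
rewrite !sumr_const -[(1 + 1)%R]/((1 *+ 2)%R) -mulrnA => /eqP.
by rewrite eqr_nat => /eqP <-.
Qed.

Lemma pick_sum (I : finType) (A : {set I}) (F : I -> rat) u :
  (\sum_(i in A) F i * (u == i)%:R = if u \in A then F u else 0)%R.
Proof.
case: ifP => uA.
  rewrite (bigD1 u) //= eqxx mulr1 big1 ?addr0 // => i /andP[_].
  by rewrite eq_sym => /negbTE->; rewrite mulr0.
by rewrite big1 // => i iA; case: eqP => [E|_]; [rewrite -E uA in iA | rewrite mulr0].
Qed.

(** One half of Euler's formula for one side. The faces, less the one through [d0], and the inner
    vertices are both related to the inner edges by signed incidence. A face potential in the kernel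
    is constant across inner edges and zero on the face of [d0], hence zero; a vertex potential in
    the kernel is constant along edges and zero at [x0], hence zero. The two maps compose to zero
    because a face enters an inner vertex as often as it leaves it. *)
Lemma side_count d0 K : K = side T C d0 -> d0 \in darts T ->
  #|face_sub K| + #|vert_in K| <= #|edge_in K| + 1.
Proof.
move=> KE D0; have K0 : d0 \in K by rewrite KE side_self.
have cK : phi_closed T K by rewrite KE; apply: side_phi.
have rK : rv_closed T C K by rewrite KE; apply: side_rv.
have KD : K \subset darts T.
  by apply/subsetP=> d; rewrite KE => dK; rewrite (side_dart sT rT dK).
have f0 : face T d0 \in face_sub K by exact: face_sub_closed.
rewrite (cardsD1 (face T d0)) f0 -addnA addnC leq_add2r.
pose b (f : {set dart}) (e : dart) : rat := ((e \in f)%:R - (rv e \in f)%:R)%R.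
pose a (e : dart) (v : 'I_n) : rat := ((e.2 == v)%:R - (e.1 == v)%:R)%R.
apply: (incidence_bound (b := b) (a := a)).
- move=> f v; rewrite in_setD1 inE => /and3P[_ Ff /subsetP fK] Hv.
  pose g (d : dart) := ((d \in f)%:R * a d v)%R.
  have -> : (\sum_(e in edge_in K) b f e * a e v = \sum_(e in edge_in K) (g e + g (rv e)))%R.
    apply: eq_bigr => e _; rewrite /b /g mulrBl; congr (_ + _)%R.
    by rewrite -mulrN /a /= opprB.
  rewrite edge_sum //.
  have -> : (\sum_(d in K | d \notin C) g d = \sum_(d in f) a d v)%R.
    rewrite [RHS]big_mkcond [LHS]big_mkcond /=; apply: eq_bigr => d _.
    rewrite /g; have [df|] := boolP (d \in f); last by rewrite mul0r if_same.
    rewrite (fK _ df) /= mul1r; case: ifP => // /negbFE /CX /andP[d1 d2].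
    move: Hv; rewrite inE /a => /andP[vX _].
    have nX w : w \in X -> (w == v) = false by move=> wX; apply/eqP=> E; rewrite -E wX in vX.
    by rewrite !nX // subr0.
  rewrite /a sumrB; apply/eqP; rewrite subr_eq0; apply/eqP.
  rewrite [RHS](reindex_inj (phi_inj sT rT)) /=.
  by apply: eq_bigl => d; case/facesP: Ff => e _ ->; rewrite phi_face.
- move=> x Hx.
  pose Xf d := if face T d \in face_sub K :\ face T d0 then x (face T d) else 0%R.
  have XE d : (\sum_(f in face_sub K :\ face T d0) x f * (d \in f)%:R = Xf d)%R.
    rewrite /Xf -(pick_sum _ x); apply: eq_bigr => f; rewrite in_setD1 inE => /and3P[_ Ff _].
    congr (_ * (nat_of_bool _)%:R)%R; apply/idP/eqP => [/(face_in sT rT Ff)[]//|<-].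
    exact: mem_face.
  have {}Hx e : e \in edge_in K -> Xf e = Xf (rv e).
    move=> /Hx; rewrite /b; under eq_bigr do rewrite mulrBr.
    by rewrite sumrB !XE => /eqP; rewrite subr_eq0 => /eqP.
  have Xrv d : d \in darts T -> d \notin C -> d \in K -> Xf (rv d) = Xf d.
    move=> dD dC dK; have dN : d.1 != d.2.
      by apply: (dart_neq sT); rewrite -surjective_pairing.
    have [l|l] := ltnP d.1 d.2; first by rewrite -(Hx d) // inE dK dC.
    rewrite -{2}(rvK d) -(Hx (rv d)) // inE (rK _ dD dC) dK symC dC /=.
    by rewrite ltn_neqAle l andbT eq_sym.
  pose K2 := [set d | (d \in K) && (Xf d == 0%R)].
  have cK2 : phi_closed T K2.
    by move=> d dD; rewrite !inE cK // /Xf face_phi.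
  have rK2 : rv_closed T C K2.
    move=> d dD dC; rewrite !inE rK //; have [dK|//] := boolP (d \in K).
    by rewrite Xrv.
  move=> f; rewrite in_setD1 => /andP[N]; rewrite inE => /andP[/facesP[d dD E] /subsetP fK].
  have dK : d \in K by apply: fK; rewrite E mem_face.
  have : d \in K2.
    rewrite (side_min sT rT cK2 rK2 (d0 := d0)); last by rewrite -KE.
    by rewrite inE K0 /Xf in_setD1 eqxx.
  have fF : f \in faces T by rewrite E face_faces.
  have fS : f \subset K by apply/subsetP.
  by rewrite [d \in K2]inE /Xf in_setD1 -E N [f \in face_sub K]inE fF fS => /andP[_ /eqP].
- move=> y Hy.
  pose Y v := if v \in vert_in K then y v else 0%R.
  have {}Hy e : e \in edge_in K -> Y e.2 = Y e.1.
    move=> /Hy; rewrite /a; under eq_bigr do rewrite mulrC mulrBr.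
    by rewrite sumrB !pick_sum => /eqP; rewrite subr_eq0 => /eqP.
  move=> v vV; apply/eqP/negPn/negP => yv.
  pose W := [pred w | (w \in vert_in K) && (y w != 0%R)].
  have clW : closed (adjv T) W.
    apply: intro_closed => [|u w uw /andP[uV uy]].
      by apply: sym_connect_sym => u w; rewrite /adjv (simple_sym sT).
    have wu : (w, u) \in darts T by rewrite -(rv_dart sT).
    have wuK : (w, u) \in K by apply: (vert_all KD cK rK uV).
    have wuC : (w, u) \notin C.
      by apply/negP=> /CX /= /andP[_]; move: uV; rewrite inE => /andP[/negbTE->].
    have YE : Y w = Y u.
      have [l|l] := ltnP w u; first by rewrite -(Hy (w, u)) // inE wuK wuC.
      apply: (Hy (u, w)); rewrite inE -[(u, w)]/(rv (w, u)) rK // wuK symC wuC /=.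
      by rewrite ltn_neqAle l andbT eq_sym val_eqE (dart_neq sT wu).
    have: Y w != 0%R by rewrite YE /Y uV.
    by rewrite inE /Y; case: ifP => [_ ->|]; rewrite ?eqxx.
  have : x0 \in W by rewrite -(closed_connect clW (cT v x0)) inE /= vV.
  by case/andP; rewrite inE x0X.
Qed.
End Count.

Section Tricycle.
Variable n : nat.
Notation dart := ('I_n * 'I_n)%type.
Variable T : cemb n.
Implicit Types (d : dart) (K : {set dart}).
Hypothesis ppT : is4PPT T.
Let sT := is4PPT_simple ppT.
Let rT := is4PPT_rot ppT.

Lemma is4PPT_conn : connected_graph T. Proof. by case: ppT => [[[[]]]]. Qed.
Let cT := is4PPT_conn.

(** Turning around [v] from [s], no edge of [C] is met before [t], so the angles in between lie on
    one side. The converse is the same argument for the complement of [K]. *)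
Lemma arc (C : {set dart}) K v s t :
  phi_closed T K -> rv_closed T C K -> (s, v) \in darts T -> (t, v) \in darts T -> s != t ->
  (forall u, (u, v) \in C -> u = s \/ u = t) -> ((s, v) \in K) = ((v, t) \in K).
Proof.
have half K' : phi_closed T K' -> rv_closed T C K' -> (s, v) \in darts T -> (t, v) \in darts T ->
    s != t -> (forall u, (u, v) \in C -> u = s \/ u = t) -> (s, v) \in K' -> (v, t) \in K'.
  move=> cK rK sD tD st Cv sK; apply: contraT => tK.
  suff: (t, v) \in K' /\ t != t by rewrite eqxx; case.
  apply: (rot_in_ind sT rT (P := fun u => (u, v) \in K' /\ u != t)) sD tD _ => // u uD [uK ut].
  set u' := (phi T (u, v)).2.
  have pE : phi T (u, v) = (v, u') by [].
  have D' : (u', v) \in darts T by rewrite -(rv_dart sT) -[rv _]/(v, u') -pE phi_dart.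
  have K1 : (v, u') \in K' by rewrite -pE cK.
  have nt : u' != t by apply: contraNneq tK => <-.
  split=> //; have [/Cv[->//|E]|N] := boolP ((u', v) \in C); first by rewrite E eqxx in nt.
  by rewrite -(rK _ D' N).
move=> cK rK sD tD st Cv; apply/idP/idP; first exact: (half K).
apply: contraTT => sK; have := half (~: K); rewrite !inE; apply=> //.
- by move=> d dD; rewrite !inE cK.
- by move=> d dD dC; rewrite !inE rK.
Qed.

Variables x y z : 'I_n.
Hypotheses (xy : (x, y) \in darts T) (yz : (y, z) \in darts T) (zx : (z, x) \in darts T).

Definition cyc3 : {set dart} := [set d in [:: (x, y); (y, z); (z, x); (y, x); (z, y); (x, z)]].
Definition vset3 : {set 'I_n} := [set v in [:: x; y; z]].

Let nxy : x != y := dart_neq sT xy.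
Let nyz : y != z := dart_neq sT yz.
Let nzx : z != x := dart_neq sT zx.
Let yx : (y, x) \in darts T. Proof. by rewrite -(rv_dart sT). Qed.
Let zy : (z, y) \in darts T. Proof. by rewrite -(rv_dart sT). Qed.
Let xz : (x, z) \in darts T. Proof. by rewrite -(rv_dart sT). Qed.

Lemma cyc3_rv d : (rv d \in cyc3) = (d \in cyc3).
Proof.
case: d => u v; rewrite !inE !xpair_eqE /= !orbA.
case: (u == x); case: (u == y); case: (u == z); case: (v == x); case: (v == y); by case: (v == z).
Qed.

Lemma cyc3_vset d : d \in cyc3 -> (d.1 \in vset3) && (d.2 \in vset3).
Proof.
by rewrite inE !in_cons in_nil => /or4P[/eqP->|/eqP->|/eqP->|/or4P[/eqP->|/eqP->|/eqP->|//]];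
   rewrite /= !inE !eqxx ?orbT.
Qed.

Lemma cyc3_closed K : phi_closed T K -> rv_closed T cyc3 K ->
  [/\ ((y, z) \in K) = ((x, y) \in K), ((z, x) \in K) = ((x, y) \in K),
      ((z, y) \in K) = ((y, x) \in K) & ((x, z) \in K) = ((y, x) \in K)].
Proof.
have nyx : y != x by rewrite eq_sym.
have nzy : z != y by rewrite eq_sym.
have nxz : x != z by rewrite eq_sym.
have Cx u : (u, x) \in cyc3 -> u = y \/ u = z.
  rewrite !inE !xpair_eqE (negbTE nxy) (negbTE nxz) eqxx !andbF !andbT /= orbF.
  by case/orP=> /eqP->; [right|left].
have Cy u : (u, y) \in cyc3 -> u = x \/ u = z.
  rewrite !inE !xpair_eqE (negbTE nyx) (negbTE nyz) eqxx !andbF !andbT /= orbF.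
  by case/orP=> /eqP->; [left|right].
have Cz u : (u, z) \in cyc3 -> u = x \/ u = y.
  rewrite !inE !xpair_eqE (negbTE nzx) (negbTE nzy) eqxx !andbF !andbT /=.
  by case/orP=> /eqP->; [right|left].
have sw (P Q : Prop) : P \/ Q -> Q \/ P by case; [right|left].
move=> cK rK.
have h1 := arc cK rK xy zy nxz Cy.
have h2 := arc cK rK zy xy nzx (fun u H => sw _ _ (Cy u H)).
have h3 := arc cK rK yz xz nyx (fun u H => sw _ _ (Cz u H)).
have h4 := arc cK rK yx zx nyz Cx.
by split; rewrite -?h1 -?h2 -?h3 -?h4.
Qed.

(** The side holds exactly one orientation of the cycle, which accounts for the three extra
    darts. *)
Lemma side_card K : K \subset darts T -> phi_closed T K -> rv_closed T cyc3 K ->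
  ((x, y) \in K) != ((y, x) \in K) -> #|K| = 2 * #|edge_in cyc3 K| + 3.
Proof.
move=> KD cK rK Nxy; rewrite -(cardsID cyc3 K) addnC; congr (_ + _).
  exact: (edge_in_card sT cyc3_rv).
have [e1 e2 e3 e4] := cyc3_closed cK rK.
have u6 : uniq [:: (x, y); (y, z); (z, x); (y, x); (z, y); (x, z)].
  rewrite /= !inE !xpair_eqE (negbTE nxy) (negbTE nyz) (negbTE nzx).
  rewrite [y == x]eq_sym [z == y]eq_sym [x == z]eq_sym (negbTE nxy) (negbTE nyz) (negbTE nzx).
  by rewrite ?andbF.
have -> : #|K :&: cyc3| = count (mem K) [:: (x, y); (y, z); (z, x); (y, x); (z, y); (x, z)].
  rewrite -size_filter -(card_uniqP (filter_uniq _ u6)); apply: eq_card => d.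
  by rewrite in_setI in_set mem_filter.
rewrite /= e1 e2 e3 e4; move: Nxy.
by case: ((x, y) \in K); case: ((y, x) \in K).
Qed.

(** A 3-cycle separates the sphere. [S] is the side without the outer face, and its count is exact
    because the inequalities of [side_count] for the two sides add up to Euler's formula. *)
Lemma sides : exists S : {set dart},
  [/\ [/\ S \subset darts T, phi_closed T S & rv_closed T cyc3 S],
      [disjoint outer T & S], ((x, y) \in S) != ((y, x) \in S) &
      #|S| = 2 * (#|face_sub T S| + #|vert_in vset3 S|) + 1].
Proof.
pose K0 := side T cyc3 (x, y); pose K1 := side T cyc3 (y, x).
have c0 : phi_closed T K0 by apply: side_phi.
have c1 : phi_closed T K1 by apply: side_phi.
have r0 : rv_closed T cyc3 K0 by apply: side_rv cyc3_rv _.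
have r1 : rv_closed T cyc3 K1 by apply: side_rv cyc3_rv _.
have D0 : K0 \subset darts T by apply/subsetP=> d /(side_dart sT rT) ->.
have D1 : K1 \subset darts T by apply/subsetP=> d /(side_dart sT rT) ->.
have xX : x \in vset3 by rewrite !inE eqxx.
have n0 := side_count sT rT cT cyc3_rv cyc3_vset xX (erefl K0) xy.
have n1 := side_count sT rT cT cyc3_rv cyc3_vset xX (erefl K1) yx.
have s0 : (x, y) \in K0 by apply: side_self.
have s1 : (y, x) \in K1 by apply: side_self.
have cov d : d \in darts T -> (d \in K0) || (d \in K1).
  move=> dD; pose K := side T cyc3 d.
  have cK : phi_closed T K by apply: side_phi.
  have rK : rv_closed T cyc3 K by apply: side_rv cyc3_rv _.
  have sy := side_sym sT rT cyc3_rv.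
  suff: ((x, y) \in K) || ((y, x) \in K) by rewrite !inE sy (sy d).
  apply: contraT; rewrite negb_or => /andP[N1 N2].
  have [e1 e2 e3 e4] := cyc3_closed cK rK.
  have all_out e : e \in cyc3 -> (e \in K) = false.
    rewrite inE !in_cons in_nil.
    by case/or4P=> [/eqP->|/eqP->|/eqP->|/or4P[/eqP->|/eqP->|/eqP->|//]];
      rewrite ?e1 ?e2 ?e3 ?e4; apply/negbTE.
  case/negP: N1; apply: (dual_connected sT rT cT cK _ dD) => //; last exact: side_self.
  move=> e eD _; have [eC|/rK->//] := boolP (e \in cyc3).
  by rewrite !all_out // cyc3_rv.
have pl : n + #|faces T| = #|darts T| %/ 2 + 2 by case: ppT => [[[[]]]].
have faceK K d : phi_closed T K -> d \in darts T -> (face T d \subset K) = (d \in K).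
  move=> cK dD; apply/idP/idP=> [/subsetP H|dK]; first exact/H/mem_face.
  by have := face_sub_closed sT rT cK dD dK; rewrite inE => /andP[].
have u3 : uniq [:: x; y; z].
  by rewrite /= !inE negb_or nxy [x == z]eq_sym nzx nyz.
have cX : #|~: vset3| + 3 = n.
  have c3 : #|vset3| = 3 by rewrite cardsE (card_uniqP u3).
  by rewrite -[RHS]card_ord -(cardsC vset3) addnC c3.
have deg v : exists u, (u, v) \in darts T.
  by have [u uR] := reflex_ex ppT v; exists u; apply: reflex_dart.
have vcov v : v \notin vset3 -> (v \in vert_in vset3 K0) || (v \in vert_in vset3 K1).
  move=> vX; rewrite [v \in vert_in _ K0]in_set [v \in vert_in _ K1]in_set vX /=.
  have [u uD] := deg v; have /orP[H|H] := cov _ uD; apply/orP; [left|right];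
  by apply/existsP; exists u.
(* If one side held both orientations of the cycle it would be everything, and [side_count] would
   give [F + (n - 3) <= (E - 3) + 1] with all faces and edges, against [n + F = E + 2]. *)
have [B|B] := boolP ((y, x) \in K0).
  exfalso; have K0D d : d \in darts T -> d \in K0.
    move=> /cov /orP[//|]; by move/(side_min sT rT c0 r0) => ->.
  have f0 : face_sub T K0 = faces T.
    apply/setP=> F; rewrite inE; case: (boolP (F \in faces T)) => //= /facesP[d dD ->].
    by rewrite faceK // K0D.
  have v0 : vert_in vset3 K0 = ~: vset3.
    apply/setP=> v; rewrite [RHS]in_setC; apply/idP/idP; first by rewrite in_set => /andP[].
    move=> vX; rewrite in_set vX; apply/existsP.
    by have [u uD] := deg v; exists u; apply: K0D.
  have K0E : K0 = darts T by apply/eqP; rewrite eqEsubset D0; apply/subsetP.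
  have c6 : #|darts T| = 2 * #|edge_in cyc3 K0| + 6.
    rewrite -(edge_in_card sT cyc3_rv D0 r0) K0E -(cardsID cyc3 (darts T)) addnC.
    congr (_ + _).
    have -> : darts T :&: cyc3 = cyc3.
      apply/setIidPr/subsetP => d; rewrite inE !in_cons in_nil.
      by case/or4P=> [/eqP->|/eqP->|/eqP->|/or4P[/eqP->|/eqP->|/eqP->|//]].
    rewrite cardsE; apply/card_uniqP.
    rewrite /= !inE !xpair_eqE (negbTE nxy) (negbTE nyz) (negbTE nzx).
    rewrite [y == x]eq_sym [z == y]eq_sym [x == z]eq_sym (negbTE nxy) (negbTE nyz) (negbTE nzx).
    by rewrite ?andbF.
  move: n0; rewrite f0 v0; move: pl cX; rewrite c6; clear.
  move: #|faces T| #|~: vset3| #|edge_in _ _| => a b c; lia.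
have disK d : d \in K0 -> d \in K1 -> False.
  move=> d0 /(side_min sT rT c0 r0); rewrite d0 => /esym H.
  by case/negP: B.
have A : (x, y) \notin K1 by apply/negP=> /(disK _ s0).
have k0 := side_card D0 c0 r0; rewrite s0 (negbTE B) in k0.
have k1 := side_card D1 c1 r1; rewrite s1 (negbTE A) in k1.
have {}k0 := k0 isT; have {}k1 := k1 isT.
have kD : #|darts T| = #|K0| + #|K1|.
  rewrite -cardsUI; have -> : K0 :&: K1 = set0.
    by apply/setP=> d; rewrite in_setI in_set0; apply/negP=> /andP[/disK].
  rewrite cards0 addn0; apply: eq_card => d; rewrite in_setU.
  apply/idP/idP=> [/cov//|/orP[]]; exact/subsetP.
have kF : #|faces T| = #|face_sub T K0| + #|face_sub T K1|.
  rewrite -cardsUI; have -> : face_sub T K0 :&: face_sub T K1 = set0.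
    apply/setP=> F; rewrite in_setI !in_set; apply/negP=> /andP[/andP[/facesP[d dD ->]]].
    by rewrite !faceK // => H /andP[_ /(disK _ H)].
  rewrite cards0 addn0; apply: eq_card => F; rewrite in_setU !in_set -andb_orr.
  by case: (boolP (F \in faces T)) => //= /facesP[d dD ->]; rewrite !faceK // cov.
have kV : #|~: vset3| <= #|vert_in vset3 K0| + #|vert_in vset3 K1|.
  apply: leq_trans (leq_card_setU _ _); apply: subset_leq_card; apply/subsetP=> v.
  by rewrite in_setC in_setU => /vcov.
have /facesP[o oD oE] := outer_face ppT.
have disO K : phi_closed T K -> o \notin K -> [disjoint outer T & K].
  move=> cK oK; apply/pred0P=> d /=; apply/negP=> /andP[]; rewrite oE => dO dK.
  case/negP: oK; have dD : d \in darts T by rewrite (face_dart sT rT dO).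
  have := dK; rewrite -(faceK _ _ cK dD) (face_eq sT rT dO) => /subsetP; apply; exact: mem_face.
(* Apart from the cycle, the two sides share out the faces, vertices and edges of [T], so by Euler's
   formula neither inequality can be strict. *)
have [cnt0 cnt1] : #|K0| = 2 * (#|face_sub T K0| + #|vert_in vset3 K0|) + 1 /\
                   #|K1| = 2 * (#|face_sub T K1| + #|vert_in vset3 K1|) + 1.
  move: pl cX kV n0 n1; rewrite kD kF k0 k1; clear.
  move: #|face_sub T K0| #|face_sub T K1| #|vert_in _ K0| #|vert_in _ K1| #|~: _|.
  move: #|edge_in _ K0| #|edge_in _ K1| => e0 e1 f0 f1 v0 v1 v pl cX kV n0 n1.
  suff: f0 + v0 = e0 + 1 /\ f1 + v1 = e1 + 1 by lia.
  have : (2 * e0 + 3 + (2 * e1 + 3)) %/ 2 = e0 + e1 + 3 by lia.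
  lia.
have [o0|o0] := boolP (o \in K0).
- exists K1; split=> //; last by rewrite s1 (negbTE A).
  by apply: disO => //; apply/negP=> /(disK _ o0).
- exists K0; split=> //; last by rewrite s0 (negbTE B).
  exact: disO.
Qed.

End Tricycle.

Section TricycleInside.
Variable n : nat.
Notation dart := ('I_n * 'I_n)%type.
Variable T : cemb n.
Implicit Types (d : dart) (S : {set dart}).
Hypothesis ppT : is4PPT T.
Let sT := is4PPT_simple ppT.
Let rT := is4PPT_rot ppT.

Lemma face_sum S (A : {set dart}) : S \subset darts T -> phi_closed T S ->
  #|S :&: A| = \sum_(f in face_sub T S) #|f :&: A|.
Proof.
move=> /subsetP SD cS; rewrite -sum1_card.
rewrite (partition_big (face T) (mem (face_sub T S))) /=; last first.
  by move=> d; rewrite in_setI => /andP[dS _]; apply: face_sub_closed => //; apply: SD.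
apply: eq_bigr => f; rewrite inE => /andP[Ff /subsetP fS].
rewrite -sum1_card; apply: eq_bigl => d; rewrite !in_setI.
apply/andP/andP => [[/andP[_ dA] /eqP <-]|[df dA]]; first by rewrite mem_face.
by rewrite (fS _ df) dA; have [-> _] := face_in sT rT Ff df.
Qed.

Lemma face_bounds f : interior_face T f ->
  #|f :&: ~: reflex T| = 3 /\ #|f :&: reflex T| <= 1.
Proof.
move=> iF; have [[[_ if3 _ _] _] f34] := ppT.
have e3 : #|f :&: ~: reflex T| = 3.
  by rewrite -(if3 f iF); apply: eq_card => d; rewrite !inE.
split=> //; have := cardsID (reflex T) f; rewrite setDE e3.
by case: (f34 f iF) => -> ; clear; move: #|_ :&: _| => m; lia.
Qed.

Variables x y z : 'I_n.
Hypotheses (xy : (x, y) \in darts T) (yz : (y, z) \in darts T) (zx : (z, x) \in darts T).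

(* S is the side of the 3-cycle xyz that does not contain the outer face. *)
Lemma tricycle : exists S : {set dart},
  [/\ [/\ S \subset darts T, phi_closed T S & rv_closed T (cyc3 x y z) S],
      [disjoint outer T & S], ((x, y) \in S) != ((y, x) \in S),
      {in S, forall d, d \in reflex T -> d.2 \notin vset3 x y z} &
      {in S &, forall d1 d2, [disjoint face T d1 & reflex T] ->
         [disjoint face T d2 & reflex T] -> face T d1 = face T d2}].
Proof.
have [S [[SD cS rS] oS Nxy cnt]] := sides ppT xy yz zx.
have [cyR cyV] := (cyc3_rv x y z, @cyc3_vset n x y z).
exists S; set F := #|face_sub T S| in cnt; set V := #|vert_in _ S| in cnt.
have inF f : f \in face_sub T S -> interior_face T f.
  rewrite inE => /andP[Ff fS]; split=> //; apply: contraTneq oS => <-.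
  case/facesP: Ff fS => d dD -> /subsetP/(_ d (mem_face _ _)) dS.
  by apply/pred0Pn; exists d; rewrite /= mem_face.
pose R := #|S :&: reflex T|.
have c3 : #|S :&: ~: reflex T| = 3 * F.
  rewrite face_sum // mulnC -sum_nat_const; apply: eq_bigr => f /inF.
  by case/face_bounds.
have RF : R = \sum_(f in face_sub T S) #|f :&: reflex T| by rewrite /R face_sum.
have cS3 : #|S| = 3 * F + R by rewrite -c3 /R -(cardsID (reflex T) S) setDE addnC.
have leRF : R <= F.
  by rewrite RF /F -sum1_card; apply: leq_sum => f /inF /face_bounds[].
pose RV := [set d in S :&: reflex T | d.2 \notin vset3 x y z].
have leV : V <= #|RV|.
  apply: leq_trans (leq_imset_card (fun d : dart => d.2) RV).
  apply: subset_leq_card; apply/subsetP=> v vV.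
  have [u uR] := reflex_ex ppT v; apply/imsetP; exists (u, v) => //.
  rewrite inE in_setI uR (vert_all sT rT cyV SD cS rS vV (reflex_dart ppT uR)) /=.
  by move: vV; rewrite inE => /andP[].
have RVs : RV \subset S :&: reflex T by apply/subsetP=> d; rewrite inE => /andP[].
have leRV : #|RV| <= R by apply: subset_leq_card.
(* [3F + R = 2(F + V) + 1] together with [V <= #|RV| <= R <= F] forces [R = V] and [F = V + 1]:
   every reflex angle of this side sits at an inner vertex, and exactly one face has none. *)
have [FR RVR] : F = R + 1 /\ R <= #|RV|.
  move: cnt cS3 leRF leV leRV; clear.
  by move: #|S| #|RV| F V R => s rv f v r; lia.
split=> //.
- move=> d dS dR; have : d \in S :&: reflex T by rewrite in_setI dS.
  have /eqP <- : RV == S :&: reflex T by rewrite eqEcard RVs.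
  by rewrite inE => /andP[].
- move=> d1 d2 S1 S2 t1 t2; apply/eqP; apply: contraT => N.
  have f1 : face T d1 \in face_sub T S by apply: face_sub_closed => //; apply: (subsetP SD).
  have f2 : face T d2 \in face_sub T S by apply: face_sub_closed => //; apply: (subsetP SD).
  have z1 : #|face T d1 :&: reflex T| = 0 by apply/eqP; rewrite cards_eq0 setI_eq0.
  have z2 : #|face T d2 :&: reflex T| = 0 by apply/eqP; rewrite cards_eq0 setI_eq0.
  have : R + 2 <= F; last by move: FR; clear; move: F R => f r; lia.
  rewrite RF (bigD1 (face T d1)) //= z1 (bigD1 (face T d2)) ?f2 1?eq_sym //= z2 !add0n.
  rewrite /F (cardsD1 (face T d1)) f1 (cardsD1 (face T d2)) in_setD1 eq_sym N f2 /=.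
  rewrite add1n add1n addn2 !ltnS -sum1_card.
  rewrite [X in _ <= X](eq_bigl (fun i => ((i \in face_sub T S) && (i != face T d1)) && (i != face T d2))).
    by apply: leq_sum => f /andP[/andP[/inF/face_bounds[]]].
  by move=> f; rewrite !in_setD1 andbC [(f != _) && (f \in _)]andbC.
Qed.

End TricycleInside.

(** * Edges that a flip may create *)

Section Blocked.
Variable n : nat.
Notation dart := ('I_n * 'I_n)%type.
Variable T : cemb n.
Implicit Types (d : dart) (S : {set dart}).
Hypothesis ppT : is4PPT T.
Let sT := is4PPT_simple ppT.
Let rT := is4PPT_rot ppT.

Lemma deg2_reflex u v w : (u, v) \in darts T -> phi T (u, v) = (v, w) ->
  phi T (w, v) = (v, u) -> (u, v) \in reflex T \/ (w, v) \in reflex T.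
Proof.
move=> uv E1 E2; have [t tR] := reflex_ex ppT v.
suff [<-|<-] : t = u \/ t = w by [left | right].
apply: (rot_in_ind sT rT (P := fun x => x = u \/ x = w)) uv (reflex_dart ppT tR) _; last by left.
by move=> x _ [->|->]; rewrite ?E1 ?E2; [right|left].
Qed.

Lemma deg2_adj u v w t : (u, v) \in darts T -> phi T (u, v) = (v, w) ->
  phi T (w, v) = (v, u) -> (t, v) \in darts T -> t = u \/ t = w.
Proof.
move=> uv E1 E2 tv.
apply: (rot_in_ind sT rT (P := fun x => x = u \/ x = w)) uv tv _; last by left.
by move=> x _ [->|->]; rewrite ?E1 ?E2; [right|left].
Qed.

(* The wedge at u1 from u0 to u2 holds no reflex angle and at most one edge, u1x;
   x = u0 means no edge. *)
Definition corner u0 u1 u2 x : Prop :=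
  [/\ (u0, u1) \in darts T, (u0, u1) \notin reflex T, (x, u1) \notin reflex T &
      (x = u0 /\ phi T (u0, u1) = (u1, u2)) \/
      (phi T (u0, u1) = (u1, x) /\ phi T (x, u1) = (u1, u2))].

Lemma corner_dart u0 u1 u2 x : corner u0 u1 u2 x -> (u1, u2) \in darts T.
Proof.
case=> D _ _ [[_ <-]|[E <-]]; rewrite phi_dart //.
by rewrite -(rv_dart sT) -[rv _]/(u1, x) -E phi_dart.
Qed.

(** The wedge at [u1] is on the inner side of the 3-cycle. Otherwise the reflex angle of [u1], which
    is not in the wedge, would lie on the inner side, where vertices of the cycle have no reflex
    angle. *)
Lemma blocked_corner u0 u1 u2 x : corner u0 u1 u2 x -> (u2, u0) \in darts T ->
  exists S, [/\ [/\ S \subset darts T, phi_closed T S & rv_closed T (cyc3 u0 u1 u2) S],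
    [/\ (u0, u1) \in S, (u1, u2) \in S & (u2, u0) \in S],
    {in S, forall d, d \in reflex T -> d.2 \notin vset3 u0 u1 u2},
    {in S &, forall d1 d2, [disjoint face T d1 & reflex T] ->
         [disjoint face T d2 & reflex T] -> face T d1 = face T d2} &
    forall t, (t, u1) \in S -> t = u0 \/ t = x].
Proof.
move=> co D20; have D12 := corner_dart co; have [D01 r0 rx cs] := co.
have [S [[SD cS rS] oS Nxy re tu]] := tricycle ppT D01 D12 D20.
have [e1 e2 e3 e4] := cyc3_closed ppT D01 D12 D20 cS rS.
have C1 u : (u, u1) \in cyc3 u0 u1 u2 -> u = u0 \/ u = u2.
  have := dart_neq sT D01; have := dart_neq sT D12; have := dart_neq sT D20.
  rewrite !inE !xpair_eqE => /negbTE n20 /negbTE n12 /negbTE n01.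
  rewrite [u1 == u0]eq_sym n01 n12 eqxx !andbF !andbT /= orbF.
  by case/orP=> /eqP->; [left|right].
have stepS K t : phi_closed T K -> rv_closed T (cyc3 u0 u1 u2) K -> (t, u1) \in darts T ->
   (t, u1) \in K -> (u2, u1) \in K ->
   let t' := (phi T (t, u1)).2 in (t', u1) \in K \/ t' = u0.
  move=> cK rK tD tK uK t'.
  have pE : phi T (t, u1) = (u1, t') by [].
  have D' : (t', u1) \in darts T by rewrite -(rv_dart sT) -[rv _]/(u1, t') -pE phi_dart.
  have K1 : (u1, t') \in K by rewrite -pE cK.
  have [/C1[->|->]|N] := boolP ((t', u1) \in cyc3 u0 u1 u2); [by right | by left |].
  by left; rewrite -(rK _ D' N).
have stepC t : (t, u1) \in darts T -> t = u0 \/ t = x ->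
   (phi T (t, u1)).2 = u2 \/ (phi T (t, u1)).2 = x.
  by move=> _ [->|->]; case: cs => [[-> ->]|[E1 E2]]; rewrite ?E1 ?E2; [left|right|left|left].
have around K : phi_closed T K -> rv_closed T (cyc3 u0 u1 u2) K -> (u2, u1) \in K ->
    forall t, (t, u1) \in darts T -> (t, u1) \in K \/ (t = u0 \/ t = x).
  move=> cK rK uK t tD.
  have D21 : (u2, u1) \in darts T by rewrite -(rv_dart sT).
  apply: (rot_in_ind sT rT (P := fun t => (t, u1) \in K \/ (t = u0 \/ t = x))) D21 tD _; last by left.
  move=> s sD [sK|/(stepC _ sD)[->|->]]; [|by left|by right; right].
  by case: (stepS K s cK rK sD sK uK) => [|->]; [left|right; left].
have S01 : (u0, u1) \in S.
  apply: contraT => N01.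
  have S21 : (u2, u1) \in S.
    by rewrite e3; move: Nxy; rewrite (negbTE N01); case: (_ \in S).
  have [t tR] := reflex_ex ppT u1.
  have [tS|[E|E]] := around S cS rS S21 t (reflex_dart ppT tR).
  - by have := re _ tS tR; rewrite !inE eqxx orbT.
  - by rewrite -E tR in r0.
  - by rewrite -E tR in rx.
exists S; split=> //; first by rewrite e1 e2 S01.
move=> t tS; have [||| |//] := around (~: S) _ _ _ t (subsetP SD _ tS).
- by move=> d dD; rewrite !inE cS.
- by move=> d dD dC; rewrite !inE rS.
- by rewrite inE e3; move: Nxy; rewrite S01; case: (_ \in S).
by rewrite inE tS.
Qed.

(** Unless the cut is at [q1], the dart from [p] to [q1] is on the quadrilateral. An edge from [p]
    to [q2] would enclose that face in the 3-cycle [p q1 q2], with its reflex angle at the vertex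
    [p] of the cycle. *)
Lemma pent_unb1 i p q1 q2 q3 q4 : pent T i p q1 q2 q3 q4 -> i != 1 ->
  (p, q2) \notin darts T.
Proof.
move=> H i1; apply/negP=> D; have D2 : (q2, p) \in darts T by rewrite -(rv_dart sT).
have [x [co [s [h [rs [a [b [h1 [h2 h3]]]]]]]]] : exists x, corner p q1 q2 x /\
   exists s, (s, p) \in darts T /\ (s, p) \in reflex T /\ exists a b,
   phi T (p, q1) = a /\ phi T a = b /\ phi T b = (s, p).
  case: i H i1 => [|[|[|[|[|i]]]]] //= /andP[/(triE ppT)[[t1 t2 t3] [u1 u2 u3] [r1 r2 r3]]
     /(qdE ppT)[[s1 s2 s3 s4] [h1 h2 h3 h4] [k1 k2 k3 k4]]] _.
  - by exists q3; split; [split=> //; right | exists q4; do !split=> //; exists (q1, q3), (q3, q4)].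
  - by exists p; split; [split=> //; left | exists q4; do !split=> //; exists (q1, q2), (q2, q4)].
  - by exists p; split; [split=> //; left | exists q3; do !split=> //; exists (q1, q2), (q2, q3)].
have [S [[SD cS rS] [S01 _ _] re _ _]] := blocked_corner co D2.
have aS : a \in S by rewrite -h1 cS //; apply: (subsetP SD).
have bS : b \in S by rewrite -h2 cS //; apply: (subsetP SD).
have sS : (s, p) \in S by rewrite -h3 cS //; apply: (subsetP SD).
by have := re _ sS rs; rewrite !inE eqxx.
Qed.

(** The mirror image, with the corner at [q4]; here the reflex dart is itself a side of the
    wedge. *)
Lemma pent_unb4 i p q1 q2 q3 q4 : pent T i p q1 q2 q3 q4 -> i != 4 ->
  (q3, p) \notin darts T.
Proof.
move=> H i4; apply/negP=> D; have D2 : (p, q3) \in darts T by rewrite -(rv_dart sT).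
have [x [co rs]] : exists x, corner q3 q4 p x /\ (q4, p) \in reflex T.
  case: i H i4 => [|[|[|[|[|i]]]]] //= /andP[/(triE ppT)[[t1 t2 t3] [u1 u2 u3] [r1 r2 r3]]
     /(qdE ppT)[[s1 s2 s3 s4] [h1 h2 h3 h4] [k1 k2 k3 k4]]] _.
  - by exists q3; split=> //; split=> //; left.
  - by exists q3; split=> //; split=> //; left.
  - by exists q2; split=> //; split=> //; right.
have [S [_ [_ S12 _] re _ _]] := blocked_corner co D2.
by have := re _ S12 rs; rewrite !inE eqxx !orbT.
Qed.

Lemma cyc3_out (u0 u1 u2 : 'I_n) (d : dart) : (d.1 \notin vset3 u0 u1 u2) || (d.2 \notin vset3 u0 u1 u2) ->
  d \notin cyc3 u0 u1 u2.
Proof. by rewrite -negb_and; apply: contra; apply: cyc3_vset. Qed.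

(** The edge would close the 3-cycle [w1 w2 w3] with both triangles on its inner side, which has
    room for only one. *)
Lemma square_unb w0 w1 w2 w3 : tri T w0 w1 w2 -> tri T w0 w2 w3 -> (w1, w3) \notin darts T.
Proof.
move=> t1 t2; apply/negP=> D; have D2 : (w3, w1) \in darts T by rewrite -(rv_dart sT).
have [[a1 a2 a3] [b1 b2 b3] [c1 c2 c3]] := triE ppT t1.
have [[d1 d2 d3] [e1 e2 e3] [f1 f2 f3]] := triE ppT t2.
have co : corner w1 w2 w3 w0 by split=> //; right.
have [S [[SD cS rS] [S01 S12 _] re tu _]] := blocked_corner co D2.
have fd x y z : tri T x y z -> [disjoint face T (x, y) & reflex T].
  move=> t; have [_ _ [g1 g2 g3]] := triE ppT t; have /and3P[_ cy _] := t.
  apply/pred0P=> d /=; rewrite (face_cycle cy (mem_head _ _)) inE !in_cons.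
  by apply/negP=> /andP[/or4P[/eqP->|/eqP->|/eqP->|]] //; apply/negP.
have S2 : (w2, w3) \in S by [].
have := tu _ _ S01 S2 (fd _ _ _ (tri_rot ppT t1)) (fd _ _ _ (tri_rot ppT t2)).
have /and3P[_ cy _] := tri_rot ppT t1.
rewrite (face_cycle cy (mem_head _ _)) => /setP/(_ (w2, w3)).
rewrite mem_face !inE !xpair_eqE.
have /= := tri_uniq ppT t1; have /= := tri_uniq ppT t2; rewrite !inE !negb_or.
case/and3P=> /andP[/negbTE n02 /negbTE n03] /negbTE n23 _ /and3P[/andP[/negbTE n01 _] /negbTE n12 _].
by rewrite [w2 == w1]eq_sym n12 [w2 == w0]eq_sym n02 [w3 == w0]eq_sym n03 ?andbF.
Qed.

(** An edge [q1 q3] closes a 3-cycle that encloses [q4]. An edge from [q4] to [q2] would then lie in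
    the wedge at [q2], whose only edge besides its sides leads to [x], and [x] is not [q4]. *)
Lemma pent_unb23 i p q1 q2 q3 q4 : pent T i p q1 q2 q3 q4 -> (i == 1) || (i == 4) ->
  q1 != q4 -> (q1, q3) \in darts T -> (q2, q4) \in darts T -> False.
Proof.
move=> H i14 n14 D1 D2.
have D31 : (q3, q1) \in darts T by rewrite -(rv_dart sT).
have [x [co [nx np n24 hS]]] : exists x, corner q1 q2 q3 x /\ [/\ x != q4, p \notin [:: q1; q2; q3],
   (q2 != q4) && (q3 != q4) & forall S, phi_closed T S -> rv_closed T (cyc3 q1 q2 q3) S ->
      (q2, q3) \in S -> (q3, q4) \in S].
  case: i H i14 => [|[|[|[|[|i]]]]] //= /andP[tT qT] _;
  have [[t1 t2 t3] [u1 u2 u3] [r1 r2 r3]] := triE ppT tT;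
  have [[s1 s2 s3 s4] [h1 h2 h3 h4] [k1 k2 k3 k4]] := qdE ppT qT;
  have [m1 m2 m3 [m4 m5 m6]] := qd_neq ppT qT;
  have /= := tri_uniq ppT tT; rewrite !inE !negb_or => /and3P[/andP[l1 l2] l3 _].
  - exists p; split; first by split=> //; right.
    split=> //; [by rewrite l1 m1 m2 | by rewrite m5 m6 |].
    by move=> S cS rS; rewrite -h2 cS.
  - have np : p \notin vset3 q1 q2 q3 by rewrite !inE !negb_or m1 m2 m3.
    exists q1; split; first by split=> //; left.
    split=> //; first by rewrite m1 m2 m3.
      rewrite l1 andbT; apply/eqP=> E.
      have E3 : phi T (p, q3) = (q3, q2) by rewrite u3 E.
      by case: (deg2_reflex s3 h3 E3) => K; [rewrite K in k3 | rewrite K in r3].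
    move=> S cS rS H; have H1 : (q3, p) \in S by rewrite -h3 cS.
    have H2 : (p, q3) \in S.
      by rewrite -[(p, q3)]/(rv (q3, p)) rS // cyc3_out //= np orbT.
    by rewrite -u3 cS.
have [S [[SD cS rS] [S01 S12 _] re tu out]] := blocked_corner co D31.
have S34 := hS S cS rS S12.
have q4X : q4 \notin vset3 q1 q2 q3.
  by case/andP: n24 => a b; rewrite !inE !negb_or eq_sym n14 eq_sym a eq_sym b.
have q4V : q4 \in vert_in (vset3 q1 q2 q3) S.
  by rewrite inE q4X; apply/existsP; exists q3.
have S24 : (q2, q4) \in S by apply: (vert_all sT rT (@cyc3_vset n q1 q2 q3) SD cS rS q4V).
have S42 : (q4, q2) \in S.
  by rewrite -[(q4, q2)]/(rv (q2, q4)) rS // cyc3_out //= q4X orbT.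
by have [E|E] := out _ S42; [rewrite E eqxx in n14 | rewrite E eqxx in nx].
Qed.

(** Otherwise [v] would have degree two and two convex angles. This is how the ends of a new edge
    are seen to be distinct. *)
Lemma corner_neq u v w : (u, v) \in darts T -> (u, v) \notin reflex T ->
  (w, v) \notin reflex T -> phi T (u, v) = (v, w) -> forall t, phi T (w, v) = (v, t) -> u != t.
Proof.
move=> uv ru rw E1 t E2; apply/eqP=> E; subst t.
by case: (deg2_reflex uv E1 E2) => K; [rewrite K in ru | rewrite K in rw].
Qed.

Lemma pent_neq i j p q1 q2 q3 q4 : pent T i p q1 q2 q3 q4 -> 0 < j <= 4 -> i != j ->
  (diag j p q1 q2 q3 q4).1 != (diag j p q1 q2 q3 q4).2.
Proof.
move=> H ji ij.
case: i H ij => [|[|[|[|[|i]]]]] //= /andP[tT qT];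
have [[t1 t2 t3] [u1 u2 u3] [r1 r2 r3]] := triE ppT tT;
have [[s1 s2 s3 s4] [h1 h2 h3 h4] [k1 k2 k3 k4]] := qdE ppT qT;
have [m1 m2 m3 [m4 m5 m6]] := qd_neq ppT qT;
case: j ji => [|[|[|[|[|j]]]]] //= _ _; try done; try by rewrite eq_sym.
- exact: (corner_neq t2 r2 k1 u2 h1).
- exact: (corner_neq s1 k1 r3 h1 u3).
- exact: (corner_neq t2 r2 k2 u2 h2).
- exact: (corner_neq s2 k2 r3 h2 u3).
- exact: (corner_neq t2 r2 k3 u2 h3).
- exact: (corner_neq s3 k3 r3 h3 u3).
Qed.

End Blocked.

(** * Flip sequences that keep a set of faces fixed *)

Section Moves.
Variable n : nat.
Notation dart := ('I_n * 'I_n)%type.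
Implicit Types (T : cemb n) (d : dart) (X : {set dart}).

Definition same X T T' : Prop := outer T' = outer T /\
  forall d, d \in X -> [/\ d \in darts T', phi T' d = phi T d & (d \in reflex T') = (d \in reflex T)].

Definition moves X k T T' : Prop :=
  exists2 j, j <= k & [/\ flips j T T', is4PPT T' & same X T T'].

Lemma same_refl X T : X \subset darts T -> same X T T.
Proof. by move=> /subsetP H; split=> // d /H. Qed.

Lemma same_trans X T T' T'' : same X T T' -> same X T' T'' -> same X T T''.
Proof.
move=> [o1 h1] [o2 h2]; split; first by rewrite o2.
by move=> d dX; have [_ e1 e2] := h1 d dX; have [e3 e4 e5] := h2 d dX; rewrite e4 e5.
Qed.

Lemma same_sub X T T' : X \subset darts T -> same X T T' -> X \subset darts T'.
Proof. by move=> _ [_ h]; apply/subsetP=> d /h[]. Qed.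

Lemma same_phi_closed X T T' : is4PPT T -> is4PPT T' -> X \subset darts T -> phi_closed T X ->
  same X T T' -> phi_closed T' X.
Proof.
move=> ppT ppT' sX cX S d dD'.
have [_ h] := S.
apply/idP/idP => H; last first.
  by have [_ -> _] := h d H; rewrite cX // (subsetP sX).
have pI := phi_inj (is4PPT_simple ppT') (is4PPT_rot ppT').
have it k : iter k (phi T) (phi T' d) \in X by elim: k => //= k IH; rewrite cX // (subsetP sX).
have it' k : iter k (phi T') (phi T' d) = iter k (phi T) (phi T' d).
  by elim: k => //= k ->; have [_ ->] := h _ (it k).
suff -> : d = iter (fingraph.order (phi T') d).-1 (phi T') (phi T' d) by rewrite it'.
by rewrite -iterSr prednK ?fingraph.order_gt0 // iter_order.
Qed.

Lemma flips_cat j k T T' T'' : flips j T T' -> flips k T' T'' -> flips (j + k) T T''.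
Proof. by elim=> // i A B C f _ IH /IH; apply: flipsS. Qed.

Lemma moves0 X k T : is4PPT T -> X \subset darts T -> moves X k T T.
Proof. by move=> ppT sX; exists 0 => //; split=> //; [constructor | apply: same_refl]. Qed.

Lemma moves_trans X j k T T' T'' : moves X j T T' -> moves X k T' T'' -> moves X (j + k) T T''.
Proof.
case=> i ij [f1 p1 s1] [l lk [f2 p2 s2]]; exists (i + l); first exact: leq_add.
by split=> //; [apply: flips_cat f1 f2 | apply: same_trans s1 s2].
Qed.

Lemma moves_leq X j k T T' : j <= k -> moves X j T T' -> moves X k T T'.
Proof. by move=> jk [i ij H]; exists i => //; apply: leq_trans jk. Qed.

Lemma moves_pp X k T T' : moves X k T T' -> is4PPT T'.
Proof. by case=> j _ []. Qed.

Lemma moves_same X k T T' : moves X k T T' -> same X T T'.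
Proof. by case=> j _ []. Qed.

Lemma move_frame X T T' e e' c : is4PPT T' -> flip T T' -> frame T T' e e' c -> X \subset darts T ->
  {in [:: e, rv e & c], forall d, d \notin X} -> moves X 1 T T'.
Proof.
move=> ppT' f [o _ H] sX N; exists 1 => //; split=> //.
  by apply: (@flipsS _ 0 T T' T') => //; constructor.
split=> // d dX; have [||d1 d2 d3 _] := H d; rewrite ?(subsetP sX) //.
by apply: contraL dX => /N.
Qed.

Section Fixed.
Variables (T : cemb n) (X : {set dart}).
Hypothesis ppT : is4PPT T.
Let sT := is4PPT_simple ppT.
Let rT := is4PPT_rot ppT.
Hypotheses (sX : X \subset darts T) (cX : phi_closed T X).

Lemma tri_face x y z d : tri T x y z -> d \in [:: (x, y); (y, z); (z, x)] ->
  face T d = [set e in [:: (x, y); (y, z); (z, x)]].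
Proof. by move=> /and3P[_ cy _]; apply: face_cycle. Qed.

Lemma qd_face p q r s d : qd T p q r s -> d \in [:: (p, q); (q, r); (r, s); (s, p)] ->
  face T d = [set e in [:: (p, q); (q, r); (r, s); (s, p)]].
Proof. by move=> /and4P[_ cy _ _]; apply: face_cycle. Qed.

Lemma face_out d e : d \in darts T -> d \notin X -> e \in face T d -> e \notin X.
Proof.
move=> dD dX; rewrite inE => /iter_findex <-; elim: (findex _ _ _) => //= k IH.
by rewrite cX //; elim: k {IH} => //= k; rewrite phi_dart.
Qed.

Lemma tri_out x y z d : tri T x y z -> d \in [:: (x, y); (y, z); (z, x)] -> d \notin X ->
  {in [:: (x, y); (y, z); (z, x)], forall e, e \notin X}.
Proof.
move=> t dt dX e et; have F := tri_face t dt; have [[a1 a2 a3] _ _] := triE ppT t.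
apply: (face_out _ dX); last by rewrite F inE.
by move: dt; rewrite !in_cons => /or4P[/eqP->|/eqP->|/eqP->|].
Qed.

Lemma qd_out p q r s d : qd T p q r s -> d \in [:: (p, q); (q, r); (r, s); (s, p)] -> d \notin X ->
  {in [:: (p, q); (q, r); (r, s); (s, p)], forall e, e \notin X}.
Proof.
move=> t dt dX e et; have F := qd_face t dt; have [[a1 a2 a3 a4] _ _] := qdE ppT t.
apply: (face_out _ dX); last by rewrite F inE.
by move: dt; rewrite !in_cons => /or4P[/eqP->|/eqP->|/eqP->|/orP[/eqP->|]].
Qed.

Lemma pent_cover i p q1 q2 q3 q4 : pent T i p q1 q2 q3 q4 ->
  let e := diag i p q1 q2 q3 q4 in
  e \in darts T /\ face T e :|: face T (rv e) = [set d in [:: e, rv e & walk5 p q1 q2 q3 q4]].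
Proof.
case: i => [|[|[|[|[|i]]]]] //= /andP[t q]; rewrite /rv /=.
- split; first by have [[]] := qdE ppT q.
  rewrite (tri_face t (d := (q2, p))) ?(qd_face q (d := (p, q2))) ?in_cons ?eqxx ?orbT //; apply/setP=> d.
  by rewrite in_setU !in_set !in_cons !in_nil; do 7!case: (d == _).
- split; first by have [[]] := qdE ppT q.
  rewrite (tri_face t (d := (q3, q1))) ?(qd_face q (d := (q1, q3))) ?in_cons ?eqxx ?orbT //; apply/setP=> d.
  by rewrite in_setU !in_set !in_cons !in_nil; do 7!case: (d == _).
- split; first by have [[]] := qdE ppT q.
  rewrite (tri_face t (d := (q4, q2))) ?(qd_face q (d := (q2, q4))) ?in_cons ?eqxx ?orbT //; apply/setP=> d.
  by rewrite in_setU !in_set !in_cons !in_nil; do 7!case: (d == _).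
- split; first by have [[]] := qdE ppT q.
  rewrite (tri_face t (d := (p, q3))) ?(qd_face q (d := (q3, p))) ?in_cons ?eqxx ?orbT //; apply/setP=> d.
  by rewrite in_setU !in_set !in_cons !in_nil; do 7!case: (d == _).
Qed.

(** While [same] protects a chosen set of darts over many flips, [keep] and [exch] record the effect
    of a single flip on all other faces and on the edge set. *)
Definition keep T' (e : dart) : Prop :=
  forall d, d \in darts T -> d \notin face T e -> d \notin face T (rv e) ->
     [/\ d \in darts T', phi T' d = phi T d, (d \in reflex T') = (d \in reflex T)
       & face T' d = face T d].

Definition exch T' (e e' : dart) : Prop :=
  (forall d, (d \in darts T') =
     ((d \in darts T) && (d != e) && (d != rv e)) || (d == e') || (d == rv e')) /\
  keep T' e.

Lemma cover_move T' e e' c : is4PPT T' -> flip T T' -> frame T T' e e' c -> e \in darts T ->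
  e \notin X -> rv e \notin X -> face T e :|: face T (rv e) = [set d in [:: e, rv e & c]] ->
  moves X 1 T T' /\ exch T' e e'.
Proof.
move=> ppT' f fr eD N1 N2 E; split.
  apply: (move_frame ppT' f fr) => // d; have := in_setU d (face T e) (face T (rv e)).
  rewrite E in_set => -> /orP[]; first exact: face_out.
  by apply: face_out; rewrite ?rv_dart.
have [_ h1 h2] := fr; split=> // d dD M1 M2; apply: h2 => //.
have := in_setU d (face T e) (face T (rv e)).
by rewrite E in_set => ->; rewrite negb_or M1.
Qed.

Lemma pent_move i j p q1 q2 q3 q4 : pent T i p q1 q2 q3 q4 -> 0 < j <= 4 -> i != j ->
  diag i p q1 q2 q3 q4 \notin X -> rv (diag i p q1 q2 q3 q4) \notin X ->
  diag j p q1 q2 q3 q4 \notin darts T ->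
  exists T', [/\ moves X 1 T T', pent T' j p q1 q2 q3 q4 &
    exch T' (diag i p q1 q2 q3 q4) (diag j p q1 q2 q3 q4)].
Proof.
move=> H ji ij N1 N2 N.
have [T' [f ppT' H' fr]] := pent_flip ppT H ji ij N (pent_neq ppT H ji ij).
have [eD E] := pent_cover H.
by have [m h] := cover_move ppT' f fr eD N1 N2 E; exists T'.
Qed.

Lemma square_move w0 w1 w2 w3 : tri T w0 w1 w2 -> tri T w0 w2 w3 -> w1 != w3 ->
  (w0, w2) \notin X -> (w2, w0) \notin X ->
  exists T', [/\ moves X 1 T T', tri T' w1 w2 w3, tri T' w1 w3 w0 & exch T' (w0, w2) (w1, w3)].
Proof.
move=> t1 t2 nw N1 N2.
have [T' [f ppT' /andP[h1 h2] fr]] := square_flip ppT t1 t2 (square_unb ppT t1 t2) nw.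
have eD : (w0, w2) \in darts T by have [[]] := triE ppT t2.
have [|m h] := cover_move ppT' f fr eD N1 N2; last by exists T'.
rewrite /rv /= (tri_face t1 (d := (w2, w0))) ?(tri_face t2 (d := (w0, w2))) ?in_cons ?eqxx ?orbT //; apply/setP=> d.
by rewrite in_setU !in_set !in_cons !in_nil; do 6!case: (d == _).
Qed.

Lemma pent_1 p q1 q2 q3 q4 i : pent T i p q1 q2 q3 q4 -> i != 1 -> diag i p q1 q2 q3 q4 \notin X ->
  rv (diag i p q1 q2 q3 q4) \notin X ->
  exists T', [/\ moves X 1 T T', pent T' 1 p q1 q2 q3 q4 & exch T' (diag i p q1 q2 q3 q4) (p, q2)].
Proof. by move=> H i1 N1 N2; apply: (pent_move H (j := 1)) => //=; apply: pent_unb1 H i1. Qed.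

Lemma pent_4 p q1 q2 q3 q4 i : pent T i p q1 q2 q3 q4 -> i != 4 -> diag i p q1 q2 q3 q4 \notin X ->
  rv (diag i p q1 q2 q3 q4) \notin X ->
  exists T', [/\ moves X 1 T T', pent T' 4 p q1 q2 q3 q4 & exch T' (diag i p q1 q2 q3 q4) (q3, p)].
Proof. by move=> H i1 N1 N2; apply: (pent_move H (j := 4)) => //=; apply: pent_unb4 H i1. Qed.

End Fixed.
End Moves.

(** * Moving a face along a dual path *)

Section Chain.
Variable n : nat.
Notation dart := ('I_n * 'I_n)%type.
Implicit Types (d e : dart) (X : {set dart}).

(** The Boolean chooses the travelling kind of face, so that a triangle among quadrilaterals and a
    quadrilateral among triangles are moved by one proof. *)
Definition on_face (b : bool) (T : cemb n) d : Prop :=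
  if b then exists x, tri T d.1 d.2 x
  else exists p q r s, qd T p q r s /\ d \in [:: (p, q); (q, r); (r, s); (s, p)].

Section Fixed.
Variables (T : cemb n) (X : {set dart}).
Hypothesis ppT : is4PPT T.
Let sT := is4PPT_simple ppT.
Let rT := is4PPT_rot ppT.
Hypotheses (sX : X \subset darts T) (cX : phi_closed T X).

Lemma adj_pent x y z p q r s : tri T x y z -> qd T p q r s ->
  (y, x) \in [:: (p, q); (q, r); (r, s); (s, p)] ->
  exists i q1 q2 q3 q4, pent T i p q1 q2 q3 q4 /\ diag i p q1 q2 q3 q4 = (y, x).
Proof.
move=> t Q; rewrite !in_cons in_nil orbF => /or4P[]/eqP[E1 E2]; subst y x.
- by exists 1, z, q, r, s; rewrite /= Q (tri_rot ppT t).
- by exists 2, q, z, r, s; rewrite /= Q (tri_rot ppT t).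
- by exists 3, q, r, z, s; rewrite /= Q (tri_rot ppT t).
- by exists 4, q, r, s, z; rewrite /= Q (tri_rot ppT t).
Qed.

(** The triangle crosses the quadrilateral to its side [e]. Every side but [q2 q3] is reached by a
    cut ending at [p], which is never blocked; for [q2 q3] one of the cuts [q1 q3] and [q2 q4] is
    free unless [q1 = q4]. *)
Lemma tri_step i p q1 q2 q3 q4 e : pent T i p q1 q2 q3 q4 -> let d := diag i p q1 q2 q3 q4 in
  d \notin X -> rv d \notin X -> e \in face T d -> e != d ->
  exists T', [/\ moves X 1 T T', keep T T' d & on_face true T' e].
Proof.
move=> H d N1 N2 eF ne.
have {eF} : [\/ e \in [:: (p, q1); (q1, q2)] /\ i != 1, e \in [:: (q3, q4); (q4, p)] /\ i != 4 |
             e = (q2, q3) /\ ((i == 1) || (i == 4))].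
  move: eF ne; rewrite /d; clear d N1 N2.
  case: i H => [|[|[|[|[|i]]]]] //= /andP[t Q]; rewrite (qd_face Q) ?in_cons ?eqxx ?orbT // in_set !in_cons in_nil.
  - case/or4P=> [->|/eqP->|->|/orP[->|//]] // _; [constructor 3|constructor 2|constructor 2] => //.
    by rewrite orbT.
  - case/or4P=> [->|->|->|/orP[->|//]] // _; [constructor 1|constructor 2|constructor 2] => //.
    by rewrite orbT.
  - case/or4P=> [->|->|->|/orP[->|//]] // _; [constructor 1|constructor 1|constructor 2] => //; by rewrite ?orbT.
  - case/or4P=> [->|->|/eqP->|/orP[->|//]] // _; [constructor 1|constructor 1|constructor 3] => //; by rewrite ?orbT.
case=> [[ew i1]|[ew i4]|[-> i14]].
- have [T' [m /= /andP[t _] [_ k]]] := pent_1 ppT sX cX H i1 N1 N2.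
  exists T'; split=> //; have ppT' := moves_pp m.
  move: ew; rewrite !in_cons in_nil orbF => /orP[]/eqP-> /=; first by exists q2.
  by exists p; apply: tri_rot.
- have [T' [m /= /andP[t _] [_ k]]] := pent_4 ppT sX cX H i4 N1 N2.
  exists T'; split=> //; have ppT' := moves_pp m.
  move: ew; rewrite !in_cons in_nil orbF => /orP[]/eqP-> /=; first by exists p.
  by exists q3; apply: tri_rot.
have [D1|D1] := boolP ((q1, q3) \in darts T); last first.
  have [|T' [m /= /andP[t _] [_ k]]] := pent_move ppT sX cX H (j := 2) isT _ N1 N2 D1.
    by case/orP: i14 => /eqP->.
  by exists T'; split=> //; exists q1; apply: (tri_rot (moves_pp m) t).
have [D2|D2] := boolP ((q2, q4) \in darts T); last first.
  have [|T' [m /= /andP[t _] [_ k]]] := pent_move ppT sX cX H (j := 3) isT _ N1 N2 D2.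
    by case/orP: i14 => /eqP->.
  by exists T'; split=> //; exists q4.
have E : q1 = q4 by apply/eqP; apply: contraT => E; case: (pent_unb23 ppT H i14 E D1 D2).
(* p has degree two, so it can be hung from the other side of the quadrilateral *)
subst q4; case/orP: i14 => /eqP Ei; subst i; move: H => /= /andP[t Q].
- have H' : pent T 4 p q2 q3 q1 q2 by rewrite /= Q (tri_rot ppT t).
  have E1 : face T (q1, p) = face T d by rewrite (qd_face Q (d := d)) ?(qd_face Q (d := (q1, p))) ?in_cons ?eqxx ?orbT.
  have E2 : face T (rv (q1, p)) = face T (rv d).
    by rewrite (tri_face t (d := rv d)) ?(tri_face t (d := (p, q1))) ?in_cons ?eqxx ?orbT.
  have [||T' [m /= /andP[t' _] [_ k]]] := pent_1 ppT sX cX H' isT.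
  + apply: (face_out ppT cX _ N1); last by rewrite -E1 mem_face.
    by have [[]] := qdE ppT Q.
  + apply: (face_out ppT cX _ N2); last by rewrite -E2 mem_face.
    by have [[]] := triE ppT t.
  exists T'; split=> //; first by move=> f fD f1 f2; apply: k; rewrite ?E1 ?E2.
  by exists p; apply: (tri_rot (moves_pp m)).
- have H' : pent T 1 p q3 q1 q2 q3 by rewrite /= Q (tri_rot ppT (tri_rot ppT t)).
  have E1 : face T (p, q1) = face T d by rewrite (qd_face Q (d := d)) ?(qd_face Q (d := (p, q1))) ?in_cons ?eqxx ?orbT.
  have E2 : face T (rv (p, q1)) = face T (rv d).
    by rewrite (tri_face t (d := rv d)) ?(tri_face t (d := (q1, p))) ?in_cons ?eqxx ?orbT.
  have [||T' [m /= /andP[t' _] [_ k]]] := pent_4 ppT sX cX H' isT.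
  + apply: (face_out ppT cX _ N1); last by rewrite -E1 mem_face.
    by have [[]] := qdE ppT Q.
  + apply: (face_out ppT cX _ N2); last by rewrite -E2 mem_face.
    by have [[]] := triE ppT t.
  exists T'; split=> //; first by move=> f fD f1 f2; apply: k; rewrite ?E1 ?E2.
  by exists p.
Qed.

(** Each remaining side of the triangle becomes a side of the quadrilateral under cut 1 or cut 4,
    and these two are never blocked. *)
Lemma qd_step i p q1 q2 q3 q4 e : pent T i p q1 q2 q3 q4 -> let d := diag i p q1 q2 q3 q4 in
  d \notin X -> rv d \notin X -> e \in face T (rv d) -> e != rv d ->
  exists T', [/\ moves X 1 T T', keep T T' d & on_face false T' e].
Proof.
move=> H d N1 N2 eF ne.
have {eF} : e \in [:: (q2, q3); (q3, q4); (q4, p)] /\ i != 1 \/ e \in [:: (p, q1); (q1, q2); (q2, q3)] /\ i != 4.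
  move: eF ne; rewrite /d; clear d N1 N2.
  case: i H => [|[|[|[|[|i]]]]] //= /andP[t Q]; rewrite /rv /= (tri_face t) ?in_cons ?eqxx ?orbT // in_set !in_cons in_nil.
  - by case/or4P=> [->|->|->|//] // _; right; rewrite ?orbT.
  - by case/or4P=> [->|->|->|//] // _; right; rewrite ?orbT.
  - by case/or4P=> [->|->|->|//] // _; left; rewrite ?orbT.
  - by case/or4P=> [->|->|->|//] // _; left; rewrite ?orbT.
case=> -[ew i1].
- have [T' [m /= /andP[_ Q] [_ k]]] := pent_1 ppT sX cX H i1 N1 N2.
  exists T'; split=> //; exists p, q2, q3, q4; split=> //.
  by move: ew; rewrite !in_cons in_nil => /or4P[->|->|->|]; rewrite ?orbT.
- have [T' [m /= /andP[_ Q] [_ k]]] := pent_4 ppT sX cX H i1 N1 N2.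
  exists T'; split=> //; exists p, q1, q2, q3; split=> //.
  by move: ew; rewrite !in_cons in_nil => /or4P[->|->|->|]; rewrite ?orbT.
Qed.

Lemma face_step b d e : on_face b T d -> on_face (~~ b) T (rv d) -> d \notin X -> rv d \notin X ->
  e \in face T (rv d) -> e != rv d ->
  exists T', [/\ moves X 1 T T', keep T T' d & on_face b T' e].
Proof.
case: b => /=; case: d => x y /=.
- case=> z t [p [q [r [s [Q dQ]]]]] N1 N2 eF ne.
  have [i [q1 [q2 [q3 [q4 [H E]]]]]] := adj_pent t Q dQ.
  have := tri_step (e := e) H; rewrite E => /(_ N2 N1 eF ne)[T' [m k o]].
  by exists T'; split=> // f fD f1 f2; apply: k.
- case=> p [q [r [s [Q dQ]]]] [z t] N1 N2 eF ne.
  have [i [q1 [q2 [q3 [q4 [H E]]]]]] := adj_pent t Q dQ.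
  by have := qd_step (e := e) H; rewrite E => /(_ N1 N2 eF ne)[T' [m k o]]; exists T'.
Qed.

Lemma on_face_out b d : on_face b T d -> d \in darts T /\ face T d != outer T.
Proof.
case: b => /=.
  case: d => x y [z t]; have [[D _ _] _ [r _ _]] := triE ppT t; split=> //.
  by case: (interior_reflex ppT D r).
case=> p [q [r [s [Q dQ]]]]; have [[D1 D2 D3 D4] _ [r1 _ _ _]] := qdE ppT Q.
have -> : d \in darts T by move: dQ; rewrite !in_cons => /or4P[/eqP->|/eqP->|/eqP->|/orP[/eqP->|]].
have [_] := interior_reflex ppT D1 r1; rewrite (qd_face Q dQ) (qd_face Q (mem_head _ _)).
by [].
Qed.

Lemma on_face_face b d d' : on_face b T d -> d' \in face T d -> on_face b T d'.
Proof.
case: b => /=.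
  case: d => x y [z t]; rewrite (tri_face t) ?mem_head // in_set !in_cons in_nil orbF /=.
  by case/or3P=> /eqP->; [exists z | exists x; apply: tri_rot | exists y; do 2!apply: (tri_rot ppT)].
case=> p [q [r [s [Q dQ]]]]; rewrite (qd_face Q dQ) in_set => H.
by exists p, q, r, s.
Qed.

Lemma on_face_case b d : d \in darts T -> face T d != outer T -> on_face b T d \/ on_face (~~ b) T d.
Proof. by case: b => dD dO; have [] := tri_or_qd ppT dD dO => H; [left|right|right|left]. Qed.

End Fixed.

Definition adjf (f g : {set dart}) := [exists d, (d \in f) && (rv d \in g)].

(** A flip across a dual edge alters only the two faces that meet there, and the path visits each
    face once, so the rest of the path survives. Having [rv e] in [X] keeps the target from being
    the edge crossed last. *)
Lemma chain b X e s : forall T d0, is4PPT T -> X \subset darts T -> phi_closed T X -> outer T \subset X ->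
  d0 \notin X -> on_face b T d0 -> {in s, forall f, f \in faces T /\ [disjoint f & X]} ->
  path adjf (face T d0) s -> uniq (face T d0 :: s) -> e \in last (face T d0) s -> rv e \in X ->
  exists T', moves X (size s) T T' /\ on_face b T' e.
Proof.
elim: s => [|g s IH] T d0 ppT sX cX oX d0X o0 hs /=.
  by move=> _ _ eF _; exists T; split; [apply: moves0 | apply: on_face_face o0 eF].
case/andP=> /existsP[d /andP[df dg]] pg /and3P[nf ng us] el eX.
have sT := is4PPT_simple ppT; have rT := is4PPT_rot ppT.
have [d0D _] := on_face_out ppT o0.
have [gF gX] := hs g (mem_head _ _).
have [gE rdD] := face_in sT rT gF dg.
have rdX : rv d \notin X by rewrite (disjointFr gX dg).
have dX : d \notin X by apply: (face_out ppT cX d0D d0X).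
have od := on_face_face ppT o0 df.
have hs' : {in s, forall f, f \in faces T /\ [disjoint f & X]} by move=> f fs; apply: hs; rewrite in_cons fs orbT.
have rdO : face T (rv d) != outer T.
  by apply: contraNneq rdX => E; apply: (subsetP oX); rewrite -E mem_face.
rewrite gE in pg nf ng us el.
(* If the next face is already of the travelling kind, it takes over at no cost. *)
case: (on_face_case ppT b rdD rdO) => ob.
  have [|T' [m o]] := IH T (rv d) ppT sX cX oX rdX ob hs' pg _ el eX; first by rewrite /= ng.
  by exists T'; split=> //; apply: moves_leq m.
have fd : face T d = face T d0 by apply: face_eq sT rT _ _ df.
case: s => [|h s] in IH hs hs' pg nf ng us el *.
  have [|T' [m k o]] := face_step ppT sX cX od ob dX rdX el; last by exists T'.
  by apply: contraNneq dX => E; rewrite -(rvK d) -E.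
move: pg => /= /andP[/existsP[d1 /andP[d1g d1h]] ph].
have [hF hX] := hs' h (mem_head _ _).
have [hE rd1D] := face_in sT rT hF d1h.
have d1n : d1 != rv d.
  move: nf; apply: contraNneq => E; rewrite !in_cons; apply/orP; right; apply/orP; left.
  by rewrite hE E rvK fd.
have [T' [m k o]] := face_step ppT sX cX od ob dX rdX d1g d1n.
have ppT' := moves_pp m; have S := moves_same m.
have sX' := same_sub sX S; have cX' := same_phi_closed ppT ppT' sX cX S.
have oX' : outer T' \subset X by case: S => ->.
have d1X : d1 \notin X by apply: (face_out ppT cX rdD rdX).
have hf f x : f \in h :: s -> x \in f -> [/\ x \in darts T, x \notin face T d & x \notin face T (rv d)].
  move=> fs xf; have [fF _] := hs' f fs; have [fE xD] := face_in sT rT fF xf; split=> //.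
    move: nf; rewrite in_cons negb_or => /andP[_]; apply: contra => H.
    by rewrite -fd -(face_eq sT rT H) -fE.
  by apply: contra ng => H; rewrite -(face_eq sT rT H) -fE.
have [|||T'' [m' o']] := IH T' d1 ppT' sX' cX' oX' d1X o _ _ _ el eX.
- move=> f fs; have [fF fX] := hs' f fs; split=> //.
  case/facesP: fF => x xD E; rewrite E in fs fX *.
  have [_ x1 x2] := hf _ x fs (mem_face _ _).
  by have [xD' _ _ <-] := k x xD x1 x2; apply: face_faces.
- by rewrite /= ph andbT; apply/existsP; exists d1; rewrite mem_face.
- rewrite cons_uniq us andbT; apply/negP=> H.
  by have [_ _ /negP] := hf _ d1 H (mem_face _ _); case.
by exists T''; split=> //; apply: moves_trans m m'.
Qed.

End Chain.

(** * Counting faces, and bringing a face to the boundary of the fixed part *)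

Section Reach.
Variable n : nat.
Notation dart := ('I_n * 'I_n)%type.
Implicit Types (d e : dart) (X : {set dart}) (T : cemb n).

Definition bdry X : {set dart} := [set d | (d \in X) || (rv d \in X)].

(* The part of the surface outside X is connected. *)
Definition conn T X : Prop := forall K : {set dart}, K \subset darts T :\: X -> phi_closed T K ->
  rv_closed T (bdry X) K -> forall d0 d, d0 \in K -> d \in darts T -> d \notin X -> d \in K.

Section Count.
Variable T : cemb n.
Hypothesis ppT : is4PPT T.
Let sT := is4PPT_simple ppT.
Let rT := is4PPT_rot ppT.

Lemma card_reflex : #|reflex T| = n.
Proof.
rewrite -sum1_card (partition_big snd xpredT) //= -[RHS]card_ord -sum1_card.
apply: eq_bigr => v _; rewrite sum1_card -[RHS](ppT.1.2 v).
by apply: eq_card => d; rewrite !inE.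
Qed.

Lemma face_sub_darts : face_sub T (darts T) = faces T.
Proof.
apply/setP=> f; rewrite inE andb_idr // => /facesP[d dD ->].
by apply/subsetP=> e /(face_dart sT rT) ->.
Qed.

Lemma phi_closed_darts : phi_closed T (darts T).
Proof. by move=> d _; rewrite phi_dart. Qed.

Lemma faces_sum (A : {set dart}) : #|darts T :&: A| = #|outer T :&: A| + \sum_(f in faces T :\ outer T) #|f :&: A|.
Proof.
rewrite (face_sum ppT A (subxx _) phi_closed_darts) // face_sub_darts.
by rewrite (big_setD1 (outer T)) //=; apply: outer_face.
Qed.

Lemma card_darts : #|darts T| = 3 * (#|faces T|).-1 + n.
Proof.
have := faces_sum (~: reflex T).
have -> : outer T :&: ~: reflex T = set0.
  by apply/setP=> d; rewrite !inE; apply/negbTE/negP => /andP[/(outer_reflex ppT)->].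
rewrite cards0 add0n (eq_bigr (fun _ => 3)); last first.
  move=> f; rewrite in_setD1 => /andP[fo fF].
  by have [] := face_bounds ppT (conj fF fo).
rewrite sum_nat_const; have := cardsD1 (outer T) (faces T); rewrite (outer_face ppT) => -> /= E.
have sR : darts T :&: reflex T = reflex T.
  by apply/setIidPr/subsetP=> d; apply: reflex_dart.
have := cardsID (reflex T) (darts T); rewrite sR card_reflex setDE E.
by rewrite add0n => <-; rewrite addnC mulnC.
Qed.

(** Three convex angles per interior face and [n] reflex angles make [3(F - 1) + n] darts, which
    bounds [F] through Euler's formula. This in turn bounds the length of a dual path. *)
Lemma faces_leq : #|faces T| <= n.
Proof.
have [[[[_ _ _ pl _] _ _ _] _] _] := ppT; rewrite /planar_embedding in pl.
have := card_darts; have : 0 < #|faces T| by apply/card_gt0P; exists (outer T); apply: outer_face.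
move: pl; move: #|faces T| #|darts T| => F D; clear; lia.
Qed.

(** Without triangles each of the interior faces would own a reflex angle, and together with at
    least three on the outer face there would be more than [n] of them. *)
Lemma ex_tri : 2 < #|outer T| -> exists d, d \in darts T /\ on_face true T d.
Proof.
move=> h3; have [/existsP[d /andP[dD /existsP[x t]]]|N] :=
  boolP [exists d, (d \in darts T) && [exists x, tri T d.1 d.2 x]].
  by exists d; split=> //; exists x.
have rE := faces_sum (reflex T).
have E1 : darts T :&: reflex T = reflex T.
  by apply/setIidPr/subsetP=> d; apply: reflex_dart.
have E2 : outer T :&: reflex T = outer T by apply/setIidPl/subsetP=> d; apply: outer_reflex.
rewrite E1 E2 card_reflex in rE.
have lb : #|faces T :\ outer T| <= \sum_(f in faces T :\ outer T) #|f :&: reflex T|.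
  rewrite -sum1_card; apply: leq_sum => f; rewrite in_setD1 => /andP[fo /facesP[d dD E]].
  rewrite E in fo *; have [[x t]|[p [q [r [s [Q dQ]]]]]] := tri_or_qd ppT dD fo.
    by case/negP: N; apply/existsP; exists d; rewrite dD; apply/existsP; exists x.
  rewrite card_gt0; apply/set0Pn; exists (s, p); rewrite in_setI.
  have [_ _ [_ _ _ ->]] := qdE ppT Q.
  by rewrite (qd_face Q dQ) in_set !in_cons eqxx !orbT.
have [[[[_ _ _ pl _] _ _ _] _] _] := ppT; rewrite /planar_embedding in pl.
have := card_darts; have := cardsD1 (outer T) (faces T); rewrite (outer_face ppT) => cF.
move: rE lb cF pl h3; move: #|faces T| #|faces T :\ _| #|darts T| #|outer T| (\sum_(f in _) _) => a b c d e.
clear; lia.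
Qed.

Lemma ex_quad v X : phi_closed T X -> outer T \subset X -> (forall u, (u, v) \notin X) ->
  exists d, [/\ d \in darts T, d \notin X & on_face false T d].
Proof.
move=> cX oX vX; have [u uR] := reflex_ex ppT v; have uD := reflex_dart ppT uR.
exists (u, v); split=> //; have [|[x t]|//] := tri_or_qd ppT uD.
  by apply: contraNneq (vX u) => E; apply: (subsetP oX); rewrite -E mem_face.
by have [_ _ []] := triE ppT t; rewrite uR.
Qed.

End Count.

Definition adjx T X : rel {set dart} :=
  fun f g => [&& adjf f g, g \in faces T & [disjoint g & X]].

(** The darts of the faces that a dual path off [X] can reach form a closed set, so by [conn] they
    are the whole complement. A path without repeated faces is no longer than the number of
    faces. *)
Lemma reach b T X d0 e : is4PPT T -> X \subset darts T -> phi_closed T X -> outer T \subset X ->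
  conn T X -> d0 \notin X -> on_face b T d0 -> e \in darts T -> e \notin X -> rv e \in X ->
  exists T', moves X n T T' /\ on_face b T' e.
Proof.
move=> ppT sX cX oX cn d0X o0 eD eX reX.
have sT := is4PPT_simple ppT; have rT := is4PPT_rot ppT.
have [d0D _] := on_face_out ppT o0.
have fX d : d \in darts T -> d \notin X -> [disjoint face T d & X].
  move=> dD dX; apply/pred0P=> x /=; apply/negbTE/negP => /andP[xf xX].
  by move: xX; apply/negP; apply: (face_out ppT cX dD dX xf).
pose K := [set d in darts T :\: X | connect (adjx T X) (face T d0) (face T d)].
have cK : phi_closed T K.
  move=> d dD; rewrite !in_set (face_phi sT rT) phi_dart // cX //.
have rK : rv_closed T (bdry X) K.
  suff H d : d \in darts T -> d \notin bdry X -> d \in K -> rv d \in K.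
    move=> d dD dB; apply/idP/idP; last exact: H.
    rewrite -{2}(rvK d); apply: H; rewrite ?rv_dart //.
    by move: dB; rewrite !inE rvK orbC.
  rewrite in_set negb_or => dD /andP[dX rdX]; rewrite in_set => /andP[_ dc].
  rewrite in_set in_setD rdX rv_dart // dD /=.
  apply: connect_trans dc (connect1 _); rewrite /adjx face_faces ?rv_dart // fX ?rv_dart //=.
  by rewrite andbT; apply/existsP; exists d; rewrite !mem_face.
have : e \in K.
  apply: (cn K _ cK rK d0) => //; first by apply/subsetP=> d; rewrite in_set => /andP[].
  by rewrite in_set in_setD d0X d0D connect0.
rewrite in_set => /andP[_ /connectP[s ps se]].
case/shortenP: ps se => s' ps' us' _ se.
have sF : {in s', forall f, f \in faces T /\ [disjoint f & X]}.
  elim: s' {se us'} (face T d0) ps' => //= f s' IH f0 /andP[/and3P[_ h1 h2] ps'] g.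
  by rewrite in_cons => /orP[/eqP->|]; [split | apply: IH ps' g].
have [||T' [m o]] := chain ppT sX cX oX d0X o0 sF _ us' _ reX.
- by apply: sub_path ps' => f g /and3P[].
- by rewrite -se mem_face.
exists T'; split=> //; apply: moves_leq m; apply: leq_trans (faces_leq ppT).
rewrite cardE; apply: uniq_leq_size; first by case/andP: us'.
by move=> f /sF[]; rewrite mem_enum.
Qed.

(** A closed set outside [X] and [F] becomes one for [X] alone: with [F] added if all that lies
    across [F] belongs to it, and as it stands if nothing there does. The disjunction excludes that
    [F] cuts the complement in two. *)
Lemma conn_add T X F : is4PPT T -> X \subset darts T -> phi_closed T X -> conn T X ->
  phi_closed T F -> F \subset darts T :\: X ->
  (forall K : {set dart}, phi_closed T K -> rv_closed T (bdry (X :|: F)) K ->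
     (forall x : dart, x \in F -> x \notin bdry X -> rv x \in K) \/
     (forall x : dart, x \in F -> x \notin bdry X -> rv x \notin K)) ->
  conn T (X :|: F).
Proof.
move=> ppT sX cX cn cF sF HF K sK cK rK d0 d K0 dD; rewrite in_setU negb_or => /andP[dX dF].
have sT := is4PPT_simple ppT.
have KX (x : dart) : x \in K -> [/\ x \in darts T, x \notin X & x \notin F].
  by move=> xK; have := subsetP sK x xK; rewrite in_setD in_setU negb_or => /andP[/andP[]].
have FX (x : dart) : x \in F -> x \in darts T /\ x \notin X.
  by move=> xF; have := subsetP sF x xF; rewrite in_setD => /andP[].
have sy (L : {set dart}) : (forall x : dart, x \in darts T -> x \notin bdry X -> x \in L -> rv x \in L) -> rv_closed T (bdry X) L.
  move=> H x xD xB; apply/idP/idP; last exact: H.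
  by rewrite -{2}(rvK x); apply: H; rewrite ?rv_dart //; move: xB; rewrite !inE rvK orbC.
have KF (x : dart) : x \notin bdry X -> x \in K -> rv x \in K \/ rv x \in F.
  move=> xB xK; have [rF|rF] := boolP (rv x \in F); first by right.
  have [xD x1 x2] := KX x xK; left.
  by rewrite rK ?xK // inE !in_setU !negb_or x1 x2 rF; move: xB; rewrite !inE negb_or => /andP[_ ->].
case: (HF K cK rK) => H.
  have : d \in K :|: F; last by rewrite in_setU (negbTE dF) orbF.
  apply: (cn _ _ _ _ d0) => //; last by rewrite in_setU K0.
  - by apply/subsetP=> x; rewrite in_setU in_setD => /orP[/KX[-> -> _]|/FX[-> ->]].
  - by move=> x xD; rewrite !in_setU cK // cF.
  apply: sy => x xD xB; rewrite !in_setU => /orP[/(KF x xB)[]->|xF]; rewrite ?orbT //.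
  by rewrite H.
apply: (cn K _ cK _ d0) => //; first by apply/subsetP=> x /KX[xD xX _]; rewrite in_setD xX.
apply: sy => x xD xB xK; have [//|rF] := KF x xB xK.
have xB' : rv x \notin bdry X by move: xB; rewrite !inE rvK orbC.
by have := H _ rF xB'; rewrite rvK xK.
Qed.

(* Rotating at v from its only X-angle (u,v) sweeps all the darts at v outside X. *)
Lemma conn_fan T X K u v w : is4PPT T -> phi_closed T X -> phi_closed T K -> rv_closed T (bdry X) K ->
  (forall t, (t, v) \in X -> t = u) -> (u, v) \in darts T ->
  phi T (u, v) = (v, w) -> w != u -> ((w, v) \in K) = ((v, u) \in K).
Proof.
move=> ppT cX; have sT := is4PPT_simple ppT; have rT := is4PPT_rot ppT.
move=> + + uX uD E wu.
suff H L : phi_closed T L -> rv_closed T (bdry X) L -> (w, v) \in L -> (v, u) \in L.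
  move=> cK rK; apply/idP/idP; first exact: H.
  apply: contraTT => wN; suff : (v, u) \in ~: K by rewrite inE.
  apply: H; rewrite ?in_setC // => d dD; first by rewrite !in_setC cK.
  by move=> dB; rewrite !in_setC rK.
move=> cL rL wL; have wD : (w, v) \in darts T by rewrite -(rv_dart sT) -[rv _]/(v, w) -E phi_dart.
suff : if u == u then (v, u) \in L else (u, v) \in L by rewrite eqxx.
apply: (rot_in_ind sT rT (P := fun t => if t == u then (v, u) \in L else (t, v) \in L)) wD uD _.
  move=> t tD; have [->|tu] := eqVneq t u; first by rewrite E (negbTE wu) wL.
  move=> tL; set t' := (phi T (t, v)).2; have pE : phi T (t, v) = (v, t') by [].
  have L' : (v, t') \in L by rewrite -pE cL.
  have [E'|tu'] := eqVneq t' u; first by rewrite -E'.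
  have D' : (v, t') \in darts T by rewrite -pE phi_dart.
  rewrite -[(t', v)]/(rv (v, t')) rL // inE negb_or; apply/andP; split.
    by rewrite -pE cX //; apply: contra tu => /uX/eqP.
  by apply: contra tu' => /uX/eqP.
by rewrite (negbTE wu).
Qed.

End Reach.

(** * Sweeping the faces around a vertex *)

Section Fan.
Variable n : nat.
Notation dart := ('I_n * 'I_n)%type.
Implicit Types (d e : dart) (X : {set dart}) (T : cemb n) (s u v w x y z : 'I_n).

(* X is the part of the surface already in normal form, (b,c) and (c,a) are consecutive
   on it and all the other darts at c are outside X. *)
Record good T X (a b c : 'I_n) : Prop := Good {
  good_pp : is4PPT T;
  good_sub : X \subset darts T;
  good_phi : phi_closed T X;
  good_outer : outer T \subset X;
  good_conn : conn T X;
  good_tri : forall x y z, tri T x y z -> (x, y) \notin X;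
  good_reflex : forall y u v, (y, v) \in X -> (u, v) \in reflex T -> (u, v) \in X;
  good_h : 2 < #|outer T|;
  good_bc : (b, c) \in X;
  good_ca : phi T (b, c) = (c, a);
  good_ab : a != b;
  good_c : forall u, (u, c) \in X -> u = b;
  good_b : exists t, (t, b) \in X;
  good_bd : forall t u u', (t, u) \in X -> (u, t) \notin X -> (t, u') \in X -> (u', t) \notin X -> u = u' }.

(** [good] involves the connectivity of the part that later flips rebuild, so its stability under
    them is carried along with it. *)
Definition sgood T X a b c : Prop := good T X a b c /\
  forall T', is4PPT T' -> same X T T' -> good T' X a b c.

Variables (X : {set dart}) (a b c : 'I_n).

Section Fixed.
Variable T : cemb n.
Hypothesis G : good T X a b c.
Let ppT := good_pp G.
Let sX := good_sub G.
Let cX := good_phi G.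
Let sT := is4PPT_simple ppT.
Let rT := is4PPT_rot ppT.

Lemma good_c_reflex u : (u, c) \in reflex T -> u = b.
Proof. by move=> uR; apply: (good_c G); apply: (good_reflex G (good_bc G) uR). Qed.

Lemma good_a_in : (c, a) \in X.
Proof. by rewrite -(good_ca G) cX ?(good_bc G) // (subsetP sX) ?(good_bc G). Qed.

Lemma good_c_out u : u != b -> (u, c) \notin X.
Proof. by apply: contra => /(good_c G) ->. Qed.

Lemma good_a_out : (a, c) \notin X. Proof. by apply: good_c_out; apply: good_ab G. Qed.

Lemma phi_out d : d \in darts T -> d \notin X -> phi T d \notin X.
Proof. by move=> dD; rewrite cX. Qed.

Lemma tri_neq_b x y : tri T x c y -> x != b.
Proof. by move=> t; apply: contra (good_tri G t) => /eqP->; apply: (good_bc G). Qed.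

(** The reflex angle of [c] is the one in [X], so [c] is not the reflex vertex of a quadrilateral
    beyond [cy]; three positions of that vertex remain. *)
Lemma fan_case s y y' : tri T s c y -> y != b -> phi T (y, c) = (c, y') ->
  [\/ tri T y c y', exists q, pent T 1 y s c y' q, exists p, pent T 2 p y s c y' |
      exists q, pent T 3 y' q y s c].
Proof.
move=> t yb E; have [[t1 t2 t3] _ _] := triE ppT t.
have yD : (y, c) \in darts T by rewrite -(rv_dart sT).
have yX := good_c_out yb.
have [|[x t']|[p [q [r [w [Q]]]]]] := tri_or_qd ppT yD.
- by apply: contraNneq yX => F; apply: (subsetP (good_outer G)); rewrite -F mem_face.
- have [_ [h _ _] _] := triE ppT t'; rewrite /= E in h; case: h => h.
  by constructor 1; rewrite /= in t'; rewrite h.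
have [_ [h1 h2 h3 h4] [_ _ _ r4]] := qdE ppT Q.
rewrite !in_cons in_nil orbF => /or4P[]/eqP[E1 E2].
- constructor 2; exists w; subst p q; rewrite E in h1; case: h1 => h1; subst r.
  by rewrite /= Q (tri_rot ppT (tri_rot ppT t)).
- constructor 3; exists p; subst q r; rewrite E in h2; case: h2 => h2; subst w.
  by rewrite /= Q (tri_rot ppT (tri_rot ppT t)).
- constructor 4; exists q; subst r w; rewrite E in h3; case: h3 => h3; subst p.
  by rewrite /= Q (tri_rot ppT (tri_rot ppT t)).
- by rewrite -E1 -E2 in r4; move: yb; rewrite (good_c_reflex r4) eqxx.
Qed.

Lemma fan_next s y : tri T s c y -> y != b ->
  exists y', [/\ phi T (y, c) = (c, y'), (y', c) \in darts T, s != y' & y != y'].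
Proof.
move=> t yb; have [[t1 t2 t3] [h1 h2 h3] [r1 r2 r3]] := triE ppT t.
have yD : (y, c) \in darts T by rewrite -(rv_dart sT).
have yR : (y, c) \notin reflex T by apply: contra yb => /good_c_reflex/eqP.
exists (phi T (y, c)).2; have E : phi T (y, c) = (c, (phi T (y, c)).2) by [].
split=> //; first by rewrite -(rv_dart sT) /rv -E phi_dart.
  exact: (corner_neq ppT t1 r1 yR h1 E).
by apply: contraNneq yR => E'; apply: (deg1_reflex ppT) => //; rewrite {1}E -E'.
Qed.

(* The edge cy is replaced by sy', so that c loses a neighbour. *)
Lemma eat s y y' : tri T s c y -> y != b -> phi T (y, c) = (c, y') -> (s, y') \notin darts T ->
  exists T', [/\ moves X 1 T T', tri T' s c y', exists2 e, e \in [:: (y, c); (c, y)] & keep T T' e &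
    forall d, (d \in darts T') =
      ((d \in darts T) && (d != (y, c)) && (d != (c, y))) || (d == (s, y')) || (d == (y', s))].
Proof.
move=> t yb E N; have [z [E' yD sy' yy']] := fan_next t yb; move: E'; rewrite E => -[E']; subst z.
have yX := good_c_out yb.
have cyX : (c, y) \notin X by apply: (good_tri G (tri_rot ppT t)).
case: (fan_case t yb E) => [t'|[q H]|[p H]|[q H]].
- have [T' [m t1 _ [f k]]] := square_move ppT sX cX (tri_rot ppT (tri_rot ppT t)) t' sy' yX cyX.
  by exists T'; split=> //; exists (y, c); rewrite ?mem_head.
- have [T' [m /andP[t1 _] [f k]]] := pent_move ppT sX cX H (j := 2) isT isT yX cyX N.
  by exists T'; split=> //; exists (y, c); rewrite ?mem_head.
- have [T' [m /andP[t1 _] [f k]]] := pent_move ppT sX cX H (j := 3) isT isT yX cyX N.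
  by exists T'; split=> //; exists (y, c); rewrite ?mem_head.
- have [T' [m /andP[t1 _] [f k]]] := pent_move ppT sX cX H (j := 4) isT isT yX cyX N.
  by exists T'; split=> //; exists (y, c); rewrite ?mem_head.
Qed.

(** The edge [s y'] closes a 3-cycle with [c] that has [z] inside. Neighbours of [z] are on the
    cycle or inside it, and the only edge from the inside to [c] comes from [y]. *)
Lemma blocked_nbr s y y' z : tri T s c y -> y != b -> phi T (y, c) = (c, y') -> (s, y') \in darts T ->
  phi T (c, y') = (y', z) -> z \notin [:: s; c; y'] ->
  forall u, (u, c) \in darts T -> (z, u) \in darts T -> u \in [:: s; y'; y].
Proof.
move=> t yb E N Ez zN u uc zu.
have [[t1 t2 t3] [h1 h2 h3] [r1 r2 r3]] := triE ppT t.
have yR : (y, c) \notin reflex T by apply: contra yb => /good_c_reflex/eqP.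
have co : corner T s c y' y by split=> //; right.
have N' : (y', s) \in darts T by rewrite -(rv_dart sT).
have [S [[SD cS rS] [_ S12 _] _ _ out]] := blocked_corner ppT co N'.
have zV : z \notin vset3 s c y' by move: zN; rewrite !inE.
have z1 : (y', z) \in S by rewrite -Ez cS // (subsetP SD).
have va v : v \in vert_in (vset3 s c y') S -> forall t, (t, v) \in darts T -> (t, v) \in S.
  by move=> vV w; apply: (vert_all sT rT (@cyc3_vset n s c y') SD cS rS vV).
have zI : z \in vert_in (vset3 s c y') S by rewrite inE zV; apply/existsP; exists y'.
have uz : (u, z) \in S by apply: va => //; rewrite -(rv_dart sT).
have [uV|uV] := boolP (u \in vset3 s c y').
  move: uV; rewrite !inE => /or3P[->|/eqP E'|->]; rewrite ?orbT //.
  by move: uc; rewrite E'; move/(dart_neq sT); rewrite eqxx.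
have zu' : (z, u) \in S by rewrite -[(z, u)]/(rv (u, z)) rS ?(subsetP SD) // cyc3_out //= zV orbT.
have uI : u \in vert_in (vset3 s c y') S by rewrite inE uV; apply/existsP; exists z.
have cu : (c, u) \in S by apply: va => //; rewrite -(rv_dart sT).
have : (u, c) \in S by rewrite -[(u, c)]/(rv (c, u)) rS ?(subsetP SD) // cyc3_out //= uV orbT.
by case/out => ->; rewrite !inE eqxx ?orbT.
Qed.

End Fixed.

End Fan.

Section FanLoop.
Variable n : nat.
Notation dart := ('I_n * 'I_n)%type.
Implicit Types (d e : dart) (T : cemb n) (s u v w x y z : 'I_n).
Variables (X : {set dart}) (a b c : 'I_n).

Lemma keep_qd T T' e p q r s : is4PPT T -> keep T T' e -> qd T p q r s ->
  (p, q) \notin face T e -> (p, q) \notin face T (rv e) -> qd T' p q r s.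
Proof.
move=> ppT k Q N1 N2; have [[d1 d2 d3 d4] [h1 h2 h3 h4] [r1 r2 r3 r4]] := qdE ppT Q.
have sT := is4PPT_simple ppT; have rT := is4PPT_rot ppT.
have M f : (p, q) \notin face T f -> forall d, d \in [:: (p, q); (q, r); (r, s); (s, p)] -> d \notin face T f.
  move=> N d dQ; apply: contra N => df; rewrite -(face_eq sT rT df) (qd_face Q dQ).
  by rewrite in_set mem_head.
have [e1 e2 e3 _] := k _ d1 N1 N2.
have [||_ e5 e6 _] := k (q, r) d2; rewrite ?(M _ N1) ?(M _ N2) ?in_cons ?eqxx ?orbT //.
have [||_ e7 e8 _] := k (r, s) d3; rewrite ?(M _ N1) ?(M _ N2) ?in_cons ?eqxx ?orbT //.
have [||_ e9 e10 _] := k (s, p) d4; rewrite ?(M _ N1) ?(M _ N2) ?in_cons ?eqxx ?orbT //.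
by rewrite /qd e1 /= e2 e5 e7 e9 h1 h2 h3 h4 !eqxx e3 e6 e8 e10 r1 r2 r3 r4.
Qed.

Lemma sgood_moves T T' k : sgood T X a b c -> moves X k T T' -> sgood T' X a b c.
Proof.
case=> G H [j _ [_ ppT' S]]; split; first exact: H.
by move=> T'' ppT'' S'; apply: H => //; apply: same_trans S S'.
Qed.

Definition nbr T := [set u | (u, c) \in darts T].

Lemma nbr_eat T T' s y y' : s != c -> y' != c -> (y, c) \in darts T ->
  (forall d, (d \in darts T') =
      ((d \in darts T) && (d != (y, c)) && (d != (c, y))) || (d == (s, y')) || (d == (y', s))) ->
  #|nbr T'| < #|nbr T|.
Proof.
move=> sc y'c yD H; have yn : y \in nbr T by rewrite inE.
rewrite (cardsD1 y (nbr T)) yn ltnS; apply: subset_leq_card; apply/subsetP=> u.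
rewrite in_set H !xpair_eqE [c == y']eq_sym (negbTE y'c) [c == s]eq_sym (negbTE sc) !andbF !orbF eqxx andbT.
by rewrite !inE; case/andP=> /andP[-> ->].
Qed.

(* The last two faces around c, a quadrilateral followed by a triangle. *)
Lemma final_right T z : good T X a b c -> tri T z c b -> on_face false T (a, c) -> phi T (a, c) = (c, z) ->
  exists T', moves X 1 T T' /\ exists w, qd T' w a c b.
Proof.
move=> G t [p [q [r [s [Q dQ]]]]] E; have ppT := good_pp G.
have [sX cX] := (good_sub G, good_phi G).
have [[d1 d2 d3 d4] [h1 h2 h3 h4] [r1 r2 r3 r4]] := qdE ppT Q.
have aX := good_a_out G; have zX : (z, c) \notin X := good_tri G t.
have aD : (a, c) \in darts T by move: dQ; rewrite !in_cons in_nil orbF => /or4P[]/eqP->.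
have czX : (c, z) \notin X by rewrite -E; apply: (phi_out G).
move: dQ; rewrite !in_cons in_nil orbF => /or4P[]/eqP[E1 E2].
- have : (s, a) \in X by apply: (good_reflex G (good_a_in G)); rewrite E1.
  by rewrite {1}E1 => H; case/negP: aX; rewrite E1 E2 -h4 cX.
- subst q r; rewrite E in h2; case: h2 => h2; subst s.
  have H : pent T 3 p a c b z by rewrite /= Q (tri_rot ppT t).
  by have [T' [m /andP[_ Q'] _]] := pent_4 ppT sX cX H isT czX zX; exists T'; split=> //; exists p.
- subst r s; rewrite E in h3; case: h3 => h3; subst p.
  have H : pent T 4 z q a c b by rewrite /= Q (tri_rot ppT t).
  by have [T' [m /andP[_ Q'] _]] := pent_1 ppT sX cX H isT czX zX; exists T'; split=> //; exists z.
- rewrite -E1 -E2 in r4; have := good_c_reflex G r4.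
  by move/eqP; rewrite (negbTE (good_ab G)).
Qed.

(* z is enclosed by a 3-cycle through a and c, hence adjacent to none of the neighbours of c
   that the sweep still has to reach: no flip is blocked. *)
Lemma mode_z m : forall T z y, sgood T X a b c -> #|nbr T| <= m -> tri T z c y ->
  on_face false T (a, c) -> phi T (a, c) = (c, z) ->
  (forall u, (u, c) \in darts T -> (z, u) \in darts T -> u \in [:: a; y]) ->
  exists T', moves X m.+1 T T' /\ exists w, qd T' w a c b.
Proof.
elim: m => [|m IH] T z y sG; have [G _] := sG => nb t oF E inv.
  have ppT := good_pp G; have [[D1 _ _] _ _] := triE ppT t.
  by move: nb; rewrite leqn0 cards_eq0 => /eqP/setP/(_ z); rewrite !inE D1.
have ppT := good_pp G; have [sX cX] := (good_sub G, good_phi G).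
have sT := is4PPT_simple ppT; have rT := is4PPT_rot ppT.
have [yb|yb] := eqVneq y b.
  rewrite yb in t; have [T' [M H]] := final_right G t oF E.
  by exists T'; split=> //; apply: moves_leq M.
have [[t1 t2 t3] [h1 h2 h3] [r1 r2 r3]] := triE ppT t.
have /= := tri_uniq ppT t; rewrite !inE !negb_or => /and3P[/andP[zc zy] cy _].
have [y' [Ey yD zy' yy']] := fan_next G t yb.
have ycD : (y, c) \in darts T by rewrite -(rv_dart sT).
have y'c := dart_neq sT yD.
have y'a : y' != a.
  by apply: contraNneq yb => E'; have /(phi_inj sT rT)[->] : phi T (y, c) = phi T (b, c) by rewrite Ey E' (good_ca G).
have ya : y != a.
  apply: contra (tri_neq_b G t) => /eqP E'.
  by have /(phi_inj sT rT)[->] : phi T (z, c) = phi T (b, c) by rewrite h1 E' (good_ca G).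
(* [y'] is a neighbour of [c] other than [a] and [y], so the invariant excludes an edge to [z]. *)
have zN : (z, y') \notin darts T.
  by apply/negP=> /(inv _ yD); rewrite !in_cons in_nil orbF (negbTE y'a) eq_sym (negbTE yy').
have [T' [M t' [e eE k] dT]] := eat G t yb Ey zN.
have lt := nbr_eat zc y'c ycD dT.
have [p [q [r [s [Q dQ]]]]] := oF.
have az : a != z.
  by apply: contraNneq zy => E'; move: E; rewrite E' h1 => -[->].
have aD : (a, c) \in darts T by have [] := on_face_out ppT oF.
have ca : (c == a) = false by apply/negbTE; rewrite eq_sym (dart_neq sT aD).
(* The quadrilateral at [ac] is on neither side of [cy], so it survives the flip. *)
have F1 : (a, c) \notin face T (y, c).
  apply/negP=> H; have := face_eq sT rT H; rewrite (qd_face Q dQ) => /setP/(_ (y, c)).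
  rewrite mem_face in_set; move: dQ; have [m1 m2 m3 [m4 m5 m6]] := qd_neq ppT Q.
  rewrite !in_cons in_nil !orbF !xpair_eqE.
  case/or4P=> /andP[/eqP E1 /eqP E2]; rewrite -!E1 -!E2 in m1 m2 m3 m4 m5 m6 *.
  + by rewrite (negbTE ya) (negbTE m4) (negbTE m5) ca !andbF.
  + by rewrite (negbTE ya) (negbTE m6) [c == p]eq_sym (negbTE m2) ca !andbF.
  + by rewrite (negbTE ya) [c == q]eq_sym (negbTE m5) [c == p]eq_sym (negbTE m3) ca !andbF.
  + by rewrite (negbTE ya) (negbTE m1) (negbTE m2) ca !andbF.
have F2 : (a, c) \notin face T (c, y).
  rewrite (tri_face t) ?in_cons ?eqxx ?orbT // in_set !in_cons in_nil !xpair_eqE (negbTE az) /=.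
  by rewrite [c == y](negbTE cy) [c == z]eq_sym (negbTE zc) !andbF.
have Fs : (a, c) \notin face T e /\ (a, c) \notin face T (rv e).
  by move: eE; rewrite !in_cons in_nil orbF => /orP[]/eqP->.
have Qs f : (a, c) \notin face T f -> (p, q) \notin face T f.
  apply: contra => H; rewrite -(face_eq sT rT H) (qd_face Q (mem_head _ _)) in_set.
  exact: dQ.
have Q' : qd T' p q r s by apply: (keep_qd ppT k Q); apply: Qs; case: Fs.
have [_ E' _ _] := k _ aD Fs.1 Fs.2.
have [||||T'' [M' H]] := IH T' z y' (sgood_moves sG M) _ t'.
- by rewrite -ltnS; apply: leq_trans lt nb.
- by exists p, q, r, s.
- by rewrite E'.
- move=> u; rewrite !dT !xpair_eqE [c == y']eq_sym (negbTE y'c) [c == z]eq_sym (negbTE zc).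
  rewrite !eqxx (negbTE zy') (negbTE zy) !andbF !orbF !andbT /=.
  case/andP=> /andP[uD uy] _ /orP[/(inv _ uD)|/eqP->].
    by rewrite !in_cons in_nil !orbF (negbTE uy) orbF => ->.
  by rewrite !in_cons eqxx orbT.
by exists T''; split=> //; rewrite -addn1 addnC; apply: moves_trans M M'.
Qed.

End FanLoop.

Section FanEnd.
Variable n : nat.
Notation dart := ('I_n * 'I_n)%type.
Implicit Types (d e : dart) (X Y : {set dart}) (T : cemb n) (s u v w x y z : 'I_n).

Lemma same_subset X Y T T' : X \subset Y -> same Y T T' -> same X T T'.
Proof. by move=> /subsetP XY [o h]; split=> // d /XY; apply: h. Qed.

Lemma moves_subset X Y k T T' : X \subset Y -> moves Y k T T' -> moves X k T T'.
Proof. by move=> XY [j jk [f p S]]; exists j => //; split=> //; apply: same_subset S. Qed.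

Lemma same_tri X T T' x y z : same X T T' -> {subset [:: (x, y); (y, z); (z, x)] <= X} ->
  is4PPT T -> tri T x y z -> tri T' x y z.
Proof.
move=> [_ S] XS ppT t; have [_ [h1 h2 h3] [r1 r2 r3]] := triE ppT t.
have [|e1 e2 e3] := S (x, y); rewrite ?XS ?in_cons ?eqxx //.
have [|_ e4 e5] := S (y, z); rewrite ?XS ?in_cons ?eqxx ?orbT //.
have [|_ e6 e7] := S (z, x); rewrite ?XS ?in_cons ?eqxx ?orbT //.
by rewrite /tri e1 /= e2 e4 e6 h1 h2 h3 !eqxx e3 e5 e7 r1 r2 r3.
Qed.

Lemma same_qd X T T' p q r s : same X T T' -> {subset [:: (p, q); (q, r); (r, s); (s, p)] <= X} ->
  is4PPT T -> qd T p q r s -> qd T' p q r s.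
Proof.
move=> [_ S] XS ppT t; have [_ [h1 h2 h3 h4] [r1 r2 r3 r4]] := qdE ppT t.
have [|e1 e2 e3] := S (p, q); rewrite ?XS ?in_cons ?eqxx //.
have [|_ e4 e5] := S (q, r); rewrite ?XS ?in_cons ?eqxx ?orbT //.
have [|_ e6 e7] := S (r, s); rewrite ?XS ?in_cons ?eqxx ?orbT //.
have [|_ e8 e9] := S (s, p); rewrite ?XS ?in_cons ?eqxx ?orbT //.
by rewrite /qd e1 /= e2 e4 e6 e8 h1 h2 h3 h4 !eqxx e3 e5 e7 e9 r1 r2 r3 r4.
Qed.

Variables (X : {set dart}) (a b c : 'I_n).

(** Start of the invariant of [mode_z]: once [c] is joined to [z] instead of [y], what [blocked_nbr]
    leaves is [a] and [y']. *)
Lemma toggle_inv T T' y y' z : is4PPT T' -> good T X a b c -> tri T a c y -> y != b ->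
  phi T (y, c) = (c, y') ->
  (a, y') \in darts T -> phi T (c, y') = (y', z) -> z \notin [:: a; c; y'] -> exch T T' (y, c) (c, z) ->
  forall u, (u, c) \in darts T' -> (z, u) \in darts T' -> u \in [:: a; y'].
Proof.
move=> ppT' G t yb E N Ez zN [dT _] u uc zu; have sT' := is4PPT_simple ppT'.
have zc : (z == c) = false by apply/negbTE; apply: contra zN => /eqP->; rewrite !in_cons eqxx orbT.
have uc' := negbTE (dart_neq sT' uc); have zu' := negbTE (dart_neq sT' zu).
move: uc zu; rewrite !dT /rv !xpair_eqE /= !eqxx zc uc' [u == z]eq_sym zu' !orbF !andbT /= ?andbF ?andbT ?orbF.
case/andP=> uD uy zuD; have := blocked_nbr G t yb E N Ez zN uD zuD.
by rewrite !in_cons in_nil !orbF (negbTE uy) orbF.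
Qed.

(** The triangle at [ac] removes neighbours of [c] until the new edge [a y'] is already present. If
    [y'] is not yet [b], a flip then makes a vertex [z], enclosed by the 3-cycle [a c y'], follow
    [a] around [c], and [mode_z] completes the sweep. The second outcome is that [c] has degree two
    but lies in a triangle. *)
Lemma mode_a m : forall T y, sgood T X a b c -> #|nbr c T| <= m -> tri T a c y ->
  (exists T', moves X (m + n.+2) T T' /\ exists w, qd T' w a c b) \/
  (exists T', moves X (m + n.+2) T T' /\ tri T' a c b).
Proof.
elim: m => [|m IH] T y sG; have [G _] := sG => nb t; have ppT := good_pp G.
  have [[D1 _ _] _ _] := triE ppT t.
  by move: nb; rewrite leqn0 cards_eq0 => /eqP/setP/(_ a); rewrite !inE D1.
have [sX cX] := (good_sub G, good_phi G).
have sT := is4PPT_simple ppT.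
have [yb|yb] := eqVneq y b.
  by right; exists T; rewrite -yb; split=> //; apply: moves0.
have [[t1 t2 t3] [h1 h2 h3] [r1 r2 r3]] := triE ppT t.
have /= := tri_uniq ppT t; rewrite !inE !negb_or => /and3P[/andP[ac ay] cy _].
have [y' [Ey yD ay' yy']] := fan_next G t yb.
have ycD : (y, c) \in darts T by rewrite -(rv_dart sT).
have y'c := dart_neq sT yD.
have yX := good_c_out G yb; have cyX := good_tri G (tri_rot ppT t).
have nbn T' : #|nbr c T'| <= n by rewrite -[X in _ <= X]card_ord max_card.
have [N|N] := boolP ((a, y') \in darts T); last first.
  have [T' [M t' _ dT]] := eat G t yb Ey N.
  have lt := nbr_eat ac y'c ycD dT.
  have /(IH T' y' (sgood_moves sG M))/(_ t') : #|nbr c T'| <= m by rewrite -ltnS (leq_trans lt nb).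
  by case=> [[T'' [M' H]]|[T'' [M' H]]]; [left|right]; exists T''; split=> //; rewrite addSn -add1n;
    apply: moves_trans M M'.
left; have Z T' z : moves X 1 T T' -> tri T' z c y' -> on_face false T' (a, c) -> phi T' (a, c) = (c, z) ->
    (forall u, (u, c) \in darts T' -> (z, u) \in darts T' -> u \in [:: a; y']) ->
    exists T', moves X (m.+1 + n.+2) T T' /\ exists w, qd T' w a c b.
  move=> M t' o' e' inv; have [T'' [M' H]] := mode_z (sgood_moves sG M) (nbn _) t' o' e' inv.
  exists T''; split=> //; apply: moves_leq (moves_trans M M').
  by rewrite addSn addnS -addn1 leq_addl.
have L k : k = m.+1 + n.+2 -> 1 <= k by move->; rewrite addSn.
case: (fan_case G t yb Ey) => [t'|[q H]|[p H]|[q H]].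
- by have := square_unb ppT (tri_rot ppT (tri_rot ppT t)) t'; rewrite N.
- have [y'b|y'b] := eqVneq y' b.
    rewrite y'b in H; have [T' [M /andP[_ Q] _]] := pent_4 ppT sX cX H isT yX cyX.
    by exists T'; split; [apply: moves_leq M; apply: L | exists y].
  have /andP[_ Q] := H; have [_ [g1 g2 g3 g4] _] := qdE ppT Q.
  have [m1 m2 m3 [m4 m5 m6]] := qd_neq ppT Q.
  (* If [q = a], then [y] has degree two, between [a] and [c]: it is hung from [y'] instead of [a]
     and plays the part of [z] itself. *)
  have [qa|qa] := eqVneq q a.
    rewrite qa in H Q g2 g3 g4 m3 m5 m6.
    have H' : pent T 4 y c y' a c by rewrite /= Q t.
    have ayX : (a, y) \notin X.
      by apply: (qd_out ppT cX Q (mem_head _ _) yX); rewrite !in_cons eqxx !orbT.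
    have yaX : (y, a) \notin X by apply: (good_tri G (tri_rot ppT (tri_rot ppT t))).
    have [T' [M /andP[t' Q'] _]] := pent_1 ppT sX cX H' isT ayX yaX.
    have ppT' := moves_pp M.
    have [_ [k1 k2 k3] _] := triE ppT' t'; have [[_ _ _ f4] [e1 e2 e3 e4] _] := qdE ppT' Q'.
    apply: (Z T' y) => //; first by exists y, y', a, c; split=> //; rewrite !in_cons eqxx !orbT.
    move=> u uc yu; have uy : (u, y) \in darts T' by rewrite -(rv_dart (is4PPT_simple ppT')).
    have [E|->] := deg2_adj ppT' f4 e4 k3 uy; last by rewrite !in_cons eqxx orbT.
    by move: uc; rewrite E => /(dart_neq (is4PPT_simple ppT')); rewrite eqxx.
  have N' : (c, q) \notin darts T.
    by apply/negP=> D; apply: (pent_unb23 ppT H isT _ N D); rewrite eq_sym.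
  have [T' [M /andP[t' Q'] ex]] := pent_move ppT sX cX H (j := 3) isT isT yX cyX N'.
  have ppT' := moves_pp M; have [_ [e1 e2 e3 e4] _] := qdE ppT' Q'.
  apply: (Z T' q) => //.
  + by apply: (tri_rot ppT' (tri_rot ppT' t')).
  + by exists y, a, c, q; split=> //; rewrite !in_cons eqxx !orbT.
  + apply: (toggle_inv ppT' G t yb Ey N g2 _ ex).
    by rewrite !in_cons in_nil orbF !negb_or qa eq_sym m5 eq_sym m6.
- have [y'b|y'b] := eqVneq y' b.
    rewrite y'b in H; have [T' [M /andP[_ Q] _]] := pent_1 ppT sX cX H isT yX cyX.
    by exists T'; split; [apply: moves_leq M; apply: L | exists p].
  have /andP[_ Q] := H; have [[g5 g6 g7 g8] [g1 g2 g3 g4] [_ _ _ r4]] := qdE ppT Q.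
  have [m1 m2 m3 [m4 m5 m6]] := qd_neq ppT Q.
  have [T' [M /andP[t' Q'] ex]] := pent_4 ppT sX cX H isT yX cyX.
  have ppT' := moves_pp M; have [_ [e1 e2 e3 e4] _] := qdE ppT' Q'.
  apply: (Z T' p) => //.
  + by apply: (tri_rot ppT' (tri_rot ppT' t')).
  + by exists p, y, a, c; split=> //; rewrite !in_cons eqxx !orbT.
  + apply: (toggle_inv ppT' G t yb Ey N g3 _ ex).
    rewrite !in_cons in_nil orbF !negb_or m2 m3 !andbT.
    apply: contraL (good_a_in G) => /eqP E; have rX : (y', a) \in X.
      by apply: (good_reflex G (good_a_in G)); rewrite -E.
    have : (y', p) \notin X.
      by apply: (qd_out ppT cX Q _ yX); rewrite !in_cons eqxx !orbT.
    by rewrite E rX.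
- by have := pent_unb4 ppT H isT; rewrite N.
Qed.

(** Two sides of the triangle border [X], so only [ab] can lead out of it. *)
Lemma conn_ear T : good T X a b c -> tri T a c b -> conn T (X :|: face T (a, c)).
Proof.
move=> G t; have ppT := good_pp G; have [sX cX] := (good_sub G, good_phi G).
have sT := is4PPT_simple ppT; have rT := is4PPT_rot ppT.
have [[D1 _ _] _ _] := triE ppT t; have acX := good_tri G t.
have caX := good_a_in G; have bcX := good_bc G.
apply: (conn_add ppT sX cX (good_conn G)).
- by move=> x _; rewrite (phi_face sT rT).
- apply/subsetP=> x xF; rewrite in_setD (face_dart sT rT xF) D1.
  by rewrite (face_out ppT cX D1 acX xF).
move=> K _ _; have H (x : dart) : x \in face T (a, c) -> x \notin bdry X -> rv x = (a, b).
  rewrite (tri_face t (mem_head _ _)) in_set !in_cons in_nil orbF => /or3P[]/eqP-> //;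
  by rewrite inE negb_or /rv /= ?caX ?bcX ?andbF.
by have [abK|abK] := boolP ((a, b) \in K); [left|right] => x xF xB; rewrite (H x xF xB).
Qed.

(** With [X] and the triangle [a c b] fixed, a quadrilateral is brought to the far side of [ab]. Its
    reflex vertex is not covered by [X], hence is neither [a] nor [b], and a cut ending there
    produces the quadrilateral at [c]. The uncovered [v] guarantees that there is a quadrilateral to
    bring. *)
Lemma ear_quad T v : sgood T X a b c -> (forall u, (u, v) \notin X) -> tri T a c b ->
  exists T', moves X n.+1 T T' /\ exists w, qd T' w a c b.
Proof.
move=> sG vX t; have [G _] := sG; have ppT := good_pp G.
have [sX cX] := (good_sub G, good_phi G).
have sT := is4PPT_simple ppT; have rT := is4PPT_rot ppT.
have [[D1 D2 D3] [h1 h2 h3] [r1 r2 r3]] := triE ppT t.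
have /= := tri_uniq ppT t; rewrite !inE !negb_or => /and3P[/andP[ac ab] cb _].
set F := face T (a, c).
have FE : F = [set e in [:: (a, c); (c, b); (b, a)]] by rewrite /F (tri_face t (mem_head _ _)).
have acX := good_tri G t.
have FX (x : dart) : x \in F -> x \in darts T /\ x \notin X.
  by move=> xF; split; [rewrite (face_dart sT rT xF) | apply: (face_out ppT cX D1 acX xF)].
have cF : phi_closed T F by move=> x _; rewrite /F (phi_face sT rT).
have caX := good_a_in G; have bcX := good_bc G.
have [d [dD dX oF]] := ex_quad ppT cX (good_outer G) vX.
have dF : d \notin F.
  apply/negP=> H; have [|p [q [r [s [Q _]]]]] := on_face_face ppT oF (d' := (a, c)).
    by rewrite (face_eq sT rT H) mem_face.
  have [p' [q' [r' [s' [Q' dQ]]]]] := oF; have [_ _ [_ _ _ rr]] := qdE ppT Q'.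
  have : (s', p') \in F by rewrite /F -(face_eq sT rT H) (qd_face Q' dQ) in_set !in_cons eqxx !orbT.
  rewrite FE in_set !in_cons in_nil orbF => /or3P[]/eqP E; rewrite E in rr.
  - by rewrite rr in r1.
  - by rewrite rr in r2.
  - by rewrite rr in r3.
(* Otherwise the triangle would be all that is outside [X], while [d] is outside both. *)
have abX : (a, b) \notin X.
  apply/negP=> abX; have : d \in F; last by rewrite (negbTE dF).
  apply: (good_conn G _ cF _ (mem_face _ _)) => //.
    by apply/subsetP=> x /FX[xD xX]; rewrite in_setD xX.
  have B (x : dart) : x \in F -> x \in bdry X.
    by rewrite FE in_set !in_cons in_nil orbF inE => /or3P[]/eqP->; rewrite /rv /= ?caX ?bcX ?abX orbT.
  move=> x xD xB; apply/idP/idP => H; case/negP: xB; last exact: B.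
  by have := B _ H; rewrite !inE rvK orbC.
set X' := X :|: F.
have sX' : X' \subset darts T by apply/subsetP=> x; rewrite in_setU => /orP[/(subsetP sX)//|/FX[]].
have cX' : phi_closed T X' by move=> x xD; rewrite !in_setU cX // cF.
have oX' : outer T \subset X' by apply: subset_trans (good_outer G) (subsetUl _ _).
have abD : (a, b) \in darts T by rewrite -(rv_dart sT).
have [|||T' [M [p [q [r [s [Q dQ]]]]]]] := reach ppT sX' cX' oX' (conn_ear G t) (d0 := d) (e := (a, b)) _ oF abD.
- by rewrite in_setU (negbTE dX) (negbTE dF).
- rewrite in_setU (negbTE abX) FE in_set !in_cons in_nil !xpair_eqE eqxx (negbTE ac).
  by rewrite [b == c]eq_sym (negbTE cb) (negbTE ab).
- by rewrite in_setU FE in_set !in_cons eqxx !orbT.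
have M0 := moves_subset (subsetUl X F) M.
have [G' _] := sgood_moves sG M0; have ppT' := moves_pp M.
have t' : tri T' a c b.
  by apply: (same_tri (moves_same M)) t => // x; rewrite in_setU FE in_set => ->; rewrite orbT.
have [sX1 cX1] := (good_sub G', good_phi G').
have baX : (b, a) \notin X by apply: (good_tri G' (tri_rot ppT' (tri_rot ppT' t'))).
have [t0 tb] := good_b G'.
have np u v' : (v', u) \in X -> p != u.
  move=> uX; apply/negP=> /eqP E; have [_ _ [_ _ _ rr]] := qdE ppT' Q.
  have sp : (s, p) \in X by rewrite E; apply: (good_reflex G' uX); rewrite -E.
  have := qd_out ppT' cX1 Q dQ abX (x := (s, p)); rewrite sp !in_cons eqxx !orbT.
  by move/(_ isT).
have pa := np _ _ (good_a_in G'); have pb := np _ _ tb.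
have fin T1 : moves X 1 T' T1 -> qd T1 p a c b -> exists T', moves X n.+1 T T' /\ exists w, qd T' w a c b.
  by move=> M1 Q1; exists T1; split; [rewrite -addn1; apply: moves_trans M0 M1 | exists p].
move: dQ; rewrite !in_cons in_nil orbF => /or4P[]/eqP[E1 E2].
- by rewrite E1 eqxx in pa.
- subst q r; have H : pent T' 2 p a c b s by rewrite /= Q t'.
  by have [T1 [M1 /andP[_ Q1] _]] := pent_4 ppT' sX1 cX1 H isT abX baX; apply: fin M1 Q1.
- subst r s; have H : pent T' 3 p q a c b by rewrite /= Q t'.
  by have [T1 [M1 /andP[_ Q1] _]] := pent_1 ppT' sX1 cX1 H isT abX baX; apply: fin M1 Q1.
- by rewrite E2 eqxx in pb.
Qed.

Lemma fan T v : sgood T X a b c -> (forall u, (u, v) \notin X) ->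
  exists T', moves X (4 * n + 3) T T' /\ exists w, qd T' w a c b.
Proof.
move=> sG vX; have [G _] := sG; have ppT := good_pp G.
have [sX cX] := (good_sub G, good_phi G).
have sT := is4PPT_simple ppT.
have [d [dD [x t]]] := ex_tri ppT (good_h G).
have dX : d \notin X by case: d {dD} t => u w t; apply: (good_tri G t).
have caX := good_a_in G.
have acD : (a, c) \in darts T by rewrite -(rv_dart sT); apply: (subsetP sX).
have [|T1 [M1 [y t1]]] := reach ppT sX cX (good_outer G) (good_conn G) dX _ acD (good_a_out G) caX (b := true).
  by exists x.
have sG1 := sgood_moves sG M1.
have nbn : #|nbr c T1| <= n by rewrite -[X in _ <= X]card_ord max_card.
case: (mode_a sG1 nbn t1) => [[T2 [M2 H]]|[T2 [M2 t2]]].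
  exists T2; split=> //; apply: moves_leq (moves_trans M1 M2).
  by clear; lia.
have [T3 [M3 H]] := ear_quad (sgood_moves sG1 M2) vX t2.
(* [n] flips to reach [ac], [2n + 2] for the sweep and [n + 1] for the ear. *)
exists T3; split=> //; apply: moves_leq (moves_trans M1 (moves_trans M2 M3)).
by clear; lia.
Qed.

End FanEnd.

(** * The normal form *)

Section Stack.
Variable n : nat.
Notation dart := ('I_n * 'I_n)%type.
Implicit Types (d e : dart) (X Y : {set dart}) (T : cemb n) (u v w : 'I_n) (L : seq 'I_n).

Lemma phi_closed_pred T X d : is4PPT T -> X \subset darts T -> phi_closed T X -> d \in X ->
  exists2 y, y \in X & phi T y = d.
Proof.
move=> ppT sX cX dX; have sT := is4PPT_simple ppT; have rT := is4PPT_rot ppT.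
have dD := subsetP sX _ dX; have pI := phi_inj sT rT.
set y := iter (fingraph.order (phi T) d).-1 (phi T) d.
have E : phi T y = d by rewrite -iterS prednK ?fingraph.order_gt0 // iter_order.
by exists y => //; rewrite -cX ?E // -(phi_dart sT rT) E.
Qed.

Lemma phi_closed_tail T X u v : is4PPT T -> X \subset darts T -> phi_closed T X -> (v, u) \in X ->
  exists2 t, (t, v) \in X & phi T (t, v) = (v, u).
Proof.
move=> ppT sX cX /(phi_closed_pred ppT sX cX)[[t w] tX /[dup] E [wv _]]; subst w.
by exists t.
Qed.

Definition layer (a b c w : 'I_n) : {set dart} := [set d in [:: (w, a); (a, c); (c, b); (b, w)]].

Lemma good_new T X a b c w : good T X a b c -> qd T w a c b -> forall u, (u, w) \notin X.
Proof.
move=> G Q u; have ppT := good_pp G; have [[D1 D2 D3 D4] [h1 h2 h3 h4] [r1 r2 r3 r4]] := qdE ppT Q.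
apply: contra (good_a_out G) => uX; have := good_reflex G uX r4.
by move=> H; rewrite -h1 (good_phi G) // -h4 (good_phi G).
Qed.

(** The delicate field is connectivity: only the sides [wa] and [bw] of the layer can lead out, and
    turning around [w] connects what lies beyond them, as [conn_add] requires. *)
Lemma good_step T X a b c w : good T X a b c -> qd T w a c b -> good T (X :|: layer a b c w) a b w.
Proof.
move=> G Q; have ppT := good_pp G; have [sX cX] := (good_sub G, good_phi G).
have sT := is4PPT_simple ppT; have rT := is4PPT_rot ppT.
have wX := good_new G Q; have caX := good_a_in G; have bcX := good_bc G.
have acX := good_a_out G; have ab := good_ab G.
have [[D1 D2 D3 D4] [h1 h2 h3 h4] [r1 r2 r3 r4]] := qdE ppT Q.
have [m1 m2 m3 [m4 m5 m6]] := qd_neq ppT Q.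
set F := layer a b c w; have FE : F = face T (w, a) by rewrite /F (qd_face Q (mem_head _ _)).
have inF d : (d \in F) = [|| d == (w, a), d == (a, c), d == (c, b) | d == (b, w)].
  by rewrite in_set !in_cons in_nil orbF.
have FX d : d \in F -> d \in darts T /\ d \notin X.
  have waX : (w, a) \notin X by rewrite -cX // h1.
  by rewrite FE => dF; split; [rewrite (face_dart sT rT dF) | apply: (face_out ppT cX D1 waX dF)].
have cF : phi_closed T F by move=> x _; rewrite FE (phi_face sT rT).
have sF : F \subset darts T :\: X by apply/subsetP=> d /FX[dD dX]; rewrite in_setD dX.
have sX' : X :|: F \subset darts T by apply/subsetP=> d; rewrite in_setU => /orP[/(subsetP sX)|/FX[]].
have cX' : phi_closed T (X :|: F) by move=> x xD; rewrite !in_setU cX // cF.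
have [bt btX] := good_b G.
have wc' u : (u, w) \in X :|: F -> u = b.
  rewrite in_setU (negbTE (wX u)) inF !xpair_eqE /= (negbTE m1) (negbTE m2) (negbTE m3) !andbF eqxx andbT.
  by move/eqP.
have wtail u : (w, u) \notin X by apply/negP=> /(phi_closed_tail ppT sX cX)[t tX _]; have := wX t; rewrite tX.
split=> //.
- exact: subset_trans (good_outer G) (subsetUl _ _).
- apply: (conn_add ppT sX cX (good_conn G) cF sF) => K cK rK.
  have E : ((a, w) \in K) = ((w, b) \in K).
    by apply: (conn_fan ppT cX' cK rK wc' D4 h4 ab).
  have H d : d \in F -> d \notin bdry X -> rv d = (a, w) \/ rv d = (w, b).
    rewrite inF => /or4P[]/eqP->; rewrite inE negb_or /rv /= ?caX ?bcX ?andbF //; first by left.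
    by right.
  have [awK|awK] := boolP ((a, w) \in K); [left|right] => d dF dB.
    by case: (H d dF dB) => ->; rewrite -?E.
  by case: (H d dF dB) => ->; rewrite -?E.
- move=> x y z t; rewrite in_setU negb_or (good_tri G t) /=; apply/negP; rewrite FE => H.
  have := face_eq sT rT H; rewrite (tri_face t (mem_head _ _)) (qd_face Q (mem_head _ _)).
  move/setP/(_ (b, w)); rewrite !in_set !in_cons eqxx !orbT in_nil orbF.
  have [_ _ [g1 g2 g3]] := triE ppT t.
  by case/or3P=> /eqP E; rewrite E in r4; [rewrite r4 in g1|rewrite r4 in g2|rewrite r4 in g3].
- move=> y u v; rewrite in_setU => /orP[yX|yF] uR.
    by rewrite in_setU (good_reflex G yX uR).
  rewrite in_setU; move: yF; rewrite inF !xpair_eqE => /or4P[]/andP[_ /eqP E]; subst v.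
  + by rewrite (good_reflex G caX uR).
  + by rewrite (good_reflex G bcX uR).
  + by rewrite (good_reflex G btX uR).
  + by rewrite (reflex_uniq ppT uR r4) inF eqxx !orbT.
- exact: good_h G.
- by rewrite in_setU inF eqxx !orbT.
- by exists bt; rewrite in_setU btX.
move=> t u u'; rewrite !in_setU !negb_or.
have bX' u1 : (b, u1) \in X -> (u1, b) \notin X -> (u1, b) \notin F -> False.
  move=> p1 p2 p3; have E : u1 = c by apply: (good_bd G p1 p2 bcX); case: (FX (c, b)); rewrite ?inF ?eqxx ?orbT.
  by move: p3; rewrite E inF eqxx !orbT.
have Fo u1 : (t, u1) \in F -> (u1, t) \notin X -> (t = w /\ u1 = a) \/ (t = b /\ u1 = w).
  rewrite inF !xpair_eqE => /or4P[]/andP[/eqP-> /eqP->]; rewrite ?caX ?bcX //; first by left.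
  by right.
have wb : w != b := m3; have bw : b != w by rewrite eq_sym.
case/orP=> [p1|p1] /andP[p2 p3] /orP[q1|q1] /andP[q2 q3].
- exact: (good_bd G p1 p2 q1 q2).
- case: (Fo _ q1 q2) => -[E1 E2]; subst t.
    by have := wtail u; rewrite p1.
  by case: (bX' _ p1 p2 p3).
- case: (Fo _ p1 p2) => -[E1 E2]; subst t.
    by have := wtail u'; rewrite q1.
  by case: (bX' _ q1 q2 q3).
case: (Fo _ p1 p2) => -[E1 E2]; case: (Fo _ q1 q2) => -[E3 E4].
- by rewrite E2 E4.
- by move: m3; rewrite -E1 E3 eqxx.
- by move: m3; rewrite -E3 E1 eqxx.
- by rewrite E2 E4.
Qed.

Lemma same_layer T T' X a b c w : is4PPT T -> same (X :|: layer a b c w) T T' -> qd T w a c b -> qd T' w a c b.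
Proof.
by move=> ppT S; apply: (same_qd S) => // d dQ; rewrite in_setU [d \in layer _ _ _ _]in_set dQ orbT.
Qed.

Lemma sgood_step T X a b c w : sgood T X a b c -> qd T w a c b -> sgood T (X :|: layer a b c w) a b w.
Proof.
move=> [G H] Q; split; first exact: good_step.
move=> T' ppT' S; apply: good_step; last exact: same_layer (good_pp G) S Q.
by apply: H => //; apply: same_subset S; apply: subsetUl.
Qed.

(** Base of the stack, with the outer face as [X]. The faces across consecutive outer edges are
    connected by turning around the common vertex, so removing the outer face does not disconnect
    the dual. *)
Lemma sgood_outer T a b c : is4PPT T -> 2 < #|outer T| -> (b, c) \in outer T -> phi T (b, c) = (c, a) ->
  sgood T (outer T) a b c.
Proof.
move=> ppT h3 bc E.
suff H T' : is4PPT T' -> outer T' = outer T -> phi T' (b, c) = (c, a) -> good T' (outer T) a b c.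
  by split=> [|T' ppT' [o S]]; apply: H => //; have [_ -> _] := S _ bc.
clear ppT E => ppT' oE E; rewrite -oE in h3 bc *.
have sT := is4PPT_simple ppT'; have rT := is4PPT_rot ppT'.
have oX : outer T' \subset darts T' by apply/subsetP=> d /(outer_reflex ppT')/(reflex_dart ppT').
have [d0 d0D FE] := facesP _ _ (outer_face ppT').
have cX : phi_closed T' (outer T') by move=> d _; rewrite FE (phi_face sT rT).
have u1 u u' v : (u, v) \in outer T' -> (u', v) \in outer T' -> u = u'.
  by move=> p q; apply: (reflex_uniq ppT' (v := v)); apply: (outer_reflex ppT').
have bD := subsetP oX _ bc.
(* [a = b] would close the outer face after two darts. *)
have ab : a != b.
  apply: contraTneq h3 => ab; have [t tX Et] := phi_closed_tail ppT' oX cX bc.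
  have caX : (c, a) \in outer T' by rewrite -E cX.
  have E2 : phi T' (c, b) = (b, c) by rewrite -Et (u1 _ _ _ tX (_ : (c, b) \in _)) // -ab.
  have cy : fcycle (phi T') [:: (b, c); (c, b)] by rewrite /= E ab E2 !eqxx.
  have [-> _] := face_in sT rT (outer_face ppT') bc.
  by rewrite (face_cycle cy (mem_head _ _)) -leqNgt cardsE (leq_trans (card_size _)).
have caX : (c, a) \in outer T' by rewrite -E cX.
split=> //.
- move=> K sK cK rK e0 e K0 eD eX.
  have cy K' : phi_closed T' K' -> rv_closed T' (bdry (outer T')) K' ->
     forall d, d \in outer T' -> (rv (phi T' d) \in K') = (rv d \in K').
    move=> cK' rK' [u v] uX; have vX : (v, (phi T' (u, v)).2) \in outer T'.
      by rewrite -[X in X \in _]/(phi T' (u, v)) cX // (subsetP oX).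
    have := conn_fan ppT' cX cK' rK' (fun t tX => u1 _ _ _ tX uX) (subsetP oX _ uX) (w := (phi T' (u, v)).2) (erefl _).
    apply; apply: contraTneq h3 => E'.
    have pd : phi T' (u, v) = (v, u) by rewrite -[LHS]/(v, (phi T' (u, v)).2) E'.
    have [x xX Ex] := phi_closed_tail ppT' oX cX uX.
    have xv : x = v by apply: u1 xX _; rewrite -pd cX ?(subsetP oX).
    rewrite xv in Ex; have cyc : fcycle (phi T') [:: (u, v); (v, u)] by rewrite /= pd Ex !eqxx.
    have [-> _] := face_in sT rT (outer_face ppT') uX.
    by rewrite (face_cycle cyc (mem_head _ _)) -leqNgt cardsE (leq_trans (card_size _)).
  have all d d' : d \in outer T' -> d' \in outer T' -> (rv d' \in K) = (rv d \in K).
    move=> dX dX'; have [oE' _] := face_in sT rT (outer_face ppT') dX.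
    move: dX'; rewrite oE' inE => /iter_findex <-; elim: (findex _ _ _) => //= k <-.
    apply: cy => //; elim: k => //= k IH; rewrite cX //; apply: (subsetP oX).
    exact: IH.
  have sy (L : {set dart}) : (forall x : dart, x \in darts T' -> x \in L -> rv x \in L) -> rv_closed T' set0 L.
    move=> H x xD _; apply/idP/idP; last exact: H.
    by rewrite -{2}(rvK x); apply: H; rewrite ?rv_dart.
  have KX (x : dart) : x \in K -> x \in darts T' /\ x \notin outer T'.
    by move=> xK; have := subsetP sK x xK; rewrite in_setD => /andP[].
  have [cbK|cbK] := boolP ((c, b) \in K).
    have : e \in K :|: outer T'; last by rewrite in_setU (negbTE eX) orbF.
    apply: (dual_connected sT rT (is4PPT_conn ppT') _ _ (d0 := (b, c))) => //.
    + by move=> d dD; rewrite !in_setU cK // cX.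
    + apply: sy => d dD; rewrite !in_setU => /orP[dK|dX].
        have [|rX] := boolP (rv d \in outer T'); first by rewrite orbT.
        have [_ dX] := KX d dK.
        by rewrite rK ?dK // inE negb_or dX.
      by rewrite (all _ _ bc dX) cbK.
    + by rewrite in_setU bc orbT.
  apply: (dual_connected sT rT (is4PPT_conn ppT') cK _ _ K0) => //; last by case: (KX _ K0).
  apply: sy => d dD dK; have [_ dX] := KX d dK.
  have [rX|rX] := boolP (rv d \in outer T'); last by rewrite rK ?dK // inE negb_or dX.
  have := all _ _ bc rX; rewrite rvK dK => E'.
  by move: cbK; rewrite -[(c, b)]/(rv (b, c)) -E'.
- move=> x y z t; apply/negP=> /(outer_reflex ppT'); have [_ _ [r1 _ _]] := triE ppT' t.
  exact/negP.
- move=> y u v yX uR; rewrite (reflex_uniq ppT' uR (outer_reflex ppT' yX)); exact: yX.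
- by move=> u uX; apply: u1 uX bc.
- by have [t tX _] := phi_closed_tail ppT' oX cX bc; exists t.
move=> t u u' p1 _ p2 _.
have [s sX Es] := phi_closed_tail ppT' oX cX p1; have [s' sX' Es'] := phi_closed_tail ppT' oX cX p2.
by move: Es'; rewrite (u1 _ _ _ sX' sX) Es => -[].
Qed.

End Stack.

(** * Stacks, the final fan, and uniqueness of the normal form *)

Section Canon.
Variable n : nat.
Notation dart := ('I_n * 'I_n)%type.
Implicit Types (d e : dart) (X Y : {set dart}) (T : cemb n) (u v w : 'I_n) (L : seq 'I_n).

Fixpoint stack X (a b c : 'I_n) L : {set dart} :=
  if L is w :: L' then stack (X :|: layer a b c w) a b w L' else X.

Fixpoint stacked T (a b c : 'I_n) L : bool :=
  if L is w :: L' then qd T w a c b && stacked T a b w L' else true.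

Definition covers X v := [exists u, (u, v) \in X].

Lemma coversP X v : reflect (exists u, (u, v) \in X) (covers X v).
Proof. exact: existsP. Qed.

Lemma covers_sub X Y v : X \subset Y -> covers X v -> covers Y v.
Proof. by move=> /subsetP XY /coversP[u /XY uX]; apply/coversP; exists u. Qed.

Lemma stack_sub a b L : forall X c, X \subset stack X a b c L.
Proof. by elim: L => //= w L IH X c; apply: subset_trans (IH _ _); apply: subsetUl. Qed.

Lemma sgood_stack T a b L : forall X c, sgood T X a b c -> stacked T a b c L ->
  sgood T (stack X a b c L) a b (last c L).
Proof. by elim: L => //= w L IH X c G /andP[Q S]; apply: IH => //; apply: sgood_step. Qed.

Lemma same_stacked T T' a b L : forall X c, is4PPT T -> same (stack X a b c L) T T' ->
  stacked T a b c L -> stacked T' a b c L.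
Proof.
elim: L => //= w L IH X c ppT S /andP[Q H]; rewrite (IH _ _ ppT S H) andbT.
by apply: (same_layer (X := X) ppT _ Q); apply: same_subset S; apply: stack_sub.
Qed.

Lemma good_covers T X a b c : good T X a b c -> [/\ covers X a, covers X b & covers X c].
Proof.
move=> G; split; apply/coversP; [exists c|exact: good_b G|exists b].
  exact: good_a_in G.
exact: good_bc G.
Qed.

Lemma covers_layer T X a b c w v : good T X a b c -> covers (X :|: layer a b c w) v = covers X v || (v == w).
Proof.
move=> G; have [ca cb cc] := good_covers G; apply/idP/idP.
  case/coversP=> u; rewrite in_setU => /orP[uX|]; first by apply/orP; left; apply/coversP; exists u.
  rewrite in_set !in_cons in_nil orbF !xpair_eqE => /or4P[]/andP[_ /eqP->]; rewrite ?ca ?cb ?cc //.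
  by rewrite eqxx orbT.
case/orP=> [|/eqP->]; first by apply: covers_sub; apply: subsetUl.
by apply/coversP; exists b; rewrite in_setU in_set !in_cons eqxx !orbT.
Qed.

Lemma stack_covers T a b L : forall X c v, good T X a b c -> stacked T a b c L ->
  covers (stack X a b c L) v = covers X v || (v \in L).
Proof.
elim: L => [|w L IH] X c v G /=; first by rewrite orbF.
case/andP=> Q S; rewrite (IH _ _ _ (good_step G Q) S) (covers_layer w v G) in_cons.
by rewrite orbA.
Qed.

Lemma stacked_uniq T a b L : forall X c, good T X a b c -> stacked T a b c L ->
  uniq L /\ {in L, forall v, ~~ covers X v}.
Proof.
elim: L => [|w L IH] X c G //= /andP[Q S]; have [u h] := IH _ _ (good_step G Q) S.
have wX : ~~ covers X w by apply/coversP => -[t]; apply/negP; apply: (good_new G Q).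
split.
  rewrite u andbT; apply/negP=> /h; rewrite (covers_layer w w G) eqxx orbT //.
move=> v; rewrite in_cons => /orP[/eqP->//|/h]; apply: contra.
by apply: covers_sub; apply: subsetUl.
Qed.

Lemma stack_all a b m : forall T X c, sgood T X a b c -> #|[set v | ~~ covers X v]| <= m ->
  exists T' L, [/\ moves X (m * (4 * n + 3)) T T', stacked T' a b c L &
                   forall v, covers (stack X a b c L) v].
Proof.
elim: m => [|m IH] T X c sG; have [G _] := sG => H.
  exists T, [::]; split=> //; first exact: moves0 (good_pp G) (good_sub G).
  move=> v; apply: contraLR H => /= N; rewrite -ltnNge; apply/card_gt0P.
  by exists v; rewrite inE.
have [E|[v]] := set_0Vmem [set v | ~~ covers X v].
  exists T, [::]; split=> //; first exact: moves0 (good_pp G) (good_sub G).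
  by move=> v /=; have := in_set0 v; rewrite -E inE => /negbFE.
rewrite inE => vX; have [|T1 [M1 [w Q]]] := fan (v := v) sG.
  by move=> u; apply: contra vX => uX; apply/coversP; exists u.
have sG1 := sgood_moves sG M1; have [G1 _] := sG1.
have wX : ~~ covers X w by apply/coversP => -[t]; apply/negP; apply: (good_new G1 Q).
have [|T2 [L [M2 S C]]] := IH T1 _ w (sgood_step sG1 Q).
  rewrite -ltnS; apply: leq_trans H; apply: proper_card; apply/properP; split.
    by apply/subsetP=> u; rewrite !inE; apply: contra; apply: covers_sub; apply: subsetUl.
  by exists w; rewrite !inE // (covers_layer w w G1) eqxx orbT.
exists T2, (w :: L); split=> //.
  rewrite mulSn; apply: moves_trans M1 (moves_subset _ M2); exact: subsetUl.
by rewrite /= S (same_layer (good_pp G1) (moves_same M2) Q).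
Qed.

Definition fanned T X a := forall d, d \in darts T -> d \notin X ->
  exists x y, tri T a x y /\ d \in [:: (a, x); (x, y); (y, a)].

Section Full.
Variables (X : {set dart}) (a b c : 'I_n).
Hypothesis cov : forall v, covers X v.

(** A quadrilateral outside [X] would have its reflex angle at a covered vertex, but the reflex
    angles of covered vertices are in [X]. *)
Lemma full_tri T d : good T X a b c -> d \in darts T -> d \notin X -> exists x, tri T d.1 d.2 x.
Proof.
move=> G dD dX; have ppT := good_pp G.
have [|//|[p [q [r [s [Q dQ]]]]]] := tri_or_qd ppT dD.
  by apply: contraNneq dX => E; apply: (subsetP (good_outer G)); rewrite -E mem_face.
have [u uX] := coversP _ _ (cov p); have [_ _ [_ _ _ rr]] := qdE ppT Q.
have := qd_out ppT (good_phi G) Q dQ dX (x := (s, p)).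
rewrite (good_reflex G uX rr) !in_cons eqxx !orbT.
by move/(_ isT).
Qed.

(** While some face outside [X] misses [a], connectivity yields a triangle [a p q] with a triangle
    beyond [pq] that misses [a]. Flipping this square gives [a] one more neighbour, which bounds the
    number of flips. *)
Lemma fan_all m : forall T, sgood T X a b c -> n <= m + #|nbr a T| ->
  exists T', moves X m T T' /\ fanned T' X a.
Proof.
elim: m => [|m IH] T sG; have [G _] := sG; have ppT := good_pp G => nm.
  have := subset_leq_card (subsetT (nbr a T)); rewrite cardsT card_ord => le.
  have /setP/(_ a) : nbr a T = setT by apply/eqP; rewrite eqEcard subsetT cardsT card_ord.
  by rewrite !inE (negbTE ((is4PPT_simple ppT).2 a)).
have [sX cX] := (good_sub G, good_phi G).
have sT := is4PPT_simple ppT; have rT := is4PPT_rot ppT.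
pose P (d : dart) := [exists x, exists y, tri T a x y && (d \in [:: (a, x); (x, y); (y, a)])].
have PP d : reflect (exists x y, tri T a x y /\ d \in [:: (a, x); (x, y); (y, a)]) (P d).
  apply: (iffP existsP) => [[x /existsP[y /andP[h1 h2]]]|[x [y [h1 h2]]]].
    by exists x, y.
  by exists x; apply/existsP; exists y; rewrite h1.
pose K := [set d in darts T :\: X | P d].
have [all|/forallPn[d0]] := boolP [forall d, (d \in darts T :\: X) ==> P d].
  exists T; split; first exact: moves0.
  by move=> d dD dX; have /forallP/(_ d)/implyP := all; rewrite in_setD dX dD => /(_ isT)/PP.
rewrite negb_imply => /andP[d0Y d0P].
have d0Y' : d0 \in darts T /\ d0 \notin X by move: d0Y; rewrite in_setD => /andP[].
have Pf d e : P d -> e \in face T d -> P e.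
  by move=> /PP[x [y [t dt]]]; rewrite (tri_face t dt) in_set => et; apply/PP; exists x, y.
have cK : phi_closed T K.
  move=> d dD; rewrite !in_set phi_dart // cX //; congr (_ && _); apply/idP/idP => H.
    by apply: (Pf _ _ H); rewrite (face_phi sT rT) mem_face.
  by apply: (Pf _ _ H); rewrite (phi_face sT rT) mem_face.
have caX := good_a_in G; have acX := good_a_out G.
have acD : (a, c) \in darts T by rewrite -(rv_dart sT); apply: (subsetP sX).
have acK : (a, c) \in K.
  have [x t] := full_tri G acD acX; rewrite in_set in_setD acX acD; apply/PP.
  by exists c, x; split=> //; rewrite mem_head.
have [/forallP rK|/forallPn[d]] := boolP [forall d, (d \in darts T) && (d \notin bdry X) ==> ((rv d \in K) == (d \in K))].
  have : d0 \in K; last by rewrite in_set (negbTE d0P) andbF.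
  apply: (good_conn G _ cK _ acK) => //; try by case: d0Y'.
    by apply/subsetP=> x; rewrite in_set => /andP[].
  by move=> d dD dB; have := rK d; rewrite dD dB => /eqP.
rewrite negb_imply => /andP[/andP[dD dB] dK].
have [x [xD xB xK rxK]] : exists x : dart, [/\ x \in darts T, x \notin bdry X, x \in K & rv x \notin K].
  have [H|H] := boolP (d \in K); [exists d|exists (rv d)]; split; rewrite ?rv_dart ?rvK //.
  - by move: dK; rewrite H; case: (rv d \in K).
  - by move: dB; rewrite !inE rvK orbC.
  - by move: dK; rewrite (negbTE H); case: (rv d \in K).
move: xK; rewrite in_set => /andP[_ /PP[p [q [t xt]]]].
have [xX rxX] : x \notin X /\ rv x \notin X by move: xB; rewrite inE negb_or => /andP[].
have rxD : rv x \in darts T by rewrite rv_dart.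
have nP : ~~ P (rv x) by move: rxK; rewrite in_set in_setD rxX rxD.
have [z tz] := full_tri G rxD rxX.
move: xt; rewrite !in_cons in_nil orbF => /or3P[]/eqP E; rewrite E /rv /= in tz nP xX rxX.
- case/PP: nP; exists z, p; split; first exact: tri_rot.
  by rewrite !in_cons eqxx !orbT.
- have az : a != z.
    apply: contra nP => /eqP E'; apply/PP; exists q, p; split; last by rewrite !in_cons eqxx orbT.
    by rewrite -E' in tz; apply: (tri_rot ppT (tri_rot ppT tz)).
  have t1 := tri_rot ppT (tri_rot ppT t).
  have [T1 [M1 _ _ [dT _]]] := square_move ppT sX cX t1 tz az rxX xX.
  have un := square_unb ppT t1 tz.
  have [|T2 [M2 F]] := IH T1 (sgood_moves sG M1).
    rewrite (leq_trans nm) // addSnnS leq_add2l; apply: proper_card; apply/properP; split.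
      apply/subsetP=> u; rewrite !in_set dT => ->; rewrite !xpair_eqE.
      have /= := tri_uniq ppT t; rewrite !inE !negb_or => /and3P[/andP[/negbTE-> /negbTE->] _ _].
      by rewrite !andbF.
    exists z; first by rewrite in_set dT /rv /= eqxx orbT.
    by rewrite in_set -(rv_dart sT).
  by exists T2; split=> //; rewrite -add1n; apply: moves_trans M1 M2.
- case/PP: nP; exists q, z; split=> //.
  by rewrite !in_cons eqxx.
Qed.

Lemma fanned_in T x y : good T X a b c -> fanned T X a -> tri T a x y -> (y, x) \in X.
Proof.
move=> G F t; have ppT := good_pp G; apply: contraT => N.
have [[t1 t2 t3] [h1 h2 h3] [r1 r2 r3]] := triE ppT t.
have /= := tri_uniq ppT t; rewrite !inE !negb_or => /and3P[/andP[ax ay] xy _].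
have yD : (y, x) \in darts T by rewrite -(rv_dart (is4PPT_simple ppT)).
have [p [q [t' ]]] := F _ yD N; have [_ [g1 g2 g3] [s1 s2 s3]] := triE ppT t'.
rewrite !in_cons in_nil orbF !xpair_eqE [y == a]eq_sym (negbTE ay) [x == a]eq_sym (negbTE ax) andbF orbF /=.
case/andP=> /eqP Ep /eqP Eq; subst p q.
by have := corner_neq ppT t2 r2 s1 h2 g1; rewrite eqxx.
Qed.

(** Turning around [a] from [c], each fan triangle has its third side on the boundary of [X], where
    [good_bd] leaves a single continuation; so the two fans agree step by step. *)
Lemma fanned_sub T1 T2 : good T1 X a b c -> good T2 X a b c -> same X T1 T2 ->
  fanned T1 X a -> fanned T2 X a ->
  forall d, d \in darts T1 -> d \in darts T2 /\ phi T2 d = phi T1 d.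
Proof.
move=> G1 G2 [_ S] F1 F2; have [pp1 pp2] := (good_pp G1, good_pp G2).
have [sT1 rT1] := (is4PPT_simple pp1, is4PPT_rot pp1).
have [sT2 rT2] := (is4PPT_simple pp2, is4PPT_rot pp2).
have fa T y : good T X a b c -> fanned T X a -> (y, a) \in darts T -> (y, a) \notin X -> exists x, tri T a x y.
  move=> G F yD yX; have [p [q [t]]] := F _ yD yX; have ppT := good_pp G.
  have /= := tri_uniq ppT t; rewrite !inE !negb_or => /and3P[/andP[ap aq] pq _].
  rewrite !xpair_eqE (negbTE ap) (negbTE aq) !andbF eqxx andbT /=.
  by move/eqP->; exists p.
have caX := good_a_in G1; have caD := subsetP (good_sub G1) _ caX.
have A y : (y, a) \in darts T1 -> (y, a) \in darts T2 /\ phi T2 (y, a) = phi T1 (y, a).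
  move=> yD; pose P t := (t, a) \in darts T2 /\ phi T2 (t, a) = phi T1 (t, a).
  apply: (rot_in_ind sT1 rT1 (P := P)) caD yD _; last by have [h1 h2 _] := S _ caX.
  move=> t tD [t2 E]; set t' := (phi T1 (t, a)).2; have E1 : phi T1 (t, a) = (a, t') by [].
  have t'1 : (t', a) \in darts T1 by rewrite -(rv_dart sT1) -[rv _]/(a, t') -E1 phi_dart.
  have t'2 : (t', a) \in darts T2 by rewrite -(rv_dart sT2) -[rv _]/(a, t') -E1 -E phi_dart.
  split=> //; have [X'|X'] := boolP ((t', a) \in X); first by have [_ h2 _] := S _ X'.
  have [x1 tr1] := fa _ _ G1 F1 t'1 X'; have [x2 tr2] := fa _ _ G2 F2 t'2 X'.
  have [_ [_ _ e1] _] := triE pp1 tr1; have [_ [_ _ e2] _] := triE pp2 tr2.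
  rewrite e1 e2; congr (_, _); apply: (good_bd G2) (fanned_in G2 F2 tr2) _ (fanned_in G1 F1 tr1) _.
    exact: (good_tri G2 (tri_rot pp2 tr2)).
  exact: (good_tri G1 (tri_rot pp1 tr1)).
move=> d dD; have [dX|dX] := boolP (d \in X); first by have [h1 h2 _] := S _ dX.
have [x [y [t dt]]] := F1 _ dD dX.
have [[t1 t2 t3] [h1 h2 h3] _] := triE pp1 t; have [y2 e2] := A y t3.
have yX : (y, a) \notin X by apply: (good_tri G1 (tri_rot pp1 (tri_rot pp1 t))).
have [x' t'] := fa _ _ G2 F2 y2 yX; have [_ [_ _ g3] _] := triE pp2 t'.
have E : x' = x by move: e2; rewrite g3 h3 => -[].
rewrite E in t'; have [[s1 s2 s3] [k1 k2 k3] _] := triE pp2 t'.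
by move: dt; rewrite !in_cons in_nil orbF => /or3P[]/eqP->; rewrite ?h1 ?h2 ?h3.
Qed.

Lemma fanned_uniq T1 T2 : good T1 X a b c -> good T2 X a b c -> same X T1 T2 ->
  fanned T1 X a -> fanned T2 X a -> T1 = T2.
Proof.
move=> G1 G2 S F1 F2; have [pp1 pp2] := (good_pp G1, good_pp G2).
have [sT1 rT1] := (is4PPT_simple pp1, is4PPT_rot pp1).
have [sT2 rT2] := (is4PPT_simple pp2, is4PPT_rot pp2).
have S' : same X T2 T1.
  case: S => o S; split=> // d dX; have [h1 h2 h3] := S d dX; split=> //.
  by apply: (subsetP (good_sub G1)).
have H1 := fanned_sub G1 G2 S F1 F2; have H2 := fanned_sub G2 G1 S' F2 F1.
have dE : darts T1 = darts T2 by apply/setP=> d; apply/idP/idP => [/H1[]|/H2[]].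
have rE : rot T1 = rot T2.
  apply/ffunP=> -[v u]; have [D|D] := boolP ((v, u) \in darts T1); last first.
    by rewrite (rT1.1 _ _ D) (rT2.1 v u) // -dE.
  have uv : (u, v) \in darts T1 by rewrite -(rv_dart sT1).
  by have [_ []] := H1 _ uv.
(* All vertices are covered, so every reflex angle is in [X], where the tags agree. *)
have fE : reflex T1 = reflex T2.
  apply/setP=> -[u v]; have [t tX] := coversP _ _ (cov v); case: S => _ S.
  apply/idP/idP => H.
    by have [_ _ ->] := S _ (good_reflex G1 tX H).
  by have [_ _ <-] := S _ (good_reflex G2 tX H).
have oE : outer T1 = outer T2 by case: S.
move: dE rE fE oE; clear; case: T1 => d1 r1 o1 f1; case: T2 => d2 r2 o2 f2 /=.
by move=> -> -> -> ->.
Qed.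

End Full.
End Canon.

(** * Sorting the stack *)

Section Sort.
Variable n : nat.
Notation dart := ('I_n * 'I_n)%type.
Notation quad := ('I_n * 'I_n * 'I_n * 'I_n)%type.
Implicit Types (T : cemb n) (R : seq quad) (f : quad).

Definition apex f : 'I_n := f.1.1.1.
Definition qdf T f := qd T f.1.1.1 f.1.1.2 f.1.2 f.2.

Lemma qdsE T f R : all (qdf T) (f :: R) = qdf T f && all (qdf T) R. Proof. by []. Qed.

Lemma deg3_adj T v u1 u2 u3 t : is4PPT T -> (u1, v) \in darts T -> phi T (u1, v) = (v, u2) ->
  phi T (u2, v) = (v, u3) -> phi T (u3, v) = (v, u1) -> (t, v) \in darts T -> t \in [:: u1; u2; u3].
Proof.
move=> ppT D E1 E2 E3 tD.
apply: (rot_in_ind (is4PPT_simple ppT) (is4PPT_rot ppT) (P := fun t => t \in [:: u1; u2; u3])) D tD _.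
  by move=> u _; rewrite !in_cons in_nil orbF => /or3P[]/eqP->; rewrite ?E1 ?E2 ?E3 /= eqxx ?orbT.
by rewrite mem_head.
Qed.

Lemma qd_apex T p q r s p' q' r' s' d : is4PPT T -> qd T p q r s -> qd T p' q' r' s' ->
  d \in face T (p, q) -> d \in face T (p', q') -> p = p'.
Proof.
move=> ppT Q Q' d1 d2; have sT := is4PPT_simple ppT; have rT := is4PPT_rot ppT.
have := face_eq sT rT d1; rewrite (face_eq sT rT d2).
rewrite (qd_face Q (mem_head _ _)) (qd_face Q' (mem_head _ _)) => /setP/(_ (s, p)).
have [_ _ [_ _ _ r4]] := qdE ppT Q; have [_ _ [k1 k2 k3 _]] := qdE ppT Q'.
rewrite !in_set [in RHS]in_cons !in_cons eqxx !orbT in_nil orbF => /or4P[]/eqP E.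
- by rewrite E in r4; rewrite r4 in k1.
- by rewrite E in r4; rewrite r4 in k2.
- by rewrite E in r4; rewrite r4 in k3.
- by case: E.
Qed.

(** A quadrilateral is recognised by its reflex vertex, so the listed ones, whose apexes differ from
    [p], are not among the two faces that change. *)
Lemma qstep T R i j p q1 q2 q3 q4 : is4PPT T -> pent T i p q1 q2 q3 q4 -> all (qdf T) R ->
  p \notin map apex R -> 0 < j <= 4 -> i != j -> diag j p q1 q2 q3 q4 \notin darts T ->
  exists T', [/\ moves (outer T) 1 T T', pent T' j p q1 q2 q3 q4 & all (qdf T') R].
Proof.
move=> ppT H hR pR ji ij N; have sT := is4PPT_simple ppT; have rT := is4PPT_rot ppT.
have [oX oD] : outer T \subset reflex T /\ outer T \subset darts T.
  by split; apply/subsetP=> d /(outer_reflex ppT) // /(reflex_dart ppT).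
have cX : phi_closed T (outer T).
  by have [d0 d0D ->] := facesP _ _ (outer_face ppT); move=> d _; rewrite (phi_face sT rT).
set e := diag i p q1 q2 q3 q4.
have [x [y [r [s [u [v [t Q [te Qe]]]]]]]] : exists x y r s u v,
  [/\ tri T x y r, qd T p s u v & rv e \in [:: (x, y); (y, r); (r, x)] /\ e \in [:: (p, s); (s, u); (u, v); (v, p)]].
  move: H; rewrite /e; clear; case: i => [|[|[|[|[|i]]]]] //= /andP[t Q].
  - by exists p, q1, q2, q2, q3, q4; split=> //; split; rewrite /rv !in_cons eqxx ?orbT.
  - by exists q1, q2, q3, q1, q3, q4; split=> //; split; rewrite /rv !in_cons eqxx ?orbT.
  - by exists q2, q3, q4, q1, q2, q4; split=> //; split; rewrite /rv !in_cons eqxx ?orbT.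
  - by exists q3, q4, p, q1, q2, q3; split=> //; split; rewrite /rv !in_cons eqxx ?orbT.
have [_ _ [r1 r2 r3]] := triE ppT t; have [_ _ [k1 k2 k3 _]] := qdE ppT Q.
have N1 : e \notin outer T.
  apply: (qd_out ppT cX Q (mem_head _ _) _ Qe); apply: contra k1; exact: (subsetP oX).
have N2 : rv e \notin outer T.
  apply: (tri_out ppT cX t (mem_head _ _) _ te); apply: contra r1; exact: (subsetP oX).
have [T' [M H' [_ k]]] := pent_move ppT oD cX H ji ij N1 N2 N.
exists T'; split=> //; apply/allP=> f fR; have Qf := allP hR f fR.
apply: (keep_qd ppT k Qf).
  apply: contra pR => h; have <- : apex f = p; last exact: map_f.
  apply: (qd_apex ppT Qf Q (mem_face _ _)).
  have : e \in face T (p, s) by rewrite (qd_face Q (mem_head _ _)) in_set.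
  by move/(face_eq sT rT) <-.
apply/negP=> h; have [_ _ [_ _ _ r4]] := qdE ppT Qf.
have := face_eq sT rT h; rewrite (qd_face Qf (mem_head _ _)) (tri_face t te).
move/setP/(_ (f.2, f.1.1.1)); rewrite !in_set [in LHS]in_cons !in_cons eqxx !orbT in_nil orbF.
by case/esym/or3P=> /eqP E; rewrite E in r4; [rewrite r4 in r1|rewrite r4 in r2|rewrite r4 in r3].
Qed.

Lemma qstep1 T R i p q1 q2 q3 q4 : is4PPT T -> pent T i p q1 q2 q3 q4 -> all (qdf T) R ->
  p \notin map apex R -> i != 1 ->
  exists T', [/\ moves (outer T) 1 T T', pent T' 1 p q1 q2 q3 q4 & all (qdf T') R].
Proof. by move=> ppT H hR pR i1; apply: (qstep ppT H hR pR) => //; apply: pent_unb1 H i1. Qed.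

Lemma qstep4 T R i p q1 q2 q3 q4 : is4PPT T -> pent T i p q1 q2 q3 q4 -> all (qdf T) R ->
  p \notin map apex R -> i != 4 ->
  exists T', [/\ moves (outer T) 1 T T', pent T' 4 p q1 q2 q3 q4 & all (qdf T') R].
Proof. by move=> ppT H hR pR i1; apply: (qstep ppT H hR pR) => //; apply: pent_unb4 H i1. Qed.

Lemma outer_moves T T' k X : moves X k T T' -> outer T' = outer T.
Proof. by case=> j _ [_ _ []]. Qed.

Lemma moves_step T T' T'' k : moves (outer T) 1 T T' -> moves (outer T') k T' T'' ->
  moves (outer T) k.+1 T T''.
Proof. by move=> M; rewrite (outer_moves M) -add1n; apply: moves_trans. Qed.

Variables a b x : 'I_n.

(* The face that follows in the fan carried by x; None stands for the end of the fan. *)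
Definition endq (r : option 'I_n) y : quad := if r is Some r then (r, x, y, b) else (x, y, b, a).

Lemma endq_step T R p q r : is4PPT T -> odflt x r \notin map apex R ->
  tri T q x p -> qdf T (endq r q) -> all (qdf T) R -> (p, b) \notin darts T ->
  exists T', [/\ moves (outer T) 1 T T', tri T' b p q, qdf T' (endq r p) & all (qdf T') R].
Proof.
move=> ppT; case: r => [r|] /= rR t Q hR N.
  have [|T' [M /andP[t' Q'] R']] := @qstep T R 2 3 r x p q b ppT _ hR rR isT isT N.
    by rewrite /= (tri_rot ppT t).
  by exists T'; split=> //; rewrite (tri_rot (moves_pp M) (tri_rot (moves_pp M) t')).
have [|T' [M /andP[t' Q'] R']] := @qstep T R 1 2 x p q b a ppT _ hR rR isT isT N.
  by rewrite /= (tri_rot ppT t).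
by exists T'; split=> //; rewrite (tri_rot (moves_pp M) (tri_rot (moves_pp M) t')).
Qed.

(** Four of the seven cuts end at the reflex vertex and are never blocked. In the other three, one
    end of the new edge has degree two or three at that moment, and the faces around it list its
    neighbours. *)
Lemma swap_local T R o p q r : is4PPT T -> uniq [:: a; b; x; p; q] -> o \notin [:: a; b] ->
  odflt x r \notin [:: p; q] -> [&& p \notin map apex R, q \notin map apex R & odflt x r \notin map apex R] ->
  tri T a p x -> all (qdf T) [:: (p, a, o, b), (q, x, p, b), endq r q & R] ->
  exists T', [/\ moves (outer T) 7 T T', tri T' a q x & all (qdf T') [:: (q, a, o, b), (p, x, q, b), endq r p & R]].
Proof.
move=> ppT; rewrite /= !in_cons !in_nil !orbF !negb_or.
case/and4P=> /and4P[ab ax ap aq] /and3P[bx bp bq] /andP[xp xq] /andP[pq _] /andP[oa ob].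
case/andP=> rp rq /and3P[pR qR rR] t0 /and4P[Q1 Q2 Q3 QR].
have ea y : apex (endq r y) = odflt x r by case: r {rp rq rR Q3}.
have [||| T1 [M1 /andP[t1 P1] /and3P[A2 A3 AR]]] := @qstep4 T [:: (q, x, p, b), endq r q & R] 1 p x a o b ppT _ _ _ isT.
- by rewrite /= (tri_rot ppT t0).
- by rewrite /= Q2 Q3.
- by rewrite /= !in_cons ea !negb_or pq [p == _]eq_sym rp.
have pp1 := moves_pp M1.
have [||| T2 [M2 /andP[t2 P2] /and3P[B1 B3 BR]]] := @qstep1 T1 [:: (p, x, a, o), endq r q & R] 3 q x p o b pp1 _ _ _ isT.
- by rewrite /= (tri_rot pp1 (tri_rot pp1 t1)).
- by apply/and3P.
- by rewrite /= !in_cons ea !negb_or eq_sym pq [q == _]eq_sym rq.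
have pp2 := moves_pp M2.
have [||||| T3 [M3 t3 C3 /and3P[C1 C2 CR]]] := @endq_step T2 [:: (p, x, a, o), (q, p, o, b) & R] p q r pp2.
- by rewrite /= !in_cons !negb_or rp rq.
- exact: t2.
- exact: B3.
- by apply/and3P.
- have [[_ g2 _] [_ g _] _] := triE pp2 t2; have [[_ _ _ h0] [_ _ _ h] _] := qdE pp2 B1.
  have [_ [k _ _ _] _] := qdE pp2 P2.
  rewrite -(rv_dart (is4PPT_simple pp2)); apply/negP=> /(deg3_adj pp2 g2 g k h).
  by rewrite !in_cons in_nil orbF (negbTE bx) (negbTE bq) eq_sym (negbTE ob).
have pp3 := moves_pp M3.
have [||| T4 [M4 /andP[t4 P4] /and3P[D1 D3 DR]]] := @qstep1 T3 [:: (p, x, a, o), endq r p & R] 4 q p o b p pp3 _ _ _ isT.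
- by apply/andP.
- by apply/and3P.
- by rewrite /= !in_cons ea !negb_or eq_sym pq [q == _]eq_sym rq.
have pp4 := moves_pp M4.
have [|||| T5 [M5 /andP[t5 P5] /and3P[E1 E3 ER]]] := @qstep T4 [:: (q, o, b, p), endq r p & R] 4 3 p x a o q pp4 _ _ _ isT isT.
- by apply/andP; split; [apply: (tri_rot pp4 (tri_rot pp4 t4)) | exact: D1].
- by apply/and3P.
- by rewrite /= !in_cons ea !negb_or pq [p == _]eq_sym rp.
- have [[_ _ g2] [_ _ g] _] := triE pp4 t4; have [_ [_ _ _ h] _] := qdE pp4 P4.
  by apply/negP=> /(deg2_adj pp4 g2 g h)[] E; [rewrite E eqxx in oa | rewrite E eqxx in ap].
have pp5 := moves_pp M5.
have [||| T6 [M6 /andP[t6 P6] /and3P[F1 F3 FR]]] := @qstep4 T5 [:: (p, x, a, q), endq r p & R] 1 q a o b p pp5 _ _ _ isT.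
- by apply/andP; split; [apply: (tri_rot pp5 (tri_rot pp5 t5)) | exact: E1].
- by apply/and3P.
- by rewrite /= !in_cons ea !negb_or eq_sym pq [q == _]eq_sym rq.
have pp6 := moves_pp M6.
have [|||| T7 [M7 /andP[t7 P7] /and3P[G1 G3 GR]]] := @qstep T6 [:: (q, a, o, b), endq r p & R] 4 2 p x a q b pp6 _ _ _ isT isT.
- by apply/andP; split; [apply: (tri_rot pp6 (tri_rot pp6 t6)) | exact: F1].
- by apply/and3P.
- by rewrite /= !in_cons ea !negb_or pq [p == _]eq_sym rp.
- have [[_ g2 _] [_ g _] _] := triE pp6 t6; have [_ [_ _ _ h] _] := qdE pp6 P6.
  have [_ [_ _ k _] _] := qdE pp6 F1.
  apply/negP=> /(deg3_adj pp6 g2 g h k).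
  by rewrite !in_cons in_nil orbF (negbTE xp) [x == b]eq_sym (negbTE bx) [x == a]eq_sym (negbTE ax).
have pp7 := moves_pp M7; exists T7; split.
- do 6![apply: moves_step; first by eassumption]; exact: M7.
- exact: (tri_rot pp7 t7).
by apply/and4P.
Qed.

Fixpoint stk (c : 'I_n) L : seq quad := if L is w :: L' then (w, a, c, b) :: stk w L' else [::].
Fixpoint fanl (p : 'I_n) L : seq quad := if L is q :: L' then (q, x, p, b) :: fanl q L' else [:: (x, p, b, a)].

Lemma stacked_stk T c L : stacked T a b c L = all (qdf T) (stk c L).
Proof. by elim: L c => //= w L IH c; rewrite IH. Qed.

Lemma apex_stk c L : map apex (stk c L) = L.
Proof. by elim: L c => //= w L IH c; rewrite IH. Qed.

Lemma apex_fanl p L : map apex (fanl p L) = rcons L x.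
Proof. by elim: L p => //= w L IH p; rewrite IH. Qed.

Lemma stk_rcons c L w : stk c (rcons L w) = rcons (stk c L) (w, a, last c L, b).
Proof. by elim: L c => //= v L IH c; rewrite IH. Qed.

(* The first vertices A of the stack are in place; x carries the others. *)
Definition zipper T c A B : bool := tri T a (last c A) x && all (qdf T) (stk c A ++ fanl (last c A) B).

Lemma fanl_endq B : exists r R, (forall y, fanl y B = endq r y :: R) /\
  (odflt x r) :: map apex R = rcons B x.
Proof.
case: B => [|r B]; first by exists None, [::].
by exists (Some r), (fanl r B); split=> //=; rewrite apex_fanl.
Qed.

Definition zok (c : 'I_n) S : Prop :=
  [/\ uniq [:: a; b; x], uniq S & {in c :: S, forall v, v \notin [:: a; b; x]}].

Lemma zip_swap T c A p q B : is4PPT T -> zok c (rcons A p ++ q :: B) ->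
  zipper T c (rcons A p) (q :: B) ->
  exists T', moves (outer T) 7 T T' /\ zipper T' c (rcons A q) (p :: B).
Proof.
move=> ppT; rewrite cat_rcons => -[U0 U ne] /andP[]; rewrite last_rcons stk_rcons cat_rcons /=.
have [r [R [ER aR]]] := fanl_endq B; rewrite ER => t.
rewrite all_cat => /andP[h1 /and4P[h2 h3 h4 h5]].
have xN : x \notin A ++ [:: p, q & B].
  by apply/negP=> H; have := ne x; rewrite in_cons H orbT !in_cons eqxx !orbT => /(_ isT).
have U1 : uniq (A ++ [:: p, q, odflt x r & map apex R]).
  have : uniq (x :: A ++ [:: p, q & B]) by rewrite cons_uniq xN.
  rewrite aR; congr is_true; apply: perm_uniq; apply/seq.permP => P.
  rewrite /= !count_cat /= -cats1 count_cat /= addn0; clear; lia.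
move: U1; rewrite cat_uniq => /and3P[_ /hasPn HA]; rewrite /= !in_cons !negb_or.
case/and4P=> /and3P[pq pr pS] /andP[qr qS] rS _.
have pA : p \notin A by apply: HA; rewrite !in_cons eqxx.
have qA : q \notin A by apply: HA; rewrite !in_cons eqxx orbT.
have rA : odflt x r \notin A by apply: HA; rewrite !in_cons eqxx !orbT.
have np : p \notin [:: a; b; x] by apply: ne; rewrite in_cons mem_cat !in_cons eqxx !orbT.
have nq : q \notin [:: a; b; x] by apply: ne; rewrite in_cons mem_cat !in_cons eqxx !orbT.
have no : last c A \notin [:: a; b; x].
  by apply: ne; have := mem_last c A; rewrite !in_cons mem_cat => /orP[->//|->]; rewrite orbT.
have [|||||T' [M t' /and4P[k1 k2 k3 k4]]] := @swap_local T (stk c A ++ R) (last c A) p q r ppT _ _ _ _ t.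
- rewrite -[[:: a; b; x; p; q]]/([:: a; b; x] ++ [:: p; q]) cat_uniq U0 /=.
  by rewrite mem_seq1 pq (negbTE np) (negbTE nq).
- by move: no; rewrite !in_cons !in_nil !orbF !negb_or => /and3P[-> -> _].
- by rewrite !in_cons in_nil orbF negb_or ![odflt _ _ == _]eq_sym pr qr.
- by rewrite map_cat apex_stk !mem_cat !negb_or pA qA rA pS qS rS.
- by rewrite !qdsE h2 h3 h4 all_cat h1; exact: h5.
exists T'; split=> //; rewrite /zipper last_rcons t' stk_rcons cat_rcons all_cat /=.
move: (k4 : all (qdf T') (stk c A ++ R)); rewrite all_cat => /andP[-> k5].
by rewrite ER qdsE k1 k2 k3.
Qed.

Lemma zok_apex c A q B : zok c (rcons A q ++ B) -> q \notin map apex (stk c A ++ fanl q B).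
Proof.
rewrite cat_rcons => -[_ U ne]; rewrite map_cat apex_stk apex_fanl.
have : q \notin [:: a; b; x] by apply: ne; rewrite in_cons mem_cat !in_cons eqxx !orbT.
move: U; rewrite cat_uniq => /and3P[_ /hasPn nA /andP[nB _]].
rewrite !in_cons in_nil orbF !negb_or => /and3P[_ _ qx].
by rewrite mem_cat mem_rcons in_cons !negb_or nB qx (nA q (mem_head _ _)).
Qed.

Lemma zip_up T c A q B : is4PPT T -> zok c (rcons A q ++ B) ->
  (b, c) \in darts T -> phi T (b, c) = (c, a) ->
  zipper T c (rcons A q) B -> exists T', moves (outer T) 1 T T' /\ zipper T' c A (q :: B).
Proof.
move=> ppT U bc Ebc /andP[]; rewrite last_rcons stk_rcons cat_rcons => t.
rewrite all_cat => /andP[h1 /= /andP[h2 h3]]; set p := last c A in h2 *.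
have [D E] : (b, p) \in darts T /\ phi T (b, p) = (p, a).
  rewrite /p; case/lastP: A h1 {U h2 p} => [|A w] //; rewrite last_rcons stk_rcons all_rcons => /andP[Q _].
  by have [[_ _ _ D] [_ _ _ E] _] := qdE ppT Q.
(* With the higher vertices carried by [x], the vertex [p] has only the neighbours [a] and [b]. *)
have N : (x, p) \notin darts T.
  have [_ [_ E2 _ _] _] := qdE ppT h2; case: U => /= /and3P[]; rewrite !in_cons !in_nil !orbF negb_or.
  case/andP=> _ ax bx _ _ _.
  by apply/negP=> /(deg2_adj ppT D E E2)[] E3; [rewrite E3 eqxx in bx | rewrite E3 eqxx in ax].
have [||T' [M /andP[t' Q'] hR]] := @qstep T (stk c A ++ fanl q B) 1 2 q x a p b ppT _ _ (zok_apex U) isT isT N.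
- by rewrite /= (tri_rot ppT t).
- by rewrite all_cat h1.
exists T'; split=> //; rewrite /zipper -/p (tri_rot (moves_pp M) t') /=.
by move: hR; rewrite !all_cat => /andP[-> k5] /=; apply/andP.
Qed.

Lemma zip_down T c A q B : is4PPT T -> zok c (rcons A q ++ B) ->
  zipper T c A (q :: B) -> exists T', moves (outer T) 1 T T' /\ zipper T' c (rcons A q) B.
Proof.
move=> ppT U /andP[t]; rewrite all_cat => /andP[h1 /= /andP[h2 h3]].
have [||T' [M /andP[t' Q'] hR]] := @qstep1 T (stk c A ++ fanl q B) 2 q x a (last c A) b ppT _ _ (zok_apex U) isT.
- by rewrite /= (tri_rot ppT (tri_rot ppT t)).
- by rewrite all_cat h1.
exists T'; split=> //; have pp' := moves_pp M.
rewrite /zipper last_rcons stk_rcons cat_rcons (tri_rot pp' (tri_rot pp' t')) /=.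
by move: hR; rewrite !all_cat => /andP[-> k5] /=; apply/andP.
Qed.

End Sort.

(** * Selection sort of the stack *)

Section Sorting.
Variable n : nat.
Notation dart := ('I_n * 'I_n)%type.
Implicit Types (T : cemb n) (A B C L : seq 'I_n).
Variables a b c : 'I_n.

Definition base T : Prop := (b, c) \in outer T /\ phi T (b, c) = (c, a).

Lemma base_dart T : is4PPT T -> base T -> (b, c) \in darts T.
Proof. by move=> ppT [/(outer_reflex ppT)/(reflex_dart ppT)]. Qed.

Lemma base_moves T T' k : moves (outer T) k T T' -> base T -> base T'.
Proof.
move=> M [h1 h2]; split; first by rewrite (outer_moves M).
by have [_ S] := moves_same M; have [_ -> _] := S _ h1.
Qed.

Lemma moves_cat T T' T'' j k : moves (outer T) j T T' -> moves (outer T') k T' T'' ->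
  moves (outer T) (j + k) T T''.
Proof. by move=> M; rewrite (outer_moves M); apply: moves_trans. Qed.

Section Passenger.
Variable x : 'I_n.
Notation zipper := (zipper a b x).
Notation zok := (zok a b x).

Lemma zok_perm A B : perm_eq A B -> zok c A -> zok c B.
Proof.
move=> p [h1 h2 h3]; split=> //; first by rewrite -(perm_uniq p).
by move=> v; rewrite in_cons -(perm_mem p) -in_cons; apply: h3.
Qed.

(** Each vertex that [w] passes costs nine flips: one to lay it down, one to pick [w] up again from
    the place above it, and seven to exchange the two. *)
Lemma zip_bring w B : forall A T, w \in B -> is4PPT T -> base T -> zok c (A ++ B) -> zipper T c A B ->
  exists T' B', [/\ moves (outer T) (9 * size B) T T', zipper T' c (rcons A w) B' & perm_eq B (w :: B')].
Proof.
elim: B => // q B IH A T wB ppT bT ok z.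
have ok1 : zok c (rcons A q ++ B) by rewrite cat_rcons.
have [T1 [M1 z1]] := zip_down ppT ok1 z.
have [E|wq] := eqVneq w q.
  subst w; exists T1, B; split=> //; apply: moves_leq M1; rewrite muln_gt0 //.
have wB' : w \in B by move: wB; rewrite in_cons (negbTE wq).
have [T2 [B2 [M2 z2 p2]]] := IH (rcons A q) T1 wB' (moves_pp M1) (base_moves M1 bT) ok1 z1.
have bT2 := base_moves M2 (base_moves M1 bT); have pp2 := moves_pp M2.
have ok2 : zok c (rcons (rcons A q) w ++ B2).
  by apply: zok_perm ok1; rewrite [rcons (rcons _ _) _ ++ _]cat_rcons perm_cat2l.
have [T3 [M3 z3]] := zip_up pp2 ok2 (base_dart pp2 bT2) bT2.2 z2.
have pp3 := moves_pp M3; rewrite [rcons (rcons _ _) _ ++ _]cat_rcons in ok2.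
have [T4 [M4 z4]] := zip_swap pp3 ok2 z3.
exists T4, (q :: B2); split=> //.
  apply: moves_leq (moves_cat M1 (moves_cat M2 (moves_cat M3 M4))).
  by rewrite [size (q :: B)]/= mulnS; move: (size B) => k; clear; lia.
by rewrite (perm_trans (y := q :: w :: B2)) // ?perm_cons //; apply/seq.permP => P; rewrite /= addnCA.
Qed.

Lemma zip_sort C : forall A B T, perm_eq B C -> is4PPT T -> base T -> zok c (A ++ B) -> zipper T c A B ->
  exists T', moves (outer T) (9 * size B ^ 2) T T' /\ zipper T' c (A ++ C) [::].
Proof.
elim: C => [|w C IH] A B T p ppT bT ok z.
  have B0 : B = [::] by apply: perm_small_eq p.
  subst B; exists T; rewrite cats0; split=> //; apply: moves0 => //.
  by apply/subsetP=> d /(outer_reflex ppT)/(reflex_dart ppT).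
have wB : w \in B by rewrite (perm_mem p) mem_head.
have [T1 [B1 [M1 z1 p1]]] := zip_bring wB ppT bT ok z.
have pB : perm_eq B1 C by rewrite -(perm_cons w) -(permPl p1).
have ok1 : zok c (rcons A w ++ B1).
  by apply: zok_perm ok; rewrite cat_rcons perm_cat2l.
have [T2 [M2 z2]] := IH _ _ _ pB (moves_pp M1) (base_moves M1 bT) ok1 z1.
exists T2; rewrite -cat_rcons; split=> //; apply: moves_leq (moves_cat M1 M2).
rewrite (perm_size p1) /=; clear; move: (size B1) => k; rewrite -mulnDr leq_mul2l /=; lia.
Qed.

Lemma zip_rewind A : forall B T, is4PPT T -> base T -> zok c (A ++ B) -> zipper T c A B ->
  exists T', moves (outer T) (size A) T T' /\ zipper T' c [::] (A ++ B).
Proof.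
elim/last_ind: A => [|A q IH] B T ppT bT ok z.
  exists T; split=> //; apply: moves0 => //.
  by apply/subsetP=> d /(outer_reflex ppT)/(reflex_dart ppT).
have [T1 [M1 z1]] := zip_up ppT ok (base_dart ppT bT) bT.2 z.
have ok1 : zok c (A ++ q :: B) by rewrite -cat_rcons.
have [T2 [M2 z2]] := IH _ _ (moves_pp M1) (base_moves M1 bT) ok1 z1.
exists T2; rewrite cat_rcons size_rcons; split=> //; rewrite -add1n.
exact: moves_cat M1 M2.
Qed.

Lemma zip_start A T : is4PPT T -> zok c A -> stacked T a b c (rcons A x) -> tri T a x b ->
  exists T', moves (outer T) 1 T T' /\ zipper T' c A [::].
Proof.
move=> ppT [_ _ ok]; rewrite (stacked_stk) stk_rcons all_rcons => /andP[Q S] t.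
have [||T' [M /andP[t' Q'] S']] := @qstep1 n T (stk a b c A) 4 x a (last c A) b a ppT _ S _ isT.
- by apply/andP; split=> //; apply: (tri_rot ppT (tri_rot ppT t)).
- rewrite apex_stk; apply/negP=> xA; have := ok x; rewrite in_cons xA orbT => /(_ isT).
  by rewrite !in_cons eqxx !orbT.
exists T'; split=> //; have pp' := moves_pp M.
by rewrite /zipper (tri_rot pp' t') all_cat S' /=; apply/andP.
Qed.

Lemma zip_end A T : is4PPT T -> zok c A -> zipper T c A [::] ->
  exists T', [/\ moves (outer T) 1 T T', stacked T' a b c (rcons A x) & tri T' a x b].
Proof.
move=> ppT [_ _ ok] /andP[t]; rewrite all_cat => /andP[S /andP[Q _]].
have [||T' [M /andP[t' Q'] S']] := @qstep4 n T (stk a b c A) 1 x a (last c A) b a ppT _ S _ isT.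
- by apply/andP; split=> //; apply: (tri_rot ppT (tri_rot ppT t)).
- rewrite apex_stk; apply/negP=> xA; have := ok x; rewrite in_cons xA orbT => /(_ isT).
  by rewrite !in_cons eqxx !orbT.
exists T'; split=> //; last by apply: (tri_rot (moves_pp M) t').
by rewrite stacked_stk stk_rcons all_rcons S' andbT.
Qed.

End Passenger.

Definition lok L : Prop := [/\ a != b, uniq (c :: L) & {in c :: L, forall v, v \notin [:: a; b]}].

Lemma lok_perm L L' : perm_eq L L' -> lok L -> lok L'.
Proof.
move=> p [h1 h2 h3]; split=> //; first by rewrite -(perm_uniq (s1 := c :: L)) ?perm_cons.
by move=> v; rewrite in_cons -(perm_mem p) -in_cons; apply: h3.
Qed.

Lemma lok_zok A x : lok (rcons A x) -> zok a b x c A.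
Proof.
case=> ab; rewrite -rcons_cons rcons_uniq => /andP[xA uA] H.
have Hx : x \notin [:: a; b] by apply: H; rewrite mem_rcons mem_head.
split.
- move: Hx; rewrite /= !in_cons !in_nil !orbF !negb_or => /andP[xa xb].
  by rewrite ab eq_sym xa eq_sym xb.
- by case/andP: uA.
move=> v vA; have := H v; rewrite mem_rcons in_cons vA orbT => /(_ isT).
rewrite !in_cons !in_nil !orbF !negb_or => /andP[-> ->] /=.
by apply: contraNneq xA => <-.
Qed.

(** The top [x] picks up all of [A], lays it down in the new order and is on top again at the end:
    [size A] flips for the first, nine times its square for the second, two to start and stop. *)
Lemma reorder A A2 x T : is4PPT T -> base T -> lok (rcons A x) -> perm_eq A A2 ->
  stacked T a b c (rcons A x) -> tri T a x b ->
  exists T', [/\ moves (outer T) (9 * size A ^ 2 + size A + 2) T T', stacked T' a b c (rcons A2 x) & tri T' a x b].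
Proof.
move=> ppT bT ok p S t; have zk := lok_zok ok.
have [T1 [M1 z1]] := zip_start ppT zk S t.
have b1 := base_moves M1 bT.
have zk1 : zok a b x c (A ++ [::]) by rewrite cats0.
have [T2 [M2 z2]] := zip_rewind (moves_pp M1) b1 zk1 z1; rewrite cats0 in z2.
have [T3 [M3 z3]] := zip_sort (A := [::]) p (moves_pp M2) (base_moves M2 b1) zk z2.
have [T4 [M4 S4 t4]] := zip_end (moves_pp M3) (zok_perm p zk) z3.
exists T4; split=> //.
apply: moves_leq (moves_cat M1 (moves_cat M2 (moves_cat M3 M4))).
by move: (size A) (9 * _ ^ 2) => i j; clear; lia.
Qed.

(** The top carries the others, so [reorder] cannot move it and the two highest vertices are
    exchanged directly. Every cut used here ends at the reflex vertex, hence none is blocked. *)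
Lemma top_swap A p q T : is4PPT T -> lok (rcons (rcons A p) q) -> stacked T a b c (rcons (rcons A p) q) ->
  tri T a q b ->
  exists T', [/\ moves (outer T) 6 T T', stacked T' a b c (rcons (rcons A q) p) & tri T' a p b].
Proof.
move=> ppT [_ U _]; rewrite stacked_stk !stk_rcons !last_rcons !all_rcons => /and3P[Q2 Q1 R0] t0.
move: U; rewrite cons_uniq => /andP[_]; rewrite !rcons_uniq mem_rcons in_cons negb_or => /and3P[/andP[qp qA] pA _].
rewrite -(apex_stk a b c A) in qA pA; set R := stk a b c A in qA pA R0 *; set o := last c A in Q1 *.
have [||| T1 [M1 /andP[t1 P1] /andP[A1 R1]]] := @qstep4 n T ((p, a, o, b) :: R) 1 q b a p b ppT _ _ _ isT.
- by apply/andP; split=> //; apply: (tri_rot ppT t0).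
- by apply/andP.
- by rewrite /= in_cons negb_or qp.
have pp1 := moves_pp M1.
have [||| T2 [M2 /andP[t2 P2] /andP[A2 R2]]] := @qstep1 n T1 ((q, b, a, p) :: R) 4 p a o b q pp1 _ _ _ isT.
- by apply/andP; split=> //; apply: (tri_rot pp1 t1).
- by apply/andP.
- by rewrite /= in_cons negb_or eq_sym qp.
have pp2 := moves_pp M2.
have [||| T3 [M3 /andP[t3 P3] /andP[A3 R3]]] := @qstep1 n T2 ((p, o, b, q) :: R) 3 q b a o p pp2 _ _ _ isT.
- by apply/andP; split=> //; apply: (tri_rot pp2 t2).
- by apply/andP.
- by rewrite /= in_cons negb_or qp.
have pp3 := moves_pp M3.
have [||| T4 [M4 /andP[t4 P4] /andP[A4 R4]]] := @qstep1 n T3 ((q, a, o, p) :: R) 3 p o b a q pp3 _ _ _ isT.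
- by apply/andP; split=> //; apply: (tri_rot pp3 t3).
- by apply/andP.
- by rewrite /= in_cons negb_or eq_sym qp.
have pp4 := moves_pp M4.
have [||| T5 [M5 /andP[t5 P5] /andP[A5 R5]]] := @qstep4 n T4 ((p, b, a, q) :: R) 3 q a o b p pp4 _ _ _ isT.
- by apply/andP; split=> //; apply: (tri_rot pp4 t4).
- by apply/andP.
- by rewrite /= in_cons negb_or qp.
have pp5 := moves_pp M5.
have [||| T6 [M6 /andP[t6 P6] /andP[A6 R6]]] := @qstep1 n T5 ((q, a, o, b) :: R) 4 p b a q b pp5 _ _ _ isT.
- by apply/andP; split=> //; apply: (tri_rot pp5 (tri_rot pp5 t5)).
- by apply/andP.
- by rewrite /= in_cons negb_or eq_sym qp.
exists T6; split.
- do 5![apply: moves_step; first by eassumption]; exact: M6.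
- by rewrite stacked_stk !stk_rcons !last_rcons !all_rcons; apply/and3P.
- exact: (tri_rot (moves_pp M6) (tri_rot (moves_pp M6) t6)).
Qed.

(** If the top has to change, the vertex meant for it is brought to the place just below, exchanged
    with the top, and the rest is sorted again: two reorderings and six flips. *)
Lemma restack L L2 T : is4PPT T -> base T -> lok L -> perm_eq L L2 -> stacked T a b c L ->
  tri T a (last c L) b ->
  exists T', moves (outer T) (18 * size L ^ 2 + 2 * size L + 10) T T' /\ stacked T' a b c L2.
Proof.
move=> ppT bT ok p S t; have sz := perm_size p.
case/lastP: L ok p S t sz => [|A x] ok p S t sz.
  have -> : L2 = [::] by apply/size0nil; rewrite -sz.
  exists T; split=> //; apply: moves0 => //.
  by apply/subsetP=> d /(outer_reflex ppT)/(reflex_dart ppT).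
case/lastP: L2 p sz => [|A2 x2] p sz; first by rewrite size_rcons in sz.
rewrite last_rcons in t; rewrite size_rcons; move: sz; rewrite !size_rcons => -[sz].
have [E|ne] := eqVneq x2 x.
  have pA : perm_eq A A2 by move: p; rewrite E -!cats1 perm_cat2r.
  have [T1 [M1 S1 _]] := reorder ppT bT ok pA S t.
  exists T1; rewrite E; split=> //; apply: moves_leq M1; move: (size A) => k; clear; lia.
have x2A : x2 \in A.
  have : x2 \in rcons A x by rewrite (perm_mem p) mem_rcons mem_head.
  by rewrite mem_rcons in_cons (negbTE ne).
have pA : perm_eq A (rcons (rem x2 A) x2) by rewrite perm_sym perm_rcons perm_sym perm_to_rem.
have [T1 [M1 S1 t1]] := reorder ppT bT ok pA S t.
have b1 := base_moves M1 bT; have pp1 := moves_pp M1.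
have pq y z (X : seq 'I_n) : perm_eq (rcons (rcons X y) z) (rcons (rcons X z) y).
  by apply/seq.permP => P; rewrite -!cats1 !count_cat /= addnAC.
have ok1 : lok (rcons (rcons (rem x2 A) x2) x).
  by apply: lok_perm ok; rewrite -!cats1 perm_cat2r cats1.
have [T2 [M2 S2 t2]] := top_swap pp1 ok1 S1 t1.
have ok2 := lok_perm (pq x2 x _) ok1.
have pA2 : perm_eq (rcons (rem x2 A) x) A2.
  rewrite -(perm_cat2r [:: x2]) !cats1; apply: perm_trans (pq _ _ _) _.
  by apply: perm_trans p; rewrite -!cats1 perm_cat2r cats1 perm_sym.
have [T3 [M3 S3 _]] := reorder (moves_pp M2) (base_moves M2 b1) ok2 pA2 S2 t2.
exists T3; split=> //; apply: moves_leq (moves_cat M1 (moves_cat M2 M3)).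
have -> : size (rcons (rem x2 A) x) = size A by rewrite (perm_size pA2) sz.
by move: (size A) => k; clear; lia.
Qed.

End Sorting.

(** * The flip graphs *)

Section Labeled.
Variable n : nat.
Notation dart := ('I_n * 'I_n)%type.
Implicit Types (T : cemb n) (X : {set dart}) (L : seq 'I_n).

Lemma flip_pp T T' : flip T T' -> is4PPT T'.
Proof. by case=> a [b [a' [b' [_ _ _ _ [_ _ _ _ [_ _ H]]]]]]. Qed.

Lemma del_dartsC T (a b : 'I_n) : del_darts T a b = del_darts T b a.
Proof. by apply/setP=> d; rewrite !inE andbCA. Qed.

Lemma del_rotC T (a b : 'I_n) : del_rot T a b = del_rot T b a.
Proof. by apply/ffunP=> d; rewrite !ffunE del_dartsC; case: ifP => // _; cbv zeta; rewrite orbC. Qed.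

(** [flip] names the triangle along one orientation of the removed edge but allows the new triangle
    on either side of the new edge, so the reverse flip is read along whichever orientation bounds a
    triangle. *)
Lemma flip_sym T T' : is4PPT T -> flip T T' -> flip T' T.
Proof.
move=> ppT [a [b [a' [b' [abD [iF c3] bO [N n0] [dE rE fE cE [oE tE ppT']]]]]]].
have sT := is4PPT_simple ppT; have sT' := is4PPT_simple ppT'.
set R := _ :\ (b, a) in fE tE.
have RE : R = (face T (a, b) :|: face T (b, a)) :\ (a, b) :\ (b, a) by [].
clearbody R.
have N' : (b', a') \notin darts T by rewrite -(rv_dart sT).
have baD : (b, a) \in darts T by rewrite -(rv_dart sT).
have rT := is4PPT_rot ppT.
have fD d : d \in face T (a, b) :|: face T (b, a) -> d \in darts T.
  by rewrite in_setU => /orP[] /(face_dart sT rT) ->.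
have RD d : d \in R -> d \in darts T by rewrite RE !in_setD1 => /and3P[_ _ /fD].
have NR : (a', b') \notin R /\ (b', a') \notin R by split; [apply: contra N => /RD | apply: contra N' => /RD].
have abE : ((a, b) == (a', b')) = false /\ ((a, b) == (b', a')) = false.
  by split; apply/negbTE/eqP=> E; [move: N | move: N']; rewrite -E abD.
have baE : ((b, a) == (a', b')) = false /\ ((b, a) == (b', a')) = false.
  by split; apply/negbTE/eqP=> E; [move: N | move: N']; rewrite -E baD.
have main x y : (x, y) \in [:: (a', b'); (b', a')] ->
    #|face T' (x, y)| = 3 -> #|face T' (y, x)| = #|face T (b, a)| -> flip T' T.
  move=> xy x3 y4.
  have E' : [set (x, y); (y, x)] = [set (a', b'); (b', a')].
    by move: xy; rewrite !in_cons in_nil orbF => /orP[]/eqP[-> ->] //; apply: setUC.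
  have fE' : face T' (x, y) :|: face T' (y, x) = R :|: [set (x, y); (y, x)].
    by rewrite E' -fE; move: xy; rewrite !in_cons in_nil orbF => /orP[]/eqP[-> ->] //; apply: setUC.
  have [xN yN xR yR xD] : [/\ (x, y) \notin darts T, (y, x) \notin darts T, (x, y) \notin R, (y, x) \notin R
      & (x, y) \in darts T'].
    move: xy; rewrite !in_cons in_nil orbF dE !in_setU !in_set1 => /orP[]/eqP[-> ->];
    by case: NR => -> ->; rewrite N N' eqxx ?orbT.
  have rE' : del_rot T' x y = del_rot T a b.
    by rewrite rE; move: xy; rewrite !in_cons in_nil orbF => /orP[]/eqP[-> ->] //; apply: del_rotC.
  have oN d : d \notin darts T -> face T' d != outer T'.
    apply: contraNneq => E; apply: (reflex_dart ppT); apply: (outer_reflex ppT).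
    by rewrite -oE -E mem_face.
  have R' : (face T' (x, y) :|: face T' (y, x)) :\ (x, y) :\ (y, x) = R.
    rewrite fE'; apply/setP=> d; rewrite !in_setD1 in_setU in_set2.
    have [->|_] := eqVneq d (y, x); first by rewrite (negbTE yR).
    have [->|_] := eqVneq d (x, y); first by rewrite (negbTE xR).
    by rewrite /= orbF.
  have R2 : R :|: [set (a, b); (b, a)] = face T (a, b) :|: face T (b, a).
    apply/setP=> d; rewrite RE in_setU in_set2 !in_setD1.
    have [->|_] := eqVneq d (b, a); first by rewrite !in_setU mem_face !orbT.
    have [->|_] := eqVneq d (a, b); first by rewrite !in_setU mem_face !orbT.
    by rewrite /= orbF.
  exists x, y, a, b; rewrite /= R' R2; split=> //.
  - by split=> //; split; [apply: face_faces | apply: oN].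
  - exact: oN.
  - split; last exact: (dart_neq sT abD).
    by rewrite dE !in_setU !in_set1 abE.1 abE.2 !in_setD1 eqxx andbF.
  split=> //.
  - apply/setP=> d; rewrite in_setU in_set2 !in_setD1 dE in_setU -E' in_set2 !in_setD1.
    have [->|_] := eqVneq d (y, x).
      rewrite (negbTE yN) /=; apply/esym/negbTE; apply: contra yN.
      by case/orP=> /eqP->.
    have [->|_] := eqVneq d (x, y).
      rewrite (negbTE xN) /=; apply/esym/negbTE; apply: contra xN.
      by case/orP=> /eqP->.
    have [->|_] := eqVneq d (b, a); first by rewrite baD !orbT.
    have [->|_] := eqVneq d (a, b); first by rewrite abD.
    by case: (d \in darts T).
  - by rewrite c3 y4 !eqxx.
  split=> // d d1 d2 d3; apply/esym; apply: tE => //; by rewrite -E'.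
case/orP: cE => /andP[/eqP h1 /eqP h2]; first exact: (main a' b' (mem_head _ _) h1 h2).
by apply: (main b' a' _ h1 h2); rewrite !in_cons eqxx orbT.
Qed.

Lemma flips_rcons k T T' T'' : flips k T T' -> flip T' T'' -> flips k.+1 T T''.
Proof.
move=> F f; have := flips_cat F (@flipsS _ 0 T' T'' T'' f (flips0 T'')).
by rewrite addn1.
Qed.

Lemma flips_sym k T T' : is4PPT T -> flips k T T' -> flips k T' T.
Proof.
move=> ppT F; move: ppT; elim: F => {k T T'} [T _|k T T1 T2 f _ IH ppT]; first by constructor.
exact: flips_rcons (IH (flip_pp f)) (flip_sym ppT f).
Qed.

(** The set of outer darts already fixes their cyclic order: an outer vertex has a single reflex
    angle, so it is the head of one outer dart only, and the predecessor of any outer dart is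
    determined. *)
Lemma outer_same T1 T2 : is4PPT T1 -> is4PPT T2 -> outer T1 = outer T2 -> same (outer T1) T1 T2.
Proof.
move=> pp1 pp2 oE; split=> //.
have rfl T : is4PPT T -> {subset outer T <= reflex T} by move=> ppT d; apply: outer_reflex.
have oD T : is4PPT T -> outer T \subset darts T by move=> ppT; apply/subsetP=> d /(rfl T ppT)/(reflex_dart ppT).
have oC T : is4PPT T -> phi_closed T (outer T).
  move=> ppT d _; have [d0 d0D ->] := facesP _ _ (outer_face ppT).
  by rewrite (phi_face (is4PPT_simple ppT) (is4PPT_rot ppT)).
case=> u v dO; have dO2 : (u, v) \in outer T2 by rewrite -oE.
split; first exact: (subsetP (oD _ pp2)).
  have E2 : phi T2 (u, v) = (v, (phi T2 (u, v)).2) by [].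
  have : phi T2 (u, v) \in outer T1 by rewrite oE (oC _ pp2) // (subsetP (oD _ pp2)).
  rewrite E2 => /(phi_closed_tail pp1 (oD _ pp1) (oC _ pp1))[t tO <-].
  by congr (phi T1 (_, _)); apply: (reflex_uniq pp1 (v := v)); apply: rfl.
by rewrite (rfl _ pp1 _ dO) (rfl _ pp2 _ dO2).
Qed.

Lemma stacked_same T1 T2 (a b : 'I_n) L : forall X (c : 'I_n), is4PPT T1 -> is4PPT T2 -> same X T1 T2 ->
  stacked T1 a b c L -> stacked T2 a b c L -> same (stack X a b c L) T1 T2.
Proof.
elim: L => //= w L IH X c pp1 pp2 S /andP[Q1 S1] /andP[Q2 S2]; apply: IH => //.
have [_ [h1 h2 h3 h4] [r1 r2 r3 r4]] := qdE pp1 Q1.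
have [[d1 d2 d3 d4] [k1 k2 k3 k4] [s1 s2 s3 s4]] := qdE pp2 Q2.
case: S => o S; split=> // d; rewrite in_setU => /orP[/S//|].
rewrite in_set !in_cons in_nil orbF => /or4P[]/eqP->; split=> //.
- by rewrite h1.
- by rewrite (negbTE r1) (negbTE s1).
- by rewrite h2.
- by rewrite (negbTE r2) (negbTE s2).
- by rewrite h3.
- by rewrite (negbTE r3) (negbTE s3).
- by rewrite h4.
- by rewrite r4 s4.
Qed.

Section Base.
Variables a b c : 'I_n.

Definition normal T O L : Prop :=
  [/\ stacked T a b c L, forall v, covers (stack O a b c L) v, tri T a (last c L) b
    & fanned T (stack O a b c L) a].

Lemma good_base T : is4PPT T -> 2 < #|outer T| -> base a b c T -> sgood T (outer T) a b c.
Proof. by move=> ppT h3 [h1 h2]; apply: sgood_outer. Qed.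

Lemma fan_stacked T L : is4PPT T -> 2 < #|outer T| -> base a b c T -> stacked T a b c L ->
  (forall v, covers (stack (outer T) a b c L) v) ->
  exists T', moves (outer T) n T T' /\ normal T' (outer T) L.
Proof.
move=> ppT h3 bT S cov; have G := sgood_stack (good_base ppT h3 bT) S.
have [|T' [M F]] := fan_all cov (m := n) G; first exact: leq_addr.
have [G' _] := sgood_moves G M; have ppT' := moves_pp M.
exists T'; split; first exact: moves_subset (stack_sub _ _ _ _ _) M.
split=> //; first exact: same_stacked ppT (moves_same M) S.
have acX := good_a_out G'; have caX := good_a_in G'.
have acD : (a, last c L) \in darts T'.
  by rewrite -(rv_dart (is4PPT_simple ppT')); apply: (subsetP (good_sub G')).
have [y [z [t]]] := F _ acD acX.
have /= := tri_uniq ppT' t; rewrite !inE !negb_or => /and3P[/andP[ay az] yz _].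
rewrite !xpair_eqE eqxx (negbTE ay) (negbTE az) /= orbF => /eqP E.
rewrite -E in t; have := fanned_in G' F t; move/(good_c G') => E'.
by rewrite E' in t.
Qed.

Lemma normalize T : is4PPT T -> 2 < #|outer T| -> base a b c T ->
  exists T' L, moves (outer T) (n * (4 * n + 3) + n) T T' /\ normal T' (outer T) L.
Proof.
move=> ppT h3 bT.
have [|T1 [L [M1 S1 cov]]] := stack_all (m := n) (good_base ppT h3 bT).
  by rewrite -[X in _ <= X]card_ord max_card.
have oE := outer_moves M1.
have [||T2 [M2 N2]] := fan_stacked (moves_pp M1) _ (base_moves M1 bT) S1; rewrite ?oE //.
exists T2, L; split; last by rewrite -oE.
exact: moves_cat M1 M2.
Qed.

Lemma normal_lok T L : is4PPT T -> 2 < #|outer T| -> base a b c T -> normal T (outer T) L ->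
  lok a b c L /\ forall v, (v \in L) = ~~ covers (outer T) v.
Proof.
move=> ppT h3 bT [S cov _ _]; have [G _] := good_base ppT h3 bT.
have [uL hL] := stacked_uniq G S; have [ca cb cc] := good_covers G.
have mL v : (v \in L) = ~~ covers (outer T) v.
  apply/idP/idP; first exact: hL.
  by have := cov v; rewrite (stack_covers _ G S) => /orP[->|].
split=> //; have bcD := base_dart ppT bT; have sT := is4PPT_simple ppT.
have caD : (c, a) \in darts T by rewrite -bT.2 (phi_dart sT (is4PPT_rot ppT)).
split; first exact: good_ab G.
  by rewrite cons_uniq uL mL cc.
move=> v; rewrite in_cons => /orP[/eqP->|].
  by rewrite !in_cons in_nil orbF negb_or (dart_neq sT caD) eq_sym (dart_neq sT bcD).
by rewrite mL; apply: contra; rewrite !in_cons in_nil orbF => /orP[]/eqP->.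
Qed.

End Base.

Lemma labeled_flips T1 T2 : is4PPT T1 -> is4PPT T2 -> 2 < #|outer T1| -> outer T1 = outer T2 ->
  exists k, k <= 47 * n ^ 2 /\ flips k T1 T2.
Proof.
move=> pp1 pp2 h3 oE.
have /card_gt0P[[b c] bc] : 0 < #|outer T1| by apply: leq_trans h3.
set a := (phi T1 (b, c)).2.
have b1 : base a b c T1 by [].
have [_ S0] := outer_same pp1 pp2 oE.
have b2 : base a b c T2 by split; [rewrite -oE | have [_ -> _] := S0 _ bc].
have h3' : 2 < #|outer T2| by rewrite -oE.
have [N1 [L1 [M1 F1]]] := normalize pp1 h3 b1.
have [N2 [L2 [M2 F2]]] := normalize pp2 h3' b2.
have [q1 q2] := (moves_pp M1, moves_pp M2); have [o1 o2] := (outer_moves M1, outer_moves M2).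
have [c1 c2] := (base_moves M1 b1, base_moves M2 b2).
have hN1 : 2 < #|outer N1| by rewrite o1.
have hN2 : 2 < #|outer N2| by rewrite o2.
rewrite -o1 in F1; rewrite -o2 in F2.
have [ok1 m1] := normal_lok q1 hN1 c1 F1; have [ok2 m2] := normal_lok q2 hN2 c2 F2.
have p : perm_eq L1 L2.
  apply: uniq_perm; [by case: ok1 => _ /andP[] | by case: ok2 => _ /andP[] |].
  by move=> v; rewrite m1 m2 o1 o2 oE.
have sz : size L1 <= n.
  by case: ok1 => _ /andP[_ /card_uniqP <-] _; rewrite -[X in _ <= X]card_ord max_card.
have [st1 _ t1 _] := F1.
have [N3 [M3 S3]] := restack q1 c1 ok1 p st1 t1.
have [st2 cov2 t2 f2] := F2.
have q3 := moves_pp M3; have o3 := outer_moves M3.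
have oE3 : outer N3 = outer N2 by rewrite o3 o1 o2.
have hN3 : 2 < #|outer N3| by rewrite oE3.
have [|N4 [M4 F4]] := fan_stacked q3 hN3 (base_moves M3 c1) S3; first by rewrite oE3.
have q4 := moves_pp M4; have o4 := outer_moves M4.
have E : N4 = N2.
  have oE4 : outer N4 = outer N2 by rewrite o4.
  have c4 := base_moves M4 (base_moves M3 c1); have hN4 : 2 < #|outer N4| by rewrite oE4.
  rewrite -o4 in F4; have [st4 cov4 t4 f4] := F4.
  have [G4 _] := sgood_stack (good_base q4 hN4 c4) st4.
  have [G2 _] := sgood_stack (good_base q2 hN2 c2) st2.
  have SS := stacked_same q4 q2 (outer_same q4 q2 oE4) st4 st2.
  by rewrite -oE4 in G2 f2; exact: (fanned_uniq cov4 G4 G2 SS f4 f2).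
rewrite E in M4.
have [j le_j [fl _ _]] := moves_cat M1 (moves_cat M3 M4).
have [i le_i [fl2 _ _]] := M2.
exists (j + i); split; last exact: flips_cat fl (flips_sym pp2 fl2).
have n0 : 0 < n by apply: leq_ltn_trans (ltn_ord a).
(* Two normalizations, one restacking and one fan: [2(4n^2 + 4n) + (18n^2 + 2n + 10) + n], at most
   [(26 + 11 + 10) n^2] for [n >= 1]. *)
move: le_j le_i sz n0; clear; move: (size L1) => k lj li kn n0; nia.
Qed.

End Labeled.

(** * Relabeling and the unlabeled flip graph *)

Section Relabel.
Variable n : nat.
Notation dart := ('I_n * 'I_n)%type.

Section One.
Variables (T : cemb n) (s : {perm 'I_n}).
Notation T' := (relabel s T).

Definition pdart (d : dart) : dart := (s d.1, s d.2).

Lemma pdart_inj : injective pdart.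
Proof. by case=> u v [u' v'] [/perm_inj-> /perm_inj->]. Qed.

Lemma pdart_ex d : exists e, d = pdart e.
Proof. by case: d => u v; exists ((s^-1)%g u, (s^-1)%g v); rewrite /pdart /= !permKV. Qed.

Lemma relabel_dart d : (pdart d \in darts T') = (d \in darts T).
Proof. exact: mem_imset pdart_inj. Qed.

Lemma relabel_reflex d : (pdart d \in reflex T') = (d \in reflex T).
Proof. exact: mem_imset pdart_inj. Qed.

Lemma relabel_rot u v : rot T' (s u, s v) = s (rot T (u, v)).
Proof. by rewrite ffunE /= !permK. Qed.

Lemma relabel_phi d : phi T' (pdart d) = pdart (phi T d).
Proof. by rewrite /phi /= relabel_rot. Qed.

Lemma relabel_iter k d : iter k (phi T') (pdart d) = pdart (iter k (phi T) d).
Proof. by elim: k => //= k ->; rewrite relabel_phi. Qed.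

Lemma relabel_face d : face T' (pdart d) = pdart @: face T d.
Proof.
apply/setP=> e; have [e' ->] := pdart_ex e; rewrite (mem_imset _ _ pdart_inj) !inE.
apply/idP/idP => /iter_findex.
  by rewrite relabel_iter => /pdart_inj <-; apply: fconnect_iter.
by move=> <-; rewrite -relabel_iter; apply: fconnect_iter.
Qed.

Lemma relabel_faces : faces T' = [set pdart @: (f : {set dart}) | f in faces T].
Proof.
apply/setP=> f; apply/imsetP/imsetP => [[d dD ->]|[g /imsetP[d dD ->] ->]].
  have [e E] := pdart_ex d; rewrite E relabel_dart in dD *.
  by exists (face T e); [apply: imset_f | apply: relabel_face].
by exists (pdart d); [rewrite relabel_dart | rewrite relabel_face].
Qed.

Lemma relabel_interior f : interior_face T' f -> exists2 g, interior_face T g & f = pdart @: g.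
Proof.
case; rewrite relabel_faces => /imsetP[g gF ->] N; exists g => //; split=> //.
by apply: contraNneq N => ->.
Qed.

Lemma relabel_4PPT : is4PPT T -> is4PPT T'.
Proof.
move=> [[[[[sym irr] [r1 [r2 [r3 r4]]] con pl [oF rD]] tri3 oR ref1] refl1] f34].
have pex u : exists v, u = s v by exists ((s^-1)%g u); rewrite permKV.
have pd u v : (s u, s v) \in darts T' = ((u, v) \in darts T) by apply: (relabel_dart (u, v)).
have nr v : nreflex_at T' (s v) = nreflex_at T v.
  rewrite /nreflex_at -[RHS](card_imset _ pdart_inj); apply: eq_card => d.
  have [e ->] := pdart_ex d; rewrite (mem_imset _ _ pdart_inj) !in_set relabel_reflex.
  by rewrite (inj_eq perm_inj).
have simple : simple_graph T'.
  split=> [u v|v].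
    by have [u' ->] := pex u; have [v' ->] := pex v; rewrite !pd; apply: sym.
  by have [v' ->] := pex v; rewrite pd.
have rotT : rotation_system T'.
  split=> [v u|]; last split=> [v u|]; last split=> v u w.
  - have [u' ->] := pex u; have [v' ->] := pex v; rewrite pd relabel_rot => /r1 ->.
    by [].
  - have [u' ->] := pex u; have [v' ->] := pex v; rewrite relabel_rot !pd; apply: r2.
  - have [u' ->] := pex u; have [v' ->] := pex v; have [w' ->] := pex w; rewrite !relabel_rot !pd.
    by move=> h1 h2 /perm_inj E; rewrite (r3 _ _ _ h1 h2 E).
  have [u' ->] := pex u; have [v' ->] := pex v; have [w' ->] := pex w; rewrite !pd => h1 h2.
  have [k <-] := r4 _ _ _ h1 h2; exists k; elim: k => //= k ->.
  by rewrite relabel_rot.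
have conT : connected_graph T'.
  move=> u v; have [u' ->] := pex u; have [v' ->] := pex v.
  have /connectP[p pp ->] := con u' v'; elim: p u' pp {v'} => //= w p IH u' /andP[uw pp].
  by apply: connect_trans (connect1 _) (IH _ pp); rewrite /adjv pd.
have cardI (A B : {set dart}) : #|[set d in pdart @: A | d \notin pdart @: B]| = #|[set d in A | d \notin B]|.
  rewrite -[RHS](card_imset _ pdart_inj); apply: eq_card => d.
  by have [e ->] := pdart_ex d; rewrite !(mem_imset _ _ pdart_inj) !in_set !(mem_imset _ _ pdart_inj).
split; last first.
  by move=> f /relabel_interior[g gF ->]; rewrite (card_imset _ pdart_inj); apply: f34.
split; last by move=> v; have [v' ->] := pex v; rewrite nr.
split.
- split=> //.
    rewrite /planar_embedding relabel_faces (card_imset _ (imset_inj pdart_inj)).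
    by rewrite [#|darts T'|](card_imset _ pdart_inj).
  by split; [rewrite relabel_faces; apply: imset_f | apply: imsetS].
- by move=> f /relabel_interior[g gF ->]; rewrite -(tri3 g gF); apply: cardI.
- exact: imsetS.
- by move=> v; have [v' ->] := pex v; rewrite nr.
Qed.

End One.

Lemma relabelK (s : {perm 'I_n}) (T : cemb n) : relabel s^-1 (relabel s T) = T.
Proof.
have K (A : {set dart}) : [set ((s^-1)%g d.1, (s^-1)%g d.2) | d in [set (s d.1, s d.2) | d in A]] = A.
  rewrite -imset_comp -[RHS]imset_id; apply: eq_imset => -[u v] /=.
  by rewrite !permK.
case: T => D r o f; rewrite /relabel /= !K; congr CEmb.
by apply/ffunP=> -[u v]; rewrite !ffunE /= invgK !permK.
Qed.

(** Both lists are prolonged to enumerations of all labels, which are then matched position by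
    position. *)
Lemma perm_map_ex (l1 l2 : seq 'I_n) : uniq l1 -> uniq l2 -> size l1 = size l2 ->
  exists s : {perm 'I_n}, map s l1 = l2.
Proof.
pose ext (l : seq 'I_n) := l ++ [seq v <- enum 'I_n | v \notin l].
have ue l : uniq l -> uniq (ext l).
  move=> u; rewrite cat_uniq u filter_uniq ?enum_uniq // andbT /=.
  by apply/hasPn=> v; rewrite mem_filter => /andP[].
have me l v : v \in ext l by rewrite mem_cat mem_filter mem_enum andbT orbN.
have se l : uniq l -> size (ext l) = n.
  move=> u; have /card_uniqP <- := ue l u; rewrite -[RHS]card_ord.
  by apply: eq_card => v; rewrite me inE.
move=> u1 u2 sz; pose g v := nth v (ext l2) (index v (ext l1)).
have gi : injective g.
  move=> v w; have iv := me l1 v; have iw := me l1 w; rewrite -index_mem se // in iv; rewrite -index_mem se // in iw.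
  rewrite /g (set_nth_default v w) ?se // => /eqP; rewrite nth_uniq ?se ?ue // => /eqP E.
  by rewrite -(nth_index v (me l1 v)) E nth_index.
exists (perm gi); case: l1 u1 sz @g gi => [|v0 l1] u1 sz g gi; first by case: l2 u2 sz g gi.
apply: (@eq_from_nth _ v0) => [|i]; rewrite size_map // => il.
rewrite (nth_map v0) // permE /g.
rewrite index_cat mem_nth // index_uniq // nth_cat -sz il.
by apply: set_nth_default; rewrite -sz.
Qed.

(** Outer angles are reflex and a vertex has one reflex angle, so the outer walk passes each of its
    vertices once and [nouter] is its length. *)
Lemma outer_cycle (T : cemb n) d : is4PPT T -> d \in outer T ->
  [/\ outer T = face T d, fingraph.order (phi T) d = nouter T &
      uniq (map snd (fingraph.orbit (phi T) d))].
Proof.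
move=> ppT dO; have sT := is4PPT_simple ppT; have rT := is4PPT_rot ppT.
have [oE _] := face_in sT rT (outer_face ppT) dO.
have inj2 : {in outer T &, injective snd}.
  move=> [u v] [u' v'] h h' /= E; subst v'; congr (_, _).
  by apply: (reflex_uniq ppT (v := v)); apply: (outer_reflex ppT).
split=> //.
  by rewrite /nouter (card_in_imset inj2) oE face_order.
rewrite map_inj_in_uniq ?orbit_uniq // => x y.
by rewrite -!fconnect_orbit => hx hy; apply: inj2; rewrite oE inE.
Qed.

(** It suffices to match the heads of the outer darts in cyclic order, since the tail of each dart
    is the head of the one before. *)
Lemma outer_relabel (T1 T2 : cemb n) : is4PPT T1 -> is4PPT T2 -> nouter T1 = nouter T2 ->
  0 < nouter T1 -> exists s, outer (relabel s T2) = outer T1.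
Proof.
move=> pp1 pp2 hE h0.
have ex (T : cemb n) : 0 < nouter T -> exists d, d \in outer T.
  by move=> h; have /card_gt0P[v /imsetP[d dO _]] := h; exists d.
have [d1 dO1] := ex _ h0; have [d2 dO2] : exists d, d \in outer T2 by apply: ex; rewrite -hE.
have [o1 c1 u1] := outer_cycle pp1 dO1; have [o2 c2 u2] := outer_cycle pp2 dO2.
have i1 := phi_inj (is4PPT_simple pp1) (is4PPT_rot pp1).
have i2 := phi_inj (is4PPT_simple pp2) (is4PPT_rot pp2).
have [|s E] := perm_map_ex u2 u1; first by rewrite !size_map !size_orbit c1 c2.
(* The case [k = nouter T1] returns to the start and is what closes the cycle. *)
have H k : k <= nouter T1 -> s (iter k (phi T2) d2).2 = (iter k (phi T1) d1).2.
  have lt i : i < nouter T1 -> s (iter i (phi T2) d2).2 = (iter i (phi T1) d1).2.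
    move=> il; have := congr1 (nth (s d2.2) ^~ i) E.
    rewrite -map_comp (nth_map d2) ?size_orbit ?c2 -?hE // (nth_map d1) ?size_orbit ?c1 //.
    by rewrite /orbit !nth_traject ?c1 ?c2 -?hE.
  rewrite leq_eqVlt => /orP[/eqP->|/lt //].
  have -> : iter (nouter T1) (phi T2) d2 = d2 by rewrite hE -c2 iter_order.
  have -> : iter (nouter T1) (phi T1) d1 = d1 by rewrite -c1 iter_order.
  exact: lt 0 h0.
exists s; apply/eqP; rewrite eqEcard; apply/andP; split.
  apply/subsetP=> e /imsetP[d dO ->]; rewrite o1 inE.
  have : fconnect (phi T2) (phi T2 d2) d by rewrite -same_fconnect1 //; move: dO; rewrite o2 inE.
  move=> fd; have := findex_max fd; have := iter_findex fd.
  have -> : fingraph.order (phi T2) (phi T2 d2) = nouter T1.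
    rewrite hE -c2; apply: eq_card => x; rewrite !inE; apply/esym; exact: same_fconnect1.
  move: (findex _ _ _) => k <- lk; rewrite -iterSr; suff -> : (s (iter k.+1 (phi T2) d2).1, s (iter k.+1 (phi T2) d2).2) = iter k.+1 (phi T1) d1.
    exact: fconnect_iter.
  rewrite (H k.+1) // iterS [X in s X]/= (H k) ?(ltnW lk) // iterS.
rewrite card_imset; last exact: pdart_inj.
by rewrite o1 o2 !face_order c1 c2 hE.
Qed.

End Relabel.

Theorem theorem4 :
  exists C : nat, forall n h : nat, 3 <= h <= n ->
    (* unlabeled: flips from T1 reach (an isomorphic copy of) T2 in <= C n^2 steps *)
    (forall T1 T2 : cemb n, is4PPT T1 -> is4PPT T2 ->
       nouter T1 = h -> nouter T2 = h ->
       exists k (T : cemb n), k <= C * n ^ 2 /\ flips k T1 T /\ iso T T2) /\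
    (* labeled: same labeled vertices, same outer face (same cyclic order) *)
    (forall T1 T2 : cemb n, is4PPT T1 -> is4PPT T2 ->
       nouter T1 = h -> outer T1 = outer T2 ->
       exists k, k <= C * n ^ 2 /\ flips k T1 T2).
Proof.
exists 47 => n h /andP[h3 _].
have hO (T : cemb n) : nouter T = h -> 2 < #|outer T|.
  by move=> E; apply: leq_trans (leq_imset_card snd _); rewrite -[#|_|]/(nouter T) E.
split=> T1 T2 pp1 pp2 h1.
  move=> h2; have [||s E] := @outer_relabel n T1 T2 pp1 pp2; rewrite ?h1 ?h2 //.
    exact: leq_trans h3.
  have [k [kn F]] := labeled_flips pp1 (relabel_4PPT s pp2) (hO _ h1) (esym E).
  by exists k, (relabel s T2); split=> //; split=> //; exists (s^-1)%g; apply: relabelK.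
exact: labeled_flips pp1 pp2 (hO _ h1).
Qed.
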